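(* Let $k\in\mathbb{Z}$ and let $m=r+64k$ be a square-free integer with $m\neq 0,\pm1$. Let $K=\mathbb{Q}(\sqrt[8]{m})$. If \[r\in\{2,3,6,7,10,11,14,15,18,19,22,23,26,27,30,31,34,35,38,39,42,43,46,47,50,51,54,55,58,59,62,63\},\] then $K$ is monogenic. If \[r\in\{1,5,9,13,17,21,25,29,33,37,41,45,49,53,57,61\}\] and $m\neq 5$, then $K$ is not monogenic, with the exception of $K=\mathbb{Q}(\sqrt[8]{-3})$, which is monogenic.
   Context: A number field $K$ with ring of integers $\mathbb{Z}_K$ is called monogenic if there exists $\alpha\in\mathbb{Z}_K$ with $\mathbb{Z}_K=\mathbb{Z}[\alpha]$, i.e. $(1,\alpha,\ldots,\alpha^{\deg K-1})$ is an integral basis (a power integral basis). *)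

(* Defs.v *)
From HB Require Import structures.
From mathcomp Require Import all_boot all_order all_algebra all_field.

Set Implicit Arguments.
Unset Strict Implicit.
Unset Printing Implicit Defensive.

Import GRing.Theory.
Local Open Scope ring_scope.

Definition squarefreez (m : int) : Prop :=
  forall d : int, (d ^+ 2 %| m)%Z -> d \is a GRing.unit.

(* A number field is a [fieldExtType rat]: a field of finite degree over rat. *)
Definition in_ring_of_integers (K : fieldExtType rat) (x : K) : Prop :=
  integralOver (intr : int -> K) x.

Definition in_Zadjoin (K : fieldExtType rat) (alpha x : K) : Prop :=
  exists p : {poly int}, x = (map_poly (intr : int -> K) p).[alpha].

Definition monogenic (K : fieldExtType rat) : Prop :=
  exists2 alpha : K, in_ring_of_integers alpha &
    forall x : K, in_ring_of_integers x <-> in_Zadjoin alpha x.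

(* K = Q(theta) with theta an n-th root of m.  When 'X^n - m is irreducible
   over rat this determines K up to isomorphism, whichever root theta is. *)
Definition is_pure_field (n : nat) (m : int) (K : fieldExtType rat) : Prop :=
  exists2 theta : K, theta ^+ n = m%:~R & <<1; theta>>%VS = {:K}%VS.

(* Main.v *)
Require Import Defs.
From HB Require Import structures.
From mathcomp Require Import all_boot all_order all_algebra all_field.
From mathcomp Require Import ring lra zify.
Set Implicit Arguments.
Unset Strict Implicit.
Unset Printing Implicit Defensive.
Import GRing.Theory Num.Theory.
Local Open Scope ring_scope.

(** Let [theta ^+ 8 = m], [r = theta ^+ 4] and let [alpha_j] be the image of [alpha] under
    [theta |-> zeta ^+ j * theta], [zeta] a primitive eighth root of unity.

    For [m = 2, 3 mod 4] the polynomial [X^8 - m], or its translate by 1, is Eisenstein at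
    2, and [8 * a_i * theta ^+ i] integral with [m] square-free bounds the remaining
    denominators, so Z[theta] is the ring of integers.

    Let [m = 1 mod 4] and suppose that the ring of integers is Z[alpha].  For every integer
    [beta] the difference [alpha_j - alpha_k] divides [beta_j - beta_k].  Taking
    [beta = (1 + r) / 2] and [beta = theta], the product of the sixteen
    [alpha_j - alpha_k] with [j - k] odd is [m ^+ 2 * C] with [C = 1] or [-1]; and the
    product [A] of the four [(alpha_j - alpha_(j+4)) / (2 * theta_j)] has an integral
    inverse.  Modulo [m] these are [C = 16 * a ^+ 16] and [A = a ^+ 4], where [a] is the
    coefficient of [theta] in [alpha].
    - If [m <> 1 mod 16], the tower Q(r), Q(theta ^+ 2), Q(theta) shows that [A] is an
      integer, so [m] divides 15 or 17.
    - If [m = 1 mod 16], the integer [(1 + theta + ... + theta ^+ 7) / 8] must have an odd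
      coefficient in [alpha].  Now [C] is the norm of an element [xi] of the biquadratic
      field Q(sqrt 2, sqrt (-m)).  If [m = 1 mod 32], [C] is even.  If [m = 17 mod 32],
      then [A = 1/2] or [-1/2]; as [A] is a norm from Q(sqrt m), [m] is not negative; and
      for positive [m] the parity of [C] and [2 * A] makes the coefficient of
      [sqrt (-m)] in [xi] nonzero, which forces [4 * C >= m ^+ 2]. *)

(** The two test integers cover complementary primes. For odd [j - k] the conjugates of
    [(1 + r) / 2] differ by [r] up to sign, so [C] divides a power of [m]; those of [theta] differ,
    up to a unit, by [theta] times a number of norm 2, so [C] divides 16. As [m] is odd, this leaves
    [C = 1] or [-1]. If [A] is an integer, it is 1 or -1, and [C = 16 * A ^+ 4 = 16] modulo [m]. The
    divisors of 15 and 17 that are 1 modulo 4 but not 1 modulo 16 are -3 and 5: this is the origin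
    of the two special values in the theorem. For [m = 1 mod 16] the integer with denominator 8
    turns [A] into [1/2] or [-1/2]. Then [16 * A ^+ 4 = 1], and the congruence modulo [m] is
    compatible with [C = 1]. The contradiction has to come from the prime 2 and from the archimedean
    size of the norm. *)

Lemma squarefreez_prime (m : int) (p : nat) :
  squarefreez m -> prime p -> ~~ (p%:Z ^+ 2 %| m)%Z.
Proof.
move=> sq_m p_pr; apply/negP => /sq_m; have := prime_gt1 p_pr; lia.
Qed.

(** Eisenstein at any prime factor of [m], which exists because [m] is not a unit. *)
Lemma irreducible_pure (m : int) (n : nat) : squarefreez m ->
  m <> 0 -> m <> 1 -> m <> -1 -> (0 < n)%N ->
  irreducible_poly ('X^n - (m%:~R)%:P : {poly rat}).
Proof.
move=> sq_m m0 m1 mN1 n_gt0.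
have m_gt1 : (1 < `|m|)%N by lia.
pose p := pdiv `|m|%N; have p_pr : prime p := pdiv_prime m_gt1.
have p_m : (p %| m)%Z by rewrite dvdzE /= pdiv_dvd.
have -> : 'X^n - (m%:~R)%:P = map_poly intr ('X^n - m%:P) :> {poly rat}.
  by rewrite rmorphB /= map_polyXn map_polyC.
apply/irreducible_rat_int/(eisenstein_crit p_pr).
- by rewrite size_XnsubC // eqSS -lt0n.
- rewrite (monicP (monicXnsubC _ n_gt0)); apply/negP.
  by rewrite dvdzE /= dvdn1 => /eqP p1; move: p_pr; rewrite p1.
- rewrite coefB coefXn coefC eqxx eq_sym (negPf (lt0n_neq0 n_gt0)) sub0r.
  by rewrite rpredN squarefreez_prime.
rewrite size_XnsubC //= => i lt_in; rewrite coefB coefXn coefC (ltn_eqF lt_in) sub0r.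
by case: eqP => _; rewrite rpredN // rpred0.
Qed.

Lemma irreducible_root_dvdp (F L : fieldType) (f : {rmorphism F -> L})
    (p q : {poly F}) (x : L) : irreducible_poly p ->
  root (map_poly f p) x -> root (map_poly f q) x -> p %| q.
Proof.
move=> irr_p px qx; apply/negPn/negP; rewrite -irreducible_poly_coprime //.
rewrite -(coprimep_map f) => /coprimep_root/(_ px).
by rewrite (rootP qx) eqxx.
Qed.

(** * Transfer between [K] and the complex roots of [X^8 - m] *)

Section Transfer.

Variables (m : int) (K : fieldExtType rat) (theta : K).
Hypothesis m_irr : irreducible_poly ('X^8 - (m%:~R)%:P : {poly rat}).
Hypothesis theta8 : theta ^+ 8 = m%:~R.
Hypothesis theta_gen : <<1; theta>>%VS = {:K}%VS.

Definition evalK (A : {poly rat}) : K := (map_poly (in_alg K) A).[theta].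
Definition evalC (z : algC) (A : {poly rat}) : algC := (map_poly ratr A).[z].

Lemma evalK_sub A B : evalK (A - B) = evalK A - evalK B.
Proof. by rewrite /evalK rmorphB hornerD hornerN. Qed.

Lemma evalC_sub z A B : evalC z (A - B) = evalC z A - evalC z B.
Proof. by rewrite /evalC rmorphB hornerD hornerN. Qed.

Lemma root_pureK : root (map_poly (in_alg K) ('X^8 - (m%:~R)%:P)) theta.
Proof.
rewrite rmorphB /= map_polyXn map_polyC rootE !hornerE theta8.
by rewrite -(rmorph_int (in_alg K)) subrr.
Qed.

Lemma root_pureC z : z ^+ 8 = m%:~R ->
  root (map_poly (ratr : rat -> algC) ('X^8 - (m%:~R)%:P)) z.
Proof.
move=> z8; rewrite rmorphB /= map_polyXn map_polyC /= rootE !hornerE z8.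
by rewrite rmorph_int subrr.
Qed.

Lemma evalK_eq0 A : evalK A = 0 -> 'X^8 - (m%:~R)%:P %| A.
Proof.
by move=> A0; apply: irreducible_root_dvdp m_irr root_pureK _; apply/rootP.
Qed.

Lemma evalC_eq0 z A : z ^+ 8 = m%:~R -> evalC z A = 0 -> 'X^8 - (m%:~R)%:P %| A.
Proof.
move=> z8 A0.
by apply: (irreducible_root_dvdp m_irr (root_pureC z8)); apply/rootP.
Qed.

Lemma dvdp_evalK A : 'X^8 - (m%:~R)%:P %| A -> evalK A = 0.
Proof.
case/dvdpP => q ->; rewrite /evalK rmorphM /= hornerM.
by rewrite (rootP root_pureK) mulr0.
Qed.

Lemma dvdp_evalC z A : z ^+ 8 = m%:~R -> 'X^8 - (m%:~R)%:P %| A -> evalC z A = 0.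
Proof.
move=> z8 /dvdpP[q ->]; rewrite /evalC rmorphM /= hornerM.
by rewrite (rootP (root_pureC z8)) mulr0.
Qed.

(** By irreducibility all these evaluations have the same kernel, the multiples of [X^8 - m]. An
    identity found at [theta] or at one complex root thus holds at every complex root, which plays
    the role of the embeddings of [K]. *)
Lemma eq_evalK_evalC z A B : z ^+ 8 = m%:~R ->
  evalK A = evalK B <-> evalC z A = evalC z B.
Proof.
move=> z8; split=> /eqP; rewrite -subr_eq0.
  rewrite -evalK_sub => /eqP/evalK_eq0/(dvdp_evalC z8)/eqP.
  by rewrite evalC_sub subr_eq0 => /eqP.
rewrite -evalC_sub => /eqP/(evalC_eq0 z8)/dvdp_evalK/eqP.
by rewrite evalK_sub subr_eq0 => /eqP.
Qed.

Lemma evalK_surj x : exists2 A : {poly rat}, (size A <= 8)%N & x = evalK A.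
Proof.
have: x \in <<1; theta>>%VS by rewrite theta_gen memvf.
case/Fadjoin_polyP => P /polyOver1P[A ->] ->.
exists (A %% ('X^8 - (m%:~R)%:P)).
  rewrite -ltnS -(size_XnsubC (m%:~R : rat) (isT : 0 < 8)%N) ltn_modp -size_poly_gt0.
  by rewrite size_XnsubC.
apply/eqP; rewrite -subr_eq0 -/(evalK _) -evalK_sub; apply/eqP/dvdp_evalK.
by rewrite {1}[A](divp_eq A ('X^8 - (m%:~R)%:P)) addrK dvdp_mull.
Qed.

Lemma evalK_comp (p : {poly int}) A :
  evalK (map_poly intr p \Po A) = (map_poly intr p).[evalK A].
Proof.
rewrite /evalK map_comp_poly horner_comp -map_poly_comp.
by congr (_.[_]); apply: eq_map_poly => i; rewrite /= -(rmorph_int (in_alg K)).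
Qed.

Lemma evalC_comp z (p : {poly int}) A :
  evalC z (map_poly intr p \Po A) = (map_poly intr p).[evalC z A].
Proof.
rewrite /evalC map_comp_poly horner_comp -map_poly_comp.
by congr (_.[_]); apply: eq_map_poly => i /=; rewrite rmorph_int.
Qed.

Lemma evalC0 z : evalC z 0 = 0.
Proof. by rewrite /evalC rmorph0 horner0. Qed.

Lemma evalK0 : evalK 0 = 0.
Proof. by rewrite /evalK rmorph0 horner0. Qed.

Lemma integral_evalK z A : z ^+ 8 = m%:~R ->
  in_ring_of_integers (evalK A) <-> evalC z A \in Aint.
Proof.
move=> z8; split=> [[p p_mon /rootP]|].
  rewrite -evalK_comp -evalK0 => /(eq_evalK_evalC _ _ z8).
  rewrite evalC0 evalC_comp => /rootP p0.
  apply: root_monic_Aint p0 _ _; first exact: monic_map.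
  by apply/polyOverP => i; rewrite coef_map intr_int.
move=> intA; have /floorpP[p Dp] : minCpoly (evalC z A) \is a polyOver Num.int by [].
have := root_minCpoly (evalC z A); rewrite Dp => /rootP.
rewrite -evalC_comp -(evalC0 z) => /(eq_evalK_evalC _ _ z8).
rewrite evalK0 evalK_comp => /rootP p0; exists p => //.
rewrite monicE -(inj_eq (intr_inj (R := algC))) -lead_coef_map_inj; last 2 first.
- exact: intr_inj.
- by rewrite rmorph0.
by rewrite -Dp (monicP (minCpoly_monic _)).
Qed.

Lemma Zadjoin_evalK z A B : z ^+ 8 = m%:~R ->
  in_Zadjoin (evalK A) (evalK B) <->
  exists p : {poly int}, evalC z B = (map_poly intr p).[evalC z A].
Proof.
move=> z8; split=> -[p Dp]; exists p; move: Dp.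
  by rewrite -evalK_comp -evalC_comp => /(eq_evalK_evalC _ _ z8).
by rewrite -evalK_comp -evalC_comp => /(eq_evalK_evalC _ _ z8).
Qed.

End Transfer.

(** * Integrality criteria and parity of integers *)

Lemma ratr_Aint (q : rat) : (ratr q : algC) \in Aint -> exists k : int, q = k%:~R.
Proof.
move=> qA; have /intrP[k Dk] : (ratr q : algC) \in Num.int.
  by apply: Cint_rat_Aint qA; apply: Crat_rat.
exists k; apply: (fmorph_inj (ratr : {rmorphism rat -> algC})); rewrite /= Dk.
by rewrite /= ratr_int.
Qed.

Lemma coprime_Aint (a b : int) (x : algC) : coprimez a b ->
  a%:~R * x \in Aint -> b%:~R * x \in Aint -> x \in Aint.
Proof.
case/coprimezP => -[u v] /= uv1 ax bx.
have -> : x = u%:~R * (a%:~R * x) + v%:~R * (b%:~R * x).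
  by rewrite !mulrA -!intrM -mulrDl -intrD uv1 mul1r.
by rewrite rpredD // rpredM // Aint_int.
Qed.

Lemma Aint_root_pure (n : nat) (m : int) (z : algC) :
  (0 < n)%N -> z ^+ n = m%:~R -> z \in Aint.
Proof.
move=> n_gt0 zn; apply: (@root_monic_Aint ('X^n - (m%:~R)%:P)).
- by rewrite rootE !hornerE zn subrr.
- exact: monicXnsubC.
apply/polyOverP => i; rewrite coefB coefXn coefC rpredB ?rpred_nat //.
by case: ifP => _; rewrite ?rpred0 ?intr_int.
Qed.

(** Compare valuations at a prime of the denominator of [q]: it occurs at least [n] times in the
    denominator of [q ^+ n], while [m ^+ i] supplies at most [i < n] factors to cancel it. *)
Lemma sqfree_pow_int (m : int) (n i : nat) (q : rat) : squarefreez m ->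
  m <> 0 -> (i < n)%N -> (exists c : int, q ^+ n * m%:~R ^+ i = c%:~R) ->
  exists k : int, q = k%:~R.
Proof.
move=> sq_m m0 lt_in [c Dc].
have [->|q0] := eqVneq q 0; first by exists 0.
suff d1 : denq q = 1 by exists (numq q); rewrite -[LHS]divq_num_den d1 divr1.
have E : numq q ^+ n * m ^+ i = c * denq q ^+ n.
  apply: (@intr_inj rat); rewrite !rmorphM !rmorphXn /= -Dc mulrAC.
  by rewrite -[X in X ^+ n * _ ^+ n]divq_num_den expr_div_n divfK // expf_neq0 // intr_eq0 denq_eq0.
have Dd : denq q = `|denq q|%N by rewrite absz_denq.
apply/eqP; rewrite Dd; apply/negPn/negP => d1.
have d_gt1 : (1 < `|denq q|)%N by have := denq_gt0 q; lia.
set p := pdiv `|denq q|%N; have p_pr : prime p := pdiv_prime d_gt1.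
have pd : (p %| `|denq q|)%N := pdiv_dvd _.
have n0 : (0 < `|numq q|)%N by rewrite absz_gt0 numq_eq0.
have pn : logn p `|numq q|%N = 0%N.
  apply/eqP; rewrite -leqn0 leqNgt logn_gt0 mem_primes p_pr n0 /=.
  apply/negP => pn; have := coprime_num_den q.
  rewrite /coprime => /eqP g1; have : (p %| 1)%N by rewrite -g1 dvdn_gcd pn.
  by rewrite dvdn1 => /eqP p1; move: p_pr; rewrite p1.
have pm : (logn p `|m|%N <= 1)%N.
  rewrite leqNgt -pfactor_dvdn //; last by rewrite absz_gt0; apply/eqP.
  by have := squarefreez_prime sq_m p_pr; rewrite dvdzE abszX.
move: (congr1 absz E); rewrite !abszM !abszX => /(congr1 (logn p)).
have c0 : (0 < `|c|)%N.
  rewrite absz_gt0; apply/eqP => c0; move: Dc; rewrite c0 => /eqP.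
  by rewrite mulf_eq0 !expf_eq0 (negPf q0) intr_eq0 (negPf (introN eqP m0)) !andbF.
have m_gt0 : (0 < `|m|)%N by rewrite absz_gt0; apply/eqP.
have d_gt0 := ltnW d_gt1.
rewrite !lognM ?expn_gt0 ?n0 ?c0 ?m_gt0 ?d_gt0 // !lognX pn muln0 add0n => F.
have ld : (0 < logn p `|denq q|)%N by rewrite logn_gt0 mem_primes p_pr d_gt0.
have : (i * logn p `|m| <= i)%N by rewrite -[leqRHS]muln1 leq_mul2l pm orbT.
rewrite F leqNgt => /negP; apply.
by rewrite (leq_trans lt_in) // (leq_trans _ (leq_addl _ _)) // leq_pmulr.
Qed.

Definition oddz (x : int) : bool := odd `|x|%N.
Arguments oddz : simpl never.

Lemma oddzE x : exists y : int, x = 2 * y + (oddz x)%:Z.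
Proof. exists ((x - (oddz x)%:Z) %/ 2)%Z; rewrite /oddz; lia. Qed.

Lemma oddzD x y : oddz (x + y) = oddz x (+) oddz y.
Proof. rewrite /oddz; lia. Qed.

Lemma oddzN x : oddz (- x) = oddz x.
Proof. by rewrite /oddz abszN. Qed.

Lemma oddzM x y : oddz (x * y) = oddz x && oddz y.
Proof. by rewrite /oddz abszM oddM. Qed.

Lemma oddzX x n : oddz (x ^+ n) = (n == 0%N) || oddz x.
Proof. by rewrite /oddz abszX oddX. Qed.

Definition oddz_simp := (oddzD, oddzN, oddzM, oddzX).

Lemma even_oddz x : oddz x = false -> exists y : int, x = 2 * y.
Proof. by move=> x0; have [y] := oddzE x; rewrite x0 addr0; exists y. Qed.

(** * Denominators of the coefficients of an integral element *)

Definition lin2 (p q : rat) (r : algC) : algC := ratr p + ratr q * r.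

Definition lin4 (c0 c1 c2 c3 : rat) (x : algC) : algC :=
  ratr c0 + ratr c1 * x + ratr c2 * x ^+ 2 + ratr c3 * x ^+ 3.

Definition lin8 (a0 a1 a2 a3 a4 a5 a6 a7 : rat) (z : algC) : algC :=
  ratr a0 + ratr a1 * z + ratr a2 * z ^+ 2 + ratr a3 * z ^+ 3
  + ratr a4 * z ^+ 4 + ratr a5 * z ^+ 5 + ratr a6 * z ^+ 6 + ratr a7 * z ^+ 7.

Lemma root8_exists : exists zeta : algC, zeta ^+ 4 = -1.
Proof. by exists (4.-root (-1)); rewrite rootCK. Qed.

Section Coefficients.

Variable m : int.
Hypothesis sq_m : squarefreez m.
Hypothesis m_neq0 : m <> 0.

Lemma coef_pow_int (n i : nat) (q : rat) (z : algC) :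
  z ^+ n = m%:~R -> (i < n)%N -> ratr q * z ^+ i \in Aint ->
  exists k : int, q = k%:~R.
Proof.
move=> zn lt_in qz; apply: (sqfree_pow_int sq_m m_neq0 lt_in).
apply: ratr_Aint; rewrite rmorphM !rmorphXn /= ratr_int -zn -exprM mulnC exprM.
by rewrite -exprMn rpredX.
Qed.

(** Since [z] divides [m], also [m * x] is integral, and [m] is coprime to the power of 2. This
    serves to divide an integral odd part by its factor [theta]. *)
Lemma odd_strip (n : nat) (z x : algC) (k : nat) : oddz m -> (0 < n)%N ->
  z ^+ n = m%:~R -> z * x \in Aint -> 2 ^+ k * x \in Aint -> x \in Aint.
Proof.
move=> m_odd n_gt0 zn zx kx; apply: (@coprime_Aint m (2 ^+ k)).
- by rewrite coprimezE abszX coprimeXr // coprime_sym coprime2n.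
- by rewrite -zn -(prednK n_gt0) exprSr -mulrA rpredM // rpredX // (Aint_root_pure n_gt0 zn).
by rewrite rmorphXn.
Qed.

Lemma integral2_half (p q : rat) :
  (forall r : algC, r ^+ 2 = m%:~R -> lin2 p q r \in Aint) ->
  exists X Y : int, [/\ p = X%:~R / 2, q = Y%:~R / 2 &
    exists c : int, X ^+ 2 - m * Y ^+ 2 = 4 * c].
Proof.
move=> pq; pose r : algC := sqrtC m%:~R; have r2 : r ^+ 2 = m%:~R by rewrite sqrtCK.
have P1 := pq r r2; have P2 : lin2 p q (- r) \in Aint by apply: pq; rewrite sqrrN.
have [X DX] : exists k : int, 2 * p = k%:~R.
  apply: ratr_Aint; have -> : ratr (2 * p) = lin2 p q r + lin2 p q (- r).
    by rewrite /lin2; ring.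
  by rewrite rpredD.
have [Y DY] : exists k : int, 2 * q = k%:~R.
  apply: (@coef_pow_int 2 1 _ r) => //.
  have -> : ratr (2 * q) * r ^+ 1 = lin2 p q r - lin2 p q (- r).
    by rewrite /lin2; ring.
  by rewrite rpredB.
have [c Dc] : exists k : int, p ^+ 2 - m%:~R * q ^+ 2 = k%:~R.
  apply: ratr_Aint.
  have -> : ratr (p ^+ 2 - m%:~R * q ^+ 2) = lin2 p q r * lin2 p q (- r).
    by rewrite /lin2; ring: r2.
  by rewrite rpredM.
exists X, Y; split; [by rewrite -DX; field | by rewrite -DY; field |].
exists c; apply: (@intr_inj rat).
have -> : (X ^+ 2 - m * Y ^+ 2)%:~R = X%:~R ^+ 2 - m%:~R * Y%:~R ^+ 2 :> rat by ring.
have -> : (4 * c)%:~R = 4 * c%:~R :> rat by ring.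
by rewrite -DX -DY -Dc; ring.
Qed.

Lemma integral8_coef (a0 a1 a2 a3 a4 a5 a6 a7 : rat) :
  (forall z : algC, z ^+ 8 = m%:~R -> lin8 a0 a1 a2 a3 a4 a5 a6 a7 z \in Aint) ->
  exists b : nat -> int, forall i, (i < 8)%N ->
    nth 0 [:: a0; a1; a2; a3; a4; a5; a6; a7] i = (b i)%:~R / 8.
Proof.
move=> aA; pose z : algC := 8.-root m%:~R; have z8 : z ^+ 8 = m%:~R by rewrite rootCK.
have [w w4] := root8_exists.
have wA : w \in Aint by apply: (@Aint_root_pure 4 (-1)).
set L := lin8 _ _ _ _ _ _ _ _ in aA.
have LA j : L (w ^+ j * z) \in Aint.
  apply: aA; rewrite exprMn z8 -exprM mulnC exprM (exprM w 4 2) w4.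
  by rewrite sqrrN expr1n expr1n mul1r.
(* A discrete Fourier transform over the eight conjugates: as [w ^+ 8 = 1], the weight is the
   inverse of [w ^+ (i * j)], and [S i] isolates the term in [z ^+ i]. *)
pose S i := \sum_(j < 8) w ^+ (j * (8 - i)) * L (w ^+ j * z).
have SA i : S i \in Aint by rewrite rpred_sum // => j _; rewrite rpredM ?rpredX.
have SE i : (i < 8)%N ->
    S i = ratr (8 * nth 0 [:: a0; a1; a2; a3; a4; a5; a6; a7] i) * z ^+ i.
  rewrite /S !big_ord_recr big_ord0 /=.
  by do 8![case: i => [|i] /=; first by move=> _; rewrite /L /lin8; ring: w4].
exists (fun i => numq (8 * nth 0 [:: a0; a1; a2; a3; a4; a5; a6; a7] i)) => i lt_i.
have [k Dk] : exists k : int, 8 * nth 0 [:: a0; a1; a2; a3; a4; a5; a6; a7] i = k%:~R.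
  by apply: (@coef_pow_int 8 i _ z) => //; rewrite -SE.
by rewrite Dk numq_int -Dk; field.
Qed.

End Coefficients.

(** * Monogenicity expressed through complex conjugates *)

Definition polyZC (p : {poly int}) : {poly algC} := map_poly intr p.

Lemma polyZC_Aint (p : {poly int}) (x : algC) : x \in Aint -> (polyZC p).[x] \in Aint.
Proof.
move=> xA; apply: rpred_horner => //; apply/polyOverP => i.
by rewrite coef_map Aint_int.
Qed.

Lemma evalC_lin8 (B : {poly rat}) (z : algC) : (size B <= 8)%N ->
  evalC z B = lin8 B`_0 B`_1 B`_2 B`_3 B`_4 B`_5 B`_6 B`_7 z.
Proof.
move=> sB; rewrite /evalC (@horner_coef_wide _ 8); last by rewrite size_map_poly.
by rewrite !big_ord_recr big_ord0 /= !coef_map /lin8 /= expr0 mulr1 add0r expr1.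
Qed.

(** One root [z] suffices in the last premise, because the identity found there transfers to
    [theta]. *)
Lemma monogenic_of_generator (m : int) (K : fieldExtType rat) (A : {poly rat}) :
    irreducible_poly ('X^8 - (m%:~R)%:P : {poly rat}) -> is_pure_field 8 m K ->
    (forall z : algC, z ^+ 8 = m%:~R -> evalC z A \in Aint) ->
    (forall B : {poly rat}, (size B <= 8)%N ->
      (forall z : algC, z ^+ 8 = m%:~R -> evalC z B \in Aint) ->
      exists p z, z ^+ 8 = m%:~R /\ evalC z B = (polyZC p).[evalC z A]) ->
  monogenic K.
Proof.
move=> irr_m [theta theta8 gen] A_int genA.
pose z0 : algC := 8.-root m%:~R; have z8 : z0 ^+ 8 = m%:~R by rewrite rootCK.
exists (evalK theta A); first by apply/(integral_evalK irr_m theta8 A z8)/A_int.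
move=> x; have [B sB ->] := evalK_surj theta8 gen x; split.
  move=> B_int; have [z z8'|p [z [z8' E]]] := genA B sB.
    exact/(integral_evalK irr_m theta8 B z8').
  by apply/(Zadjoin_evalK irr_m theta8 A B z8'); exists p.
case/(Zadjoin_evalK irr_m theta8 A B z8) => p E.
by apply/(integral_evalK irr_m theta8 B z8); rewrite E polyZC_Aint ?A_int.
Qed.

(** The same [p] serves all the roots [z]; this is what allows differences of conjugates to be
    compared. *)
Lemma monogenic_generator (m : int) (K : fieldExtType rat) :
    irreducible_poly ('X^8 - (m%:~R)%:P : {poly rat}) -> is_pure_field 8 m K ->
    monogenic K ->
  exists2 A : {poly rat}, (size A <= 8)%N &
    (forall z : algC, z ^+ 8 = m%:~R -> evalC z A \in Aint) /\
    forall B : {poly rat}, (forall z : algC, z ^+ 8 = m%:~R -> evalC z B \in Aint) ->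
      exists p, forall z, z ^+ 8 = m%:~R -> evalC z B = (polyZC p).[evalC z A].
Proof.
move=> irr_m [theta theta8 gen] [alpha].
pose z0 : algC := 8.-root m%:~R; have z8 : z0 ^+ 8 = m%:~R by rewrite rootCK.
have [A sA ->] := evalK_surj theta8 gen alpha => A_int ringE.
exists A => //; split=> [z zE|B B_int]; first exact/(integral_evalK irr_m theta8 A zE).
have /ringE[p Dp] : in_ring_of_integers (evalK theta B).
  by apply/(integral_evalK irr_m theta8 B z8)/B_int.
exists p => z zE; move: Dp; rewrite -evalK_comp -evalC_comp.
by move/(eq_evalK_evalC irr_m theta8 _ _ zE).
Qed.

(** * The case [m = 2, 3 mod 4]: Eisenstein polynomials at 2 *)

Lemma eisenstein_even (rho : nat -> algC) (N : int) (b : nat -> int) :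
    (forall j, rho j \in Aint) -> (forall j, rho j ^+ 8 / 2 \in Aint) ->
    \prod_(j < 8) rho j = (2 * N)%:~R -> oddz N ->
    (forall j, (\sum_(i < 8) (b i)%:~R * rho j ^+ i) / 2 \in Aint) ->
  forall i, (i < 8)%N -> oddz (b i) = false.
Proof.
move=> rhoA rho8 rhoN N_odd bA i; elim/ltn_ind: i => i IH lt_i.
(* After multiplication by [rho j ^+ (7 - i)], the terms below [i] have even coefficients by
   induction and those above contain [rho j ^+ 8]. The term that is left has product
   [b i ^+ 8 * N ^+ 7 / 2] over the conjugates, with [N] odd. *)
have term j : (b i)%:~R * rho j ^+ 7 / 2 \in Aint.
  have := rpredM (bA j) (rpredX (7 - i) (rhoA j)).
  rewrite (bigD1 (Ordinal lt_i)) //= mulrDl mulrDl rpredDr.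
    have -> : (b i)%:~R * rho j ^+ i / 2 * rho j ^+ (7 - i)
            = (b i)%:~R * (rho j ^+ i * rho j ^+ (7 - i)) / 2 by ring.
    by rewrite -exprD subnKC // -ltnS.
  rewrite mulr_suml mulr_suml rpred_sum // => k ki.
  have -> : (b k)%:~R * rho j ^+ k / 2 * rho j ^+ (7 - i)
            = (b k)%:~R * rho j ^+ (k + (7 - i)) / 2 by rewrite exprD; ring.
  have [lt_ki|le_ik] := ltnP k i.
    have [c ->] := even_oddz (IH k lt_ki (ltn_ord k)).
    have -> : (2 * c)%:~R * rho j ^+ (k + (7 - i)) / 2 = c%:~R * rho j ^+ (k + (7 - i)) by field.
    by rewrite rpredM ?rpredX ?Aint_int.
  have lt_ik : (i < k)%N by rewrite ltn_neqAle le_ik andbT eq_sym.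
  have -> : (k + (7 - i) = (k - i).-1 + 8)%N by lia.
  by rewrite exprD -2!mulrA rpredM ?Aint_int // rpredM ?rpredX.
have [c Dc] : exists c : int, (b i)%:~R ^+ 8 * (2 * N)%:~R ^+ 7 / 2 ^+ 8 = c%:~R :> rat.
  apply: ratr_Aint.
  have -> : ratr ((b i)%:~R ^+ 8 * (2 * N)%:~R ^+ 7 / 2 ^+ 8)
      = \prod_(j < 8) ((b i)%:~R * rho j ^+ 7 / 2) :> algC.
    rewrite 2!big_split /= !prodr_const prodrXl rhoN card_ord.
    by rewrite exprVn; field.
  by rewrite rpred_prod.
have /(congr1 oddz) : b i ^+ 8 * N ^+ 7 = 2 * c.
  apply: (@intr_inj rat).
  have -> : (2 * c)%:~R = 2 * c%:~R :> rat by ring.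
  by rewrite -Dc; field.
by rewrite !oddz_simp /= N_odd andbT.
Qed.

Lemma eisenstein_pow2 (rho : nat -> algC) (N : int) (k : nat) (b : nat -> int) :
    (forall j, rho j \in Aint) -> (forall j, rho j ^+ 8 / 2 \in Aint) ->
    \prod_(j < 8) rho j = (2 * N)%:~R -> oddz N ->
    (forall j, (\sum_(i < 8) (b i)%:~R * rho j ^+ i) / 2 ^+ k \in Aint) ->
  exists c : nat -> int, forall i, (i < 8)%N -> b i = 2 ^+ k * c i.
Proof.
move=> rhoA rho8 rhoN N_odd; elim: k b => [|k IH] b bA.
  by exists b => i _; rewrite mul1r.
have half j : (\sum_(i < 8) (b i)%:~R * rho j ^+ i) / 2 \in Aint.
  have -> (x : algC) : x / 2 = x / 2 ^+ k.+1 * 2 ^+ k.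
    by rewrite exprS; field; rewrite expf_neq0 ?pnatr_eq0.
  by rewrite rpredM // rpredX // (Aint_int 2).
have b_even i : (i < 8)%N -> b i = 2 * (b i %/ 2)%Z.
  by move/(eisenstein_even rhoA rho8 rhoN N_odd half); rewrite /oddz; lia.
have [j|c Dc] := IH (fun i => b i %/ 2)%Z.
  have E : \sum_(i < 8) (b i)%:~R * rho j ^+ i
      = 2 * \sum_(i < 8) ((b i %/ 2)%Z)%:~R * rho j ^+ i.
    rewrite mulr_sumr; apply: eq_bigr => i _.
    by rewrite {1}(b_even i (ltn_ord i)) rmorphM /= mulrA.
  have := bA j; rewrite {}E exprS invfM mulrACA divff ?mul1r //.
  by rewrite pnatr_eq0.
by exists c => i lt_i; rewrite b_even // Dc // exprS mulrA.
Qed.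

(** The shift [s] makes [z - s] a root of an Eisenstein polynomial at 2. Expanding the numerator in
    powers of [z - s] keeps integer coefficients, and there its divisibility by the denominator 8
    can be tested. *)
Lemma pure_Zadjoin (m : int) (s N : int) (B : {poly rat}) (z w : algC) :
    squarefreez m -> m <> 0 -> z ^+ 8 = m%:~R -> w ^+ 4 = -1 ->
    (forall j : nat, (w ^+ j * z - s%:~R) ^+ 8 / 2 \in Aint) ->
    \prod_(j < 8) (w ^+ j * z - s%:~R) = (2 * N)%:~R -> oddz N ->
    (size B <= 8)%N ->
    (forall y : algC, y ^+ 8 = m%:~R -> evalC y B \in Aint) ->
  exists p : {poly int}, evalC z B = (polyZC p).[z].
Proof.
move=> sq_m m0 z8 w4 rho8 rhoN N_odd sB B_int.
have zA : z \in Aint by apply: (Aint_root_pure _ z8).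
have wA : w \in Aint by apply: (@Aint_root_pure 4 (-1)).
have wz8 j : (w ^+ j * z) ^+ 8 = m%:~R.
  rewrite exprMn z8 -exprM mulnC exprM (exprM w 4 2) w4.
  by rewrite sqrrN expr1n expr1n mul1r.
have [b bE] : exists b : nat -> int, forall i, (i < 8)%N -> B`_i = (b i)%:~R / 8.
  have [y y8|b bE] := @integral8_coef m sq_m m0 B`_0 B`_1 B`_2 B`_3 B`_4 B`_5 B`_6 B`_7.
    by rewrite -evalC_lin8 // B_int.
  by exists b => i lt_i; rewrite -bE //; do 8![case: i lt_i => [|i] lt_i //=].
pose b8 : {poly int} := \poly_(i < 8) b i.
have BE y : evalC y B = (polyZC b8).[y] / 8.
  have s8 : (size (map_poly (intr : int -> algC) b8) <= 8)%N.
    by rewrite (leq_trans (size_poly _ _)) // size_poly.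
  rewrite /evalC (@horner_coef_wide _ 8); last by rewrite size_map_poly.
  rewrite (horner_coef_wide _ s8) mulr_suml; apply: eq_bigr => i _.
  rewrite !coef_map /= coef_poly ltn_ord bE // rmorphM fmorphV /= ratr_int ratr_nat.
  by rewrite mulrAC.
pose q : {poly int} := b8 \Po ('X + s%:P).
have sq8 : (size q <= 8)%N.
  by rewrite size_comp_poly2 ?size_poly // size_XaddC.
have qE y : (polyZC q).[y - s%:~R] = (polyZC b8).[y].
  rewrite /polyZC map_comp_poly horner_comp rmorphD /= map_polyX map_polyC /=.
  by rewrite !hornerE subrK.
have qS y : \sum_(i < 8) (q`_i)%:~R * y ^+ i = (polyZC q).[y].
  have s8 : (size (map_poly (intr : int -> algC) q) <= 8)%N.
    by rewrite (leq_trans (size_poly _ _)).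
  by rewrite (horner_coef_wide _ s8); apply: eq_bigr => i _; rewrite coef_map.
have rhoA j : w ^+ j * z - s%:~R \in Aint by rewrite rpredB ?rpredM ?rpredX ?Aint_int.
have q_int j : (\sum_(i < 8) (q`_i)%:~R * (w ^+ j * z - s%:~R) ^+ i) / 2 ^+ 3 \in Aint.
  rewrite qS qE; have := B_int _ (wz8 j); rewrite BE.
  by have -> : 2 ^+ 3 = 8 :> algC by ring.
have [c cE] := eisenstein_pow2 rhoA rho8 rhoN N_odd q_int.
exists ((\poly_(i < 8) c i) \Po ('X - s%:P)).
rewrite BE -qE -qS.
rewrite /polyZC map_comp_poly horner_comp rmorphB /= map_polyX map_polyC /=.
rewrite !hornerE; set c8 := map_poly _ _.
have s8 : (size c8 <= 8)%N by rewrite (leq_trans (size_poly _ _)) // size_poly.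
rewrite (horner_coef_wide _ s8) mulr_suml; apply: eq_bigr => i _.
by rewrite cE // /c8 coef_map coef_poly ltn_ord /=; field.
Qed.

Lemma monogenic_mod4_23 (m : int) (K : fieldExtType rat) :
    squarefreez m -> m <> 0 ->
    irreducible_poly ('X^8 - (m%:~R)%:P : {poly rat}) -> is_pure_field 8 m K ->
    (m %% 4)%Z = 2 \/ (m %% 4)%Z = 3 ->
  monogenic K.
Proof.
move=> sq_m m0 irr_m pureK m4.
have evX z : evalC z 'X = z by rewrite /evalC map_polyX hornerX.
have [w w4] := root8_exists.
have wA : w \in Aint by apply: (@Aint_root_pure 4 (-1)).
pose z : algC := 8.-root m%:~R; have z8 : z ^+ 8 = m%:~R by rewrite rootCK.
have zA : z \in Aint by apply: (Aint_root_pure _ z8).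
have wz8 j : (w ^+ j * z) ^+ 8 = m%:~R.
  rewrite exprMn z8 -exprM mulnC exprM (exprM w 4 2) w4.
  by rewrite sqrrN expr1n expr1n mul1r.
apply: (monogenic_of_generator (A := 'X) irr_m pureK) => [y y8|B sB B_int].
  by rewrite evX; apply: (Aint_root_pure _ y8).
suff [p Dp] : exists p : {poly int}, evalC z B = (polyZC p).[z].
  by exists p, z; rewrite evX.
case: m4 => m4.
  have [k Dk] : exists k : int, m = 2 * (2 * k + 1) by exists (m %/ 4)%Z; lia.
  (* The second number comes from the norm: the product of the [w ^+ j * z] is [- m], and that of
     the [w ^+ j * z - 1] in the other case is [1 - m]. *)
  apply: (@pure_Zadjoin m 0 (- (2 * k + 1)) _ _ w) => // [j||].
  - rewrite subr0 wz8 Dk; have -> : (2 * (2 * k + 1))%:~R / 2 = (2 * k + 1)%:~R :> algC by field.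
    exact: Aint_int.
  - rewrite !big_ord_recr big_ord0 /=.
    have -> : (2 * - (2 * k + 1))%:~R = - z ^+ 8 :> algC by rewrite z8 Dk; ring.
    by ring: w4.
  - by rewrite !oddz_simp.
have [k Dk] : exists k : int, m = 4 * k + 3 by exists (m %/ 4)%Z; lia.
apply: (@pure_Zadjoin m 1 (- (2 * k + 1)) _ _ w) => // [j||].
- set y := w ^+ j * z; have y8 := wz8 j; rewrite -/y in y8.
  have -> : (y - 1%:~R) ^+ 8 / 2 = (2 * k + 2)%:~R + (- 4 * y ^+ 7 + 14 * y ^+ 6 - 28 * y ^+ 5
      + 35 * y ^+ 4 - 28 * y ^+ 3 + 14 * y ^+ 2 - 4 * y) :> algC.
    have -> : (2 * k + 2)%:~R = (y ^+ 8 + 1) / 2 :> algC by rewrite y8 Dk; field.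
    by field.
  have yA : y \in Aint by rewrite rpredM ?rpredX.
  by rewrite !(rpredD, rpredN, rpredM, rpredX) ?Aint_int ?rpred_nat.
- rewrite !big_ord_recr big_ord0 /=.
  have -> : (2 * - (2 * k + 1))%:~R = 1 - z ^+ 8 :> algC by rewrite z8 Dk; ring.
  by ring: w4.
- by rewrite !oddz_simp.
Qed.

(** * Integral coordinates in the tower for [m = 1 mod 4] *)

Lemma oddz_half (n A B : int) : A + 2 * B = 4 * n -> oddz A = false.
Proof. by rewrite /oddz; lia. Qed.

(** With [oddz_half] this reads a congruence modulo 4 in two rounds. The first is modulo 2;
    substituting the parities found makes all coefficients even, and the second round uses the
    remaining factor 2. *)
Lemma oddz_quarter (n A B : int) : 2 * A + 4 * B = 4 * n -> oddz A = false.
Proof. by rewrite /oddz; lia. Qed.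

Section Tower.

Variables (m l : int).
Hypothesis sq_m : squarefreez m.
Hypothesis m_def : m = 1 + 4 * l.

Let m_neq0 : m <> 0.
Proof. by rewrite m_def; lia. Qed.

Let m_odd : oddz m.
Proof. by rewrite m_def !oddz_simp. Qed.

Lemma integral2_coords (p q : rat) :
  (forall r : algC, r ^+ 2 = m%:~R -> lin2 p q r \in Aint) ->
  exists s t : int, p = s%:~R + t%:~R / 2 /\ q = t%:~R / 2.
Proof.
case/(integral2_half sq_m m_neq0) => X [Y [-> -> [c E]]].
have : oddz (X - Y) = false.
  by have := congr1 oddz E; rewrite !oddz_simp m_odd.
case/even_oddz => s Ds; exists s, Y; split=> //.
have -> : X = 2 * s + Y by lia.
by field.
Qed.

(* The left-hand sides are the coordinates of
   [(C0 + C1 * omega) ^+ 2 - (D0 + D1 * omega) ^+ 2 * r] on [1, omega], where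
   [r ^+ 2 = m] and [omega = (1 + r) / 2]. *)
Lemma parity4 (C0 C1 D0 D1 s t : int) :
    C0 ^+ 2 + l * C1 ^+ 2 + D0 ^+ 2 + l * D1 ^+ 2
      - 2 * l * (2 * D0 * D1 + D1 ^+ 2) = 4 * s ->
    2 * C0 * C1 + C1 ^+ 2 - 2 * D0 ^+ 2 - 2 * l * D1 ^+ 2 - 2 * D0 * D1 - D1 ^+ 2
      = 4 * t ->
  [/\ oddz C0 = false, oddz D0 = false, oddz (C1 - D1) = false & oddz l -> oddz D1 = false].
Proof.
move=> E1 E2.
have /even_oddz[y Dy] : oddz (C1 - D1) = false.
  by have := congr1 oddz E2; rewrite !oddz_simp /=; case: (oddz C1) (oddz D1) => -[].
have {Dy}DC1 : C1 = D1 + 2 * y by rewrite -Dy addrC subrK.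
have /even_oddz[x Dx] : oddz (C0 - D0) = false.
  have := congr1 oddz E1; rewrite DC1 !oddz_simp /=.
  by case: (oddz C0) (oddz D0) (oddz l) (oddz D1) => -[] [] [].
have {Dx}DC0 : C0 = D0 + 2 * x by rewrite -Dx addrC subrK.
have D0_even : oddz D0 = false.
  have := @oddz_quarter s (D0 ^+ 2)
    (x * D0 + x ^+ 2 + l * y * D1 + l * y ^+ 2 - l * D0 * D1).
  by rewrite oddzX; apply; rewrite -E1 DC1 DC0; ring.
split=> //.
- by rewrite DC0 !oddz_simp D0_even.
- by rewrite DC1 !oddz_simp; case: (oddz D1).
move=> l_odd; have := @oddz_quarter t (- l * D1 ^+ 2 - D0 ^+ 2)
  (D0 * y + x * D1 + 2 * x * y + D1 * y + y ^+ 2).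
rewrite !oddz_simp /= l_odd D0_even addbF; apply.
by rewrite -E2 DC1 DC0; ring.
Qed.


(* The basis is [1, omega, x, omega * (1 + x) / 2] with [omega = (1 + x ^+ 2) / 2]; its last
   element is integral only for even [l]. *)
Lemma integral4_coords (c0 c1 c2 c3 : rat) :
  (forall x : algC, x ^+ 4 = m%:~R -> lin4 c0 c1 c2 c3 x \in Aint) ->
  exists s0 s1 s2 s3 : int,
    [/\ c0 = s0%:~R + s1%:~R / 2 + s3%:~R / 4, c1 = s2%:~R + s3%:~R / 4,
        c2 = s1%:~R / 2 + s3%:~R / 4, c3 = s3%:~R / 4 & oddz l -> oddz s3 = false].
Proof.
move=> cA.
have cAN x : x ^+ 4 = m%:~R -> lin4 c0 c1 c2 c3 (- x) \in Aint.
  by move=> x4; apply: cA; rewrite exprNn x4 -signr_odd mul1r.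
have sq r : r ^+ 2 = m%:~R -> (sqrtC r) ^+ 4 = m%:~R :> algC.
  by move=> r2; rewrite (exprM _ 2 2) sqrtCK.
(* Three integers of Q(r) are used: the relative trace, the odd part of twice the element divided by
   [x], and the relative norm. The norm carries the congruences modulo 4 that the other two miss. *)
have [C0 [C1 [DC0 DC1]]] : exists s t : int,
    2 * c0 = s%:~R + t%:~R / 2 /\ 2 * c2 = t%:~R / 2.
  apply: integral2_coords => r /sq x4.
  have -> : lin2 (2 * c0) (2 * c2) r
      = lin4 c0 c1 c2 c3 (sqrtC r) + lin4 c0 c1 c2 c3 (- sqrtC r).
    by rewrite /lin2 /lin4 -{1}[r]sqrtCK; ring.
  exact: rpredD (cA _ x4) (cAN _ x4).
have fA x : x ^+ 4 = m%:~R -> ratr (2 * c1) * x + ratr (2 * c3) * x ^+ 3 \in Aint.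
  move=> x4; have -> : ratr (2 * c1) * x + ratr (2 * c3) * x ^+ 3
      = lin4 c0 c1 c2 c3 x - lin4 c0 c1 c2 c3 (- x) by rewrite /lin4; ring.
  exact: rpredB (cA _ x4) (cAN _ x4).
(* The conjugation [x |-> 'i * x] changes the relative sign of the two terms, so that [c1] and [c3]
   can be separated. *)
have fA' x : x ^+ 4 = m%:~R -> ratr (2 * c1) * x - ratr (2 * c3) * x ^+ 3 \in Aint.
  move=> x4; have i2 := sqrCi algC.
  have iA : 'i \in Aint by apply: (@Aint_root_pure 2 (-1)).
  have ix4 : ('i * x) ^+ 4 = m%:~R by rewrite exprMn x4 (exprM _ 2 2) i2 sqrrN expr1n mul1r.
  have -> : ratr (2 * c1) * x - ratr (2 * c3) * x ^+ 3
      = - 'i * (ratr (2 * c1) * ('i * x) + ratr (2 * c3) * ('i * x) ^+ 3) by ring: i2.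
  by rewrite rpredM ?rpredN ?fA //.
pose x0 : algC := 4.-root m%:~R; have x04 : x0 ^+ 4 = m%:~R by rewrite rootCK.
have [k1 Dk1] : exists k : int, 4 * c1 = k%:~R.
  apply: (@coef_pow_int m sq_m m_neq0 4 1 _ x0) => //.
  have -> : ratr (4 * c1) * x0 ^+ 1 = (ratr (2 * c1) * x0 + ratr (2 * c3) * x0 ^+ 3)
     + (ratr (2 * c1) * x0 - ratr (2 * c3) * x0 ^+ 3) by ring.
  exact: rpredD (fA _ x04) (fA' _ x04).
have [k3 Dk3] : exists k : int, 4 * c3 = k%:~R.
  apply: (@coef_pow_int m sq_m m_neq0 4 3 _ x0) => //.
  have -> : ratr (4 * c3) * x0 ^+ 3 = (ratr (2 * c1) * x0 + ratr (2 * c3) * x0 ^+ 3)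
     - (ratr (2 * c1) * x0 - ratr (2 * c3) * x0 ^+ 3) by ring.
  exact: rpredB (fA _ x04) (fA' _ x04).
have [D0 [D1 [DD0 DD1]]] : exists s t : int,
    2 * c1 = s%:~R + t%:~R / 2 /\ 2 * c3 = t%:~R / 2.
  apply: integral2_coords => r r2; have x4 := sq _ r2.
  have rA : r \in Aint by apply: (Aint_root_pure _ r2).
  apply: (@odd_strip m 4 (sqrtC r) _ 1 m_odd _ x4) => //.
    have -> : sqrtC r * lin2 (2 * c1) (2 * c3) r
        = ratr (2 * c1) * sqrtC r + ratr (2 * c3) * sqrtC r ^+ 3.
      by rewrite /lin2 -{2}[r]sqrtCK; ring.
    exact: fA.
  have -> : 2 ^+ 1 * lin2 (2 * c1) (2 * c3) r = ratr (4 * c1) + ratr (4 * c3) * r.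
    by rewrite /lin2; ring.
  by rewrite Dk1 Dk3 !ratr_int rpredD ?rpredM ?Aint_int.
have [s [t [Ds Dt]]] : exists s t : int,
    c0 ^+ 2 + m%:~R * c2 ^+ 2 - 2 * m%:~R * c1 * c3 = s%:~R + t%:~R / 2
    /\ 2 * c0 * c2 - c1 ^+ 2 - m%:~R * c3 ^+ 2 = t%:~R / 2.
  apply: integral2_coords => r r2; have x4 := sq _ r2.
  set L := lin2 _ _ _.
  have -> : L = lin4 c0 c1 c2 c3 (sqrtC r) * lin4 c0 c1 c2 c3 (- sqrtC r).
    have r2' : sqrtC r ^+ 4 = m%:~R := x4.
    by rewrite /L /lin2 /lin4 -{1}[r]sqrtCK; ring: r2'.
  exact: rpredM (cA _ x4) (cAN _ x4).
have c0E : c0 = (C0%:~R + C1%:~R / 2) / 2 by rewrite -DC0; field.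
have c2E : c2 = C1%:~R / 4 by rewrite -[c2](@mulKf _ 2) // DC1; field.
have c1E : c1 = (D0%:~R + D1%:~R / 2) / 2 by rewrite -DD0; field.
have c3E : c3 = D1%:~R / 4 by rewrite -[c3](@mulKf _ 2) // DD1; field.
have [||] := @parity4 C0 C1 D0 D1 s t.
- apply: (@intr_inj rat).
  have -> : (4 * s)%:~R = 4 * ((s%:~R + t%:~R / 2) - t%:~R / 2) :> rat by field.
  by rewrite -Ds -Dt c0E c1E c2E c3E m_def; field.
- apply: (@intr_inj rat).
  have -> : (4 * t)%:~R = 8 * (t%:~R / 2) :> rat by field.
  by rewrite -Dt c0E c1E c2E c3E m_def; field.
case/even_oddz => h0 Dh0 /even_oddz[g0 Dg0] /even_oddz[h1 Dh1] D1_even.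
exists h0, h1, g0, D1; split=> //.
- by rewrite c0E Dh0 (_ : C1 = 2 * h1 + D1); [field | lia].
- by rewrite c1E Dg0; field.
by rewrite c2E (_ : C1 = 2 * h1 + D1); [field | lia].
Qed.

End Tower.

(* With [psi = theta ^+ 2] and [omega = (1 + r) / 2], the left-hand sides are the
   coordinates of [(y + w) ^+ 2 - psi * w ^+ 2] on
   [1, omega, psi, omega * (1 + psi) / 2], for [m = 1 + 8 * j]. *)
Lemma parity8_even (j y0 y1 y2 y3 w0 w1 w2 w3 n0 n1 n2 n3 : int) :
    - 4 * j * w0 * w3 + 2 * j * w1 ^+ 2 - 8 * j * w1 * w2 + 4 * j * w1 * y1 + 2 * j *
      w1 * y3 + 4 * j * w2 * y3 + 2 * j * w3 * y1 + 4 * j * w3 * y2 + 2 * j * w3 * y3 +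
      2 * j * y1 ^+ 2 + 2 * j * y1 * y3 + 4 * j * y2 * y3 + j * y3 ^+ 2 + w0 ^+ 2 + 2 *
      w0 * w2 + 2 * w0 * y0 - w2 ^+ 2 - 2 * w2 * y2 + y0 ^+ 2 - y2 ^+ 2 = 4 * n0 ->
    - 4 * j * w1 * w3 + 2 * j * w3 * y3 + j * y3 ^+ 2 + 4 * w0 * w1 - 4 * w0 * w2 + 2
      * w0 * y1 + 2 * w1 ^+ 2 - 4 * w1 * w2 + 2 * w1 * y0 + 2 * w1 * y1 - 2 * w1 * y2 +
      4 * w2 ^+ 2 - 2 * w2 * y1 + 4 * w2 * y2 + 2 * y0 * y1 + y1 ^+ 2 - 2 * y1 * y2 + 2
      * y2 ^+ 2 = 4 * n1 ->
    - 2 * j * w1 ^+ 2 + 2 * j * w1 * y3 - 4 * j * w2 * w3 + 2 * j * w3 * y1 + 2 * j *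
      w3 * y3 + 2 * j * y1 * y3 + j * y3 ^+ 2 - w0 ^+ 2 + 2 * w0 * w2 + 2 * w0 * y2 + w2
      ^+ 2 + 2 * w2 * y0 + 2 * y0 * y2 = 4 * n2 ->
    - 2 * j * w3 ^+ 2 - 4 * w0 * w1 + 2 * w0 * y3 - 2 * w1 ^+ 2 + 4 * w1 * w2 + 4 * w1
      * y2 + 2 * w1 * y3 - 4 * w2 ^+ 2 + 4 * w2 * y1 + 2 * w2 * y3 + 2 * w3 * y0 + 2 *
      w3 * y1 + 2 * w3 * y2 + 2 * w3 * y3 + 2 * y0 * y3 + 4 * y1 * y2 + 2 * y1 * y3 + 2
      * y2 * y3 + y3 ^+ 2 = 4 * n3 ->
  [/\ [/\ oddz y0 = false, oddz y1 = false, oddz y2 = false & oddz y3 = false],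
     [/\ oddz w0 = false, oddz w1 = false & oddz w2 = false]
   & oddz j -> oddz w3 = false].
Proof.
move=> E0 E1 E2 E3.
have [y1_even y3_even y02 w02] : [/\ oddz y1 = false, oddz y3 = false,
    oddz (y2 - y0) = false & oddz (w2 - w0) = false].
  have A0 := @oddz_half n0 (j * y3 ^+ 2 + w0 ^+ 2 + w2 ^+ 2 + y0 ^+ 2 + y2 ^+ 2)
    (- 2 * j * w0 * w3 + j * w1 ^+ 2 - 4 * j * w1 * w2 + 2 * j * w1 * y1 + j * w1 * y3
      + 2 * j * w2 * y3 + j * w3 * y1 + 2 * j * w3 * y2 + j * w3 * y3 + j * y1 ^+ 2 + j
      * y1 * y3 + 2 * j * y2 * y3 + w0 * w2 + w0 * y0 - w2 ^+ 2 - w2 * y2 - y2 ^+ 2)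
    ltac:(rewrite -E0; ring).
  have A1 := @oddz_half n1 (j * y3 ^+ 2 + y1 ^+ 2)
    (- 2 * j * w1 * w3 + j * w3 * y3 + 2 * w0 * w1 - 2 * w0 * w2 + w0 * y1 + w1 ^+ 2 -
      2 * w1 * w2 + w1 * y0 + w1 * y1 - w1 * y2 + 2 * w2 ^+ 2 - w2 * y1 + 2 * w2 * y2 +
      y0 * y1 - y1 * y2 + y2 ^+ 2)
    ltac:(rewrite -E1; ring).
  have A2 := @oddz_half n2 (j * y3 ^+ 2 + w0 ^+ 2 + w2 ^+ 2)
    (- j * w1 ^+ 2 + j * w1 * y3 - 2 * j * w2 * w3 + j * w3 * y1 + j * w3 * y3 + j * y1
      * y3 - w0 ^+ 2 + w0 * w2 + w0 * y2 + w2 * y0 + y0 * y2)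
    ltac:(rewrite -E2; ring).
  have A3 := @oddz_half n3 (y3 ^+ 2)
    (- j * w3 ^+ 2 - 2 * w0 * w1 + w0 * y3 - w1 ^+ 2 + 2 * w1 * w2 + 2 * w1 * y2 + w1 *
      y3 - 2 * w2 ^+ 2 + 2 * w2 * y1 + w2 * y3 + w3 * y0 + w3 * y1 + w3 * y2 + w3 * y3 +
      y0 * y3 + 2 * y1 * y2 + y1 * y3 + y2 * y3)
    ltac:(rewrite -E3; ring).
  move: A0 A1 A2 A3; rewrite !oddz_simp /=.
  by move: (oddz j) (oddz y0) (oddz y1) (oddz y2) (oddz y3) (oddz w0) (oddz w2);
    do 7 case.
(* Second round: once these parities are substituted, every coefficient is even and half of each
   equation can be read modulo 2. *)
have /even_oddz[z1 Dy1] := y1_even; have /even_oddz[z3 Dy3] := y3_even.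
have /even_oddz[z2 Dz2] := y02; have /even_oddz[x2 Dx2] := w02.
have {Dz2}Dy2 : y2 = y0 + 2 * z2 by rewrite -Dz2 addrC subrK.
have {Dx2}Dw2 : w2 = w0 + 2 * x2 by rewrite -Dx2 addrC subrK.
rewrite {}Dy1 {}Dy2 {}Dy3 {}Dw2 in E0 E1 E2 E3 *.
have A0 := @oddz_quarter n0 (j * w1 ^+ 2 + w0 ^+ 2)
    (- 2 * j * w0 * w1 - j * w0 * w3 + 2 * j * w0 * z3 - 4 * j * w1 * x2 + 2 * j * w1 *
      z1 + j * w1 * z3 + j * w3 * y0 + j * w3 * z1 + 2 * j * w3 * z2 + j * w3 * z3 + 4 *
      j * x2 * z3 + 2 * j * y0 * z3 + 2 * j * z1 ^+ 2 + 2 * j * z1 * z3 + 4 * j * z2 *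
      z3 + j * z3 ^+ 2 - w0 * z2 - x2 ^+ 2 - x2 * y0 - 2 * x2 * z2 - y0 * z2 - z2 ^+ 2)
    ltac:(rewrite -E0; ring).
have A1 := @oddz_quarter n1 (w1 ^+ 2 + y0 ^+ 2)
    (- j * w1 * w3 + j * w3 * z3 + j * z3 ^+ 2 + 2 * w0 * x2 + w0 * y0 + 2 * w0 * z2 -
      2 * w1 * x2 + w1 * z1 - w1 * z2 + 4 * x2 ^+ 2 + 2 * x2 * y0 - 2 * x2 * z1 + 4 * x2
      * z2 + 2 * y0 * z2 + z1 ^+ 2 - 2 * z1 * z2 + 2 * z2 ^+ 2)
    ltac:(rewrite -E1; ring).
have A2 := @oddz_quarter n2 (j * w1 ^+ 2 + w0 ^+ 2 + y0 ^+ 2)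
    (- j * w0 * w3 - j * w1 ^+ 2 + j * w1 * z3 - 2 * j * w3 * x2 + j * w3 * z1 + j * w3
      * z3 + 2 * j * z1 * z3 + j * z3 ^+ 2 + 2 * w0 * x2 + w0 * y0 + w0 * z2 + x2 ^+ 2 +
      x2 * y0 + y0 * z2)
    ltac:(rewrite -E2; ring).
have A3 := @oddz_quarter n3 (j * w3 ^+ 2 + w1 ^+ 2)
    (- j * w3 ^+ 2 - w0 ^+ 2 - 4 * w0 * x2 + 2 * w0 * z1 + 2 * w0 * z3 - w1 ^+ 2 + 2 *
      w1 * x2 + w1 * y0 + 2 * w1 * z2 + w1 * z3 + w3 * y0 + w3 * z1 + w3 * z2 + w3 * z3
      - 4 * x2 ^+ 2 + 4 * x2 * z1 + 2 * x2 * z3 + 2 * y0 * z1 + 2 * y0 * z3 + 4 * z1 *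
      z2 + 2 * z1 * z3 + 2 * z2 * z3 + z3 ^+ 2)
    ltac:(rewrite -E3; ring).
move: A0 A1 A2 A3; rewrite !oddz_simp /=.
by move: (oddz j) (oddz y0) (oddz w0) (oddz w1) (oddz w3); do 5 case.
Qed.

(* Same as [parity8_even] for [m = 5 + 8 * j], on [1, omega, psi, omega * (1 + psi)]. *)
Lemma parity8_odd (j y0 y1 y2 y3 w0 w1 w2 w3 n0 n1 n2 n3 : int) :
    - 8 * j * w0 * w3 + 2 * j * w1 ^+ 2 - 8 * j * w1 * w2 + 4 * j * w1 * y1 + 4 * j *
      w1 * y3 + 8 * j * w2 * y3 + 4 * j * w3 * y1 + 8 * j * w3 * y2 + 8 * j * w3 * y3 +
      2 * j * y1 ^+ 2 + 4 * j * y1 * y3 + 8 * j * y2 * y3 + 4 * j * y3 ^+ 2 + w0 ^+ 2 +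
      2 * w0 * w2 - 4 * w0 * w3 + 2 * w0 * y0 + w1 ^+ 2 - 4 * w1 * w2 + 2 * w1 * y1 + 2
      * w1 * y3 - w2 ^+ 2 - 2 * w2 * y2 + 4 * w2 * y3 + 2 * w3 * y1 + 4 * w3 * y2 + 4 *
      w3 * y3 + y0 ^+ 2 + y1 ^+ 2 + 2 * y1 * y3 - y2 ^+ 2 + 4 * y2 * y3 + 2 * y3 ^+ 2 =
      4 * n0 ->
    - 8 * j * w1 * w3 + 8 * j * w3 * y3 + 4 * j * y3 ^+ 2 + 4 * w0 * w1 - 4 * w0 * w2
      + 2 * w0 * y1 + 2 * w1 ^+ 2 - 4 * w1 * w2 - 4 * w1 * w3 + 2 * w1 * y0 + 2 * w1 *
      y1 - 2 * w1 * y2 + 4 * w2 ^+ 2 - 2 * w2 * y1 + 4 * w2 * y2 + 4 * w3 * y3 + 2 * y0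
      * y1 + y1 ^+ 2 - 2 * y1 * y2 + 2 * y2 ^+ 2 + 2 * y3 ^+ 2 = 4 * n1 ->
    - 2 * j * w1 ^+ 2 + 4 * j * w1 * y3 - 8 * j * w2 * w3 + 4 * j * w3 * y1 + 8 * j *
      w3 * y3 + 4 * j * y1 * y3 + 4 * j * y3 ^+ 2 - w0 ^+ 2 + 2 * w0 * w2 + 2 * w0 * y2
      - w1 ^+ 2 + 2 * w1 * y3 + w2 ^+ 2 - 4 * w2 * w3 + 2 * w2 * y0 + 2 * w3 * y1 + 4 *
      w3 * y3 + 2 * y0 * y2 + 2 * y1 * y3 + 2 * y3 ^+ 2 = 4 * n2 ->
    - 4 * j * w3 ^+ 2 - 2 * w0 * w1 + 2 * w0 * y3 - w1 ^+ 2 + 2 * w1 * w2 + 2 * w1 *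
      y2 + 2 * w1 * y3 - 2 * w2 ^+ 2 + 2 * w2 * y1 + 2 * w2 * y3 - 2 * w3 ^+ 2 + 2 * w3
      * y0 + 2 * w3 * y1 + 2 * w3 * y2 + 4 * w3 * y3 + 2 * y0 * y3 + 2 * y1 * y2 + 2 *
      y1 * y3 + 2 * y2 * y3 + 2 * y3 ^+ 2 = 4 * n3 ->
  [/\ [/\ oddz y0 = false, oddz y1 = false, oddz y2 = false & oddz y3 = false]
   & [/\ oddz w0 = false, oddz w1 = false, oddz w2 = false & oddz w3 = false]].
Proof.
move=> E0 E1 E2 E3.
have [y1_even w1_even y02 w02] : [/\ oddz y1 = false, oddz w1 = false,
    oddz (y2 - y0) = false & oddz (w2 - w0) = false].
  have A0 := @oddz_half n0 (w0 ^+ 2 + w1 ^+ 2 + w2 ^+ 2 + y0 ^+ 2 + y1 ^+ 2 + y2 ^+ 2)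
    (- 4 * j * w0 * w3 + j * w1 ^+ 2 - 4 * j * w1 * w2 + 2 * j * w1 * y1 + 2 * j * w1 *
      y3 + 4 * j * w2 * y3 + 2 * j * w3 * y1 + 4 * j * w3 * y2 + 4 * j * w3 * y3 + j *
      y1 ^+ 2 + 2 * j * y1 * y3 + 4 * j * y2 * y3 + 2 * j * y3 ^+ 2 + w0 * w2 - 2 * w0 *
      w3 + w0 * y0 - 2 * w1 * w2 + w1 * y1 + w1 * y3 - w2 ^+ 2 - w2 * y2 + 2 * w2 * y3 +
      w3 * y1 + 2 * w3 * y2 + 2 * w3 * y3 + y1 * y3 - y2 ^+ 2 + 2 * y2 * y3 + y3 ^+ 2)
    ltac:(rewrite -E0; ring).
  have A1 := @oddz_half n1 (y1 ^+ 2)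
    (- 4 * j * w1 * w3 + 4 * j * w3 * y3 + 2 * j * y3 ^+ 2 + 2 * w0 * w1 - 2 * w0 * w2
      + w0 * y1 + w1 ^+ 2 - 2 * w1 * w2 - 2 * w1 * w3 + w1 * y0 + w1 * y1 - w1 * y2 + 2
      * w2 ^+ 2 - w2 * y1 + 2 * w2 * y2 + 2 * w3 * y3 + y0 * y1 - y1 * y2 + y2 ^+ 2 + y3
      ^+ 2)
    ltac:(rewrite -E1; ring).
  have A2 := @oddz_half n2 (w0 ^+ 2 + w1 ^+ 2 + w2 ^+ 2)
    (- j * w1 ^+ 2 + 2 * j * w1 * y3 - 4 * j * w2 * w3 + 2 * j * w3 * y1 + 4 * j * w3 *
      y3 + 2 * j * y1 * y3 + 2 * j * y3 ^+ 2 - w0 ^+ 2 + w0 * w2 + w0 * y2 - w1 ^+ 2 +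
      w1 * y3 - 2 * w2 * w3 + w2 * y0 + w3 * y1 + 2 * w3 * y3 + y0 * y2 + y1 * y3 + y3
      ^+ 2)
    ltac:(rewrite -E2; ring).
  have A3 := @oddz_half n3 (w1 ^+ 2)
    (- 2 * j * w3 ^+ 2 - w0 * w1 + w0 * y3 - w1 ^+ 2 + w1 * w2 + w1 * y2 + w1 * y3 - w2
      ^+ 2 + w2 * y1 + w2 * y3 - w3 ^+ 2 + w3 * y0 + w3 * y1 + w3 * y2 + 2 * w3 * y3 +
      y0 * y3 + y1 * y2 + y1 * y3 + y2 * y3 + y3 ^+ 2)
    ltac:(rewrite -E3; ring).
  move: A0 A1 A2 A3; rewrite !oddz_simp /=.
  by move: (oddz y0) (oddz y1) (oddz y2) (oddz w0) (oddz w1) (oddz w2); do 6 case.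
have /even_oddz[z1 Dy1] := y1_even; have /even_oddz[x1 Dw1] := w1_even.
have /even_oddz[z2 Dz2] := y02; have /even_oddz[x2 Dx2] := w02.
have {Dz2}Dy2 : y2 = y0 + 2 * z2 by rewrite -Dz2 addrC subrK.
have {Dx2}Dw2 : w2 = w0 + 2 * x2 by rewrite -Dx2 addrC subrK.
rewrite {}Dy1 {}Dw1 {}Dy2 {}Dw2 in E0 E1 E2 E3 *.
have A0 := @oddz_quarter n0 (w0 ^+ 2 + y3 ^+ 2)
    (- 2 * j * w0 * w3 - 4 * j * w0 * x1 + 2 * j * w0 * y3 + 2 * j * w3 * y0 + 2 * j *
      w3 * y3 + 2 * j * w3 * z1 + 4 * j * w3 * z2 + 2 * j * x1 ^+ 2 - 8 * j * x1 * x2 +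
      2 * j * x1 * y3 + 4 * j * x1 * z1 + 4 * j * x2 * y3 + 2 * j * y0 * y3 + j * y3 ^+
      2 + 2 * j * y3 * z1 + 4 * j * y3 * z2 + 2 * j * z1 ^+ 2 - w0 * w3 - 2 * w0 * x1 +
      w0 * y3 - w0 * z2 + w3 * y0 + w3 * y3 + w3 * z1 + 2 * w3 * z2 + x1 ^+ 2 - 4 * x1 *
      x2 + x1 * y3 + 2 * x1 * z1 - x2 ^+ 2 - x2 * y0 + 2 * x2 * y3 - 2 * x2 * z2 + y0 *
      y3 - y0 * z2 + y3 * z1 + 2 * y3 * z2 + z1 ^+ 2 - z2 ^+ 2)
    ltac:(rewrite -E0; ring).
have A1 := @oddz_quarter n1 (y0 ^+ 2 + y3 ^+ 2)
    (- 4 * j * w3 * x1 + 2 * j * w3 * y3 + j * y3 ^+ 2 + 2 * w0 * x2 + w0 * y0 + 2 * w0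
      * z2 - 2 * w3 * x1 + w3 * y3 + 2 * x1 ^+ 2 - 4 * x1 * x2 + 2 * x1 * z1 - 2 * x1 *
      z2 + 4 * x2 ^+ 2 + 2 * x2 * y0 - 2 * x2 * z1 + 4 * x2 * z2 + 2 * y0 * z2 + z1 ^+ 2
      - 2 * z1 * z2 + 2 * z2 ^+ 2)
    ltac:(rewrite -E1; ring).
have A2 := @oddz_quarter n2 (w0 ^+ 2 + y0 ^+ 2 + y3 ^+ 2)
    (- 2 * j * w0 * w3 - 4 * j * w3 * x2 + 2 * j * w3 * y3 + 2 * j * w3 * z1 - 2 * j *
      x1 ^+ 2 + 2 * j * x1 * y3 + j * y3 ^+ 2 + 2 * j * y3 * z1 - w0 * w3 + 2 * w0 * x2
      + w0 * y0 + w0 * z2 - 2 * w3 * x2 + w3 * y3 + w3 * z1 - x1 ^+ 2 + x1 * y3 + x2 ^+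
      2 + x2 * y0 + y0 * z2 + y3 * z1)
    ltac:(rewrite -E2; ring).
have A3 := @oddz_quarter n3 (w0 ^+ 2 + w3 ^+ 2 + y3 ^+ 2)
    (- j * w3 ^+ 2 - w0 ^+ 2 - 2 * w0 * x2 + w0 * y3 + w0 * z1 - w3 ^+ 2 + w3 * y0 + w3
      * y3 + w3 * z1 + w3 * z2 - x1 ^+ 2 + 2 * x1 * x2 + x1 * y0 + x1 * y3 + 2 * x1 * z2
      - 2 * x2 ^+ 2 + x2 * y3 + 2 * x2 * z1 + y0 * y3 + y0 * z1 + y3 * z1 + y3 * z2 + 2
      * z1 * z2)
    ltac:(rewrite -E3; ring).
move: A0 A1 A2 A3; rewrite !oddz_simp /=.
by move: (oddz y0) (oddz y3) (oddz w0) (oddz w3); do 4 case.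
Qed.

Lemma half_sum (t w z r g : int) : t - w = 2 * z -> w = 2 * r + g -> t = 2 * (z + r) + g.
Proof. lia. Qed.

Section Tower8.

Variables (m l : int).
Hypothesis sq_m : squarefreez m.
Hypothesis m_def : m = 1 + 4 * l.
Variables a0 a1 a2 a3 a4 a5 a6 a7 : rat.
Hypothesis aA : forall z : algC, z ^+ 8 = m%:~R -> lin8 a0 a1 a2 a3 a4 a5 a6 a7 z \in Aint.

Let m_neq0 : m <> 0.
Proof. by rewrite m_def; lia. Qed.

Let m_odd : oddz m.
Proof. by rewrite m_def !oddz_simp. Qed.

Let sqrt8 (x : algC) : x ^+ 4 = m%:~R -> sqrtC x ^+ 8 = m%:~R.
Proof. by move=> x4; rewrite (exprM _ 2 4) sqrtCK. Qed.

Let aAN (z : algC) : z ^+ 8 = m%:~R -> lin8 a0 a1 a2 a3 a4 a5 a6 a7 (- z) \in Aint.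
Proof. by move=> z8; apply: aA; rewrite exprNn z8 -signr_odd mul1r. Qed.

Lemma integral8_even_part (x : algC) : x ^+ 4 = m%:~R ->
  lin4 (2 * a0) (2 * a2) (2 * a4) (2 * a6) x \in Aint.
Proof.
move=> /sqrt8 z8; set L := lin4 _ _ _ _ _.
have -> : L = lin8 a0 a1 a2 a3 a4 a5 a6 a7 (sqrtC x)
            + lin8 a0 a1 a2 a3 a4 a5 a6 a7 (- sqrtC x).
  by rewrite /L /lin4 /lin8 -{1 2 3}[x]sqrtCK; ring.
exact: rpredD (aA z8) (aAN z8).
Qed.

Lemma integral8_odd_part (x : algC) : x ^+ 4 = m%:~R ->
  lin4 (2 * a1) (2 * a3) (2 * a5) (2 * a7) x \in Aint.
Proof.
move=> x4; have z8 := sqrt8 x4; set L := lin4 _ _ _ _ _.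
have xA : x \in Aint by apply: (Aint_root_pure _ x4).
apply: (@odd_strip m 8 (sqrtC x) _ 2 m_odd _ z8) => //.
  have -> : sqrtC x * L = lin8 a0 a1 a2 a3 a4 a5 a6 a7 (sqrtC x)
            - lin8 a0 a1 a2 a3 a4 a5 a6 a7 (- sqrtC x).
    by rewrite /L /lin4 /lin8 -{2 3 4}[x]sqrtCK; ring.
  exact: rpredB (aA z8) (aAN z8).
have [b bE] := integral8_coef sq_m m_neq0 aA.
move: (bE 1%N isT) (bE 3%N isT) (bE 5%N isT) (bE 7%N isT) => /= E1 E3 E5 E7.
have -> : 2 ^+ 2 * L = (b 1%N)%:~R + (b 3%N)%:~R * x + (b 5%N)%:~R * x ^+ 2
    + (b 7%N)%:~R * x ^+ 3.
  by rewrite /L /lin4 E1 E3 E5 E7; field.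
by rewrite !(rpredD, rpredM, rpredX) ?Aint_int.
Qed.

Lemma integral8_norm (x : algC) : x ^+ 4 = m%:~R ->
  lin4 (a0 ^+ 2 + m%:~R * (2 * a2 * a6 + a4 ^+ 2) - m%:~R * (2 * a1 * a7 + 2 * a3 * a5))
       (2 * a0 * a2 + 2 * m%:~R * a4 * a6 - a1 ^+ 2 - m%:~R * (2 * a3 * a7 + a5 ^+ 2))
       (2 * a0 * a4 + a2 ^+ 2 + m%:~R * a6 ^+ 2 - 2 * a1 * a3 - 2 * m%:~R * a5 * a7)
       (2 * a0 * a6 + 2 * a2 * a4 - 2 * a1 * a5 - a3 ^+ 2 - m%:~R * a7 ^+ 2) x \in Aint.
Proof.
move=> /sqrt8 z8; set L := lin4 _ _ _ _ _.
have -> : L = lin8 a0 a1 a2 a3 a4 a5 a6 a7 (sqrtC x)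
            * lin8 a0 a1 a2 a3 a4 a5 a6 a7 (- sqrtC x).
  by rewrite /L /lin4 /lin8 -{1 2 3}[x]sqrtCK; ring: z8.
exact: rpredM (aA z8) (aAN z8).
Qed.

(* That is [u + v * theta + g * (1 + theta + ... + theta ^+ 7) / 8], with [u] and [v] in
   the basis of [integral4_coords]. *)
Lemma integral8_coords_even (j : int) : l = 2 * j ->
  exists (u0 u1 u2 u3 v0 v1 v2 v3 : int) (g : bool),
  [/\ [/\ a0 = u0%:~R + u1%:~R / 2 + u3%:~R / 4 + g%:R / 8,
          a2 = u2%:~R + u3%:~R / 4 + g%:R / 8,
          a4 = u1%:~R / 2 + u3%:~R / 4 + g%:R / 8 & a6 = u3%:~R / 4 + g%:R / 8],
      [/\ a1 = v0%:~R + v1%:~R / 2 + v3%:~R / 4 + g%:R / 8,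
          a3 = v2%:~R + v3%:~R / 4 + g%:R / 8,
          a5 = v1%:~R / 2 + v3%:~R / 4 + g%:R / 8 & a7 = v3%:~R / 4 + g%:R / 8]
    & oddz j -> g = false].
Proof.
move=> l_def.
have [t0 [t1 [t2 [t3 [T0 T2 T4 T6 _]]]]] :=
  integral4_coords sq_m m_def integral8_even_part.
have [w0 [w1 [w2 [w3 [W1 W3 W5 W7 _]]]]] :=
  integral4_coords sq_m m_def integral8_odd_part.
have [n0 [n1 [n2 [n3 [N0 N1 N2 N3 _]]]]] :=
  integral4_coords sq_m m_def integral8_norm.
have half (p q : rat) : 2 * p = q -> p = q / 2 by move=> <-; field.
move/half in T0; move/half in T2; move/half in T4; move/half in T6.
move/half in W1; move/half in W3; move/half in W5; move/half in W7.
have n3E : n3%:~R = 4 * (n3%:~R / 4) :> rat by field.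
have n2E : n2%:~R = (n2%:~R + n3%:~R / 4) - n3%:~R / 4 :> rat by field.
have n1E : n1%:~R = 2 * ((n1%:~R / 2 + n3%:~R / 4) - n3%:~R / 4) :> rat by field.
have n0E : n0%:~R = (n0%:~R + n1%:~R / 2 + n3%:~R / 4) - (n1%:~R / 2 + n3%:~R / 4) :> rat by field.
rewrite -N3 in n3E; rewrite -N1 -N3 in n2E.
rewrite -N2 -N3 in n1E; rewrite -N0 -N2 in n0E.
(* Twice the element is [t + theta * w = (t - w) + theta * w + w], hence the arguments [t - w] and
   [w]. Its relative norm [t ^+ 2 - psi * w ^+ 2] is four times the integer with coordinates [n]. *)
have [||||[y0 y1 y2 y3] [x0 x1 x2] x3] := @parity8_even j (t0 - w0) (t1 - w1) (t2 - w2) (t3 - w3)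
  w0 w1 w2 w3 n0 n1 n2 n3.
1-4: by apply: (@intr_inj rat);
  rewrite [RHS]rmorphM /= ?n0E ?n1E ?n2E ?n3E T0 T2 T4 T6 W1 W3 W5 W7 m_def l_def; field.
have /even_oddz[z0 Dz0] := y0; have /even_oddz[z1 Dz1] := y1.
have /even_oddz[z2 Dz2] := y2; have /even_oddz[z3 Dz3] := y3.
have /even_oddz[r0 Dr0] := x0; have /even_oddz[r1 Dr1] := x1.
have /even_oddz[r2 Dr2] := x2; have [h Dh] := oddzE w3.
rewrite -[2 * r0]addr0 in Dr0; rewrite -[2 * r1]addr0 in Dr1.
rewrite -[2 * r2]addr0 in Dr2.
have t0E := half_sum Dz0 Dr0; have t1E := half_sum Dz1 Dr1.
have t2E := half_sum Dz2 Dr2; have t3E := half_sum Dz3 Dh.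
(* Only the last coordinates can be odd, and [t3] and [w3] have the same parity: this common bit is
   the coefficient of the element with denominator 8. *)
exists (z0 + r0), (z1 + r1), (z2 + r2), (z3 + h), r0, r1, r2, h, (oddz w3).
have gE : (oddz w3)%:R = (oddz w3)%:Z%:~R :> rat by case: (oddz w3).
rewrite gE; split=> //; split.
- by rewrite T0 t0E t1E t3E; field.
- by rewrite T2 t2E t3E; field.
- by rewrite T4 t1E t3E; field.
- by rewrite T6 t3E; field.
- by rewrite W1 Dr0 Dr1 [X in X%:~R / 4]Dh; field.
- by rewrite W3 Dr2 [X in X%:~R / 4]Dh; field.
- by rewrite W5 Dr1 [X in X%:~R / 4]Dh; field.
by rewrite W7 [X in X%:~R / 4]Dh; field.
Qed.

Lemma integral8_coords_odd (j : int) : l = 2 * j + 1 ->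
  exists (u0 u1 u2 u3 v0 v1 v2 v3 : int),
    [/\ a0 = u0%:~R + u1%:~R / 2, a2 = u2%:~R + u3%:~R / 2,
        a4 = u1%:~R / 2 & a6 = u3%:~R / 2] /\
    [/\ a1 = v0%:~R + v1%:~R / 2, a3 = v2%:~R + v3%:~R / 2,
        a5 = v1%:~R / 2 & a7 = v3%:~R / 2].
Proof.
move=> l_def; have l_odd : oddz l by rewrite l_def !oddz_simp.
have [t0 [t1 [t2 [t3 [T0 T2 T4 T6 /(_ l_odd)]]]]] :=
  integral4_coords sq_m m_def integral8_even_part.
case/even_oddz => t3' Dt3; rewrite {}Dt3 in T0 T2 T4 T6.
have [w0 [w1 [w2 [w3 [W1 W3 W5 W7 /(_ l_odd)]]]]] :=
  integral4_coords sq_m m_def integral8_odd_part.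
case/even_oddz => w3' Dw3; rewrite {}Dw3 in W1 W3 W5 W7.
have [n0 [n1 [n2 [n3 [N0 N1 N2 N3 /(_ l_odd)]]]]] :=
  integral4_coords sq_m m_def integral8_norm.
case/even_oddz => n3' Dn3; rewrite {}Dn3 in N0 N1 N2 N3.
have half (p q : rat) : 2 * p = q -> p = q / 2 by move=> <-; field.
move/half in T0; move/half in T2; move/half in T4; move/half in T6.
move/half in W1; move/half in W3; move/half in W5; move/half in W7.
have n3E : n3'%:~R = 2 * ((2 * n3')%:~R / 4) :> rat by field.
have n2E : n2%:~R = (n2%:~R + (2 * n3')%:~R / 4) - (2 * n3')%:~R / 4 :> rat by field.
have n1E : n1%:~R = 2 * ((n1%:~R / 2 + (2 * n3')%:~R / 4) - (2 * n3')%:~R / 4) :> rat by field.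
have n0E : n0%:~R = (n0%:~R + n1%:~R / 2 + (2 * n3')%:~R / 4)
    - (n1%:~R / 2 + (2 * n3')%:~R / 4) :> rat by field.
rewrite -N3 in n3E; rewrite -N1 -N3 in n2E.
rewrite -N2 -N3 in n1E; rewrite -N0 -N2 in n0E.
have [||||[y0 y1 y2 y3] [x0 x1 x2 x3]] := @parity8_odd j (t0 - w0) (t1 - w1) (t2 - w2)
  (t3' - w3') w0 w1 w2 w3' n0 n1 n2 n3'.
1-4: by apply: (@intr_inj rat);
  rewrite [RHS]rmorphM /= ?n0E ?n1E ?n2E ?n3E T0 T2 T4 T6 W1 W3 W5 W7 m_def l_def; field.
have /even_oddz[z0 Dz0] := y0; have /even_oddz[z1 Dz1] := y1.
have /even_oddz[z2 Dz2] := y2; have /even_oddz[z3 Dz3] := y3.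
have /even_oddz[r0 Dr0] := x0; have /even_oddz[r1 Dr1] := x1.
have /even_oddz[r2 Dr2] := x2; have /even_oddz[r3 Dr3] := x3.
rewrite -[2 * r0]addr0 in Dr0; rewrite -[2 * r1]addr0 in Dr1.
rewrite -[2 * r2]addr0 in Dr2; rewrite -[2 * r3]addr0 in Dr3.
have t0E := half_sum Dz0 Dr0; have t1E := half_sum Dz1 Dr1.
have t2E := half_sum Dz2 Dr2; have t3E := half_sum Dz3 Dr3.
(* The extra summands come from replacing the basis element [omega * (1 + psi)] by [omega * psi]. *)
exists (z0 + r0), (z1 + r1 + (z3 + r3)), (z2 + r2), (z3 + r3), r0, (r1 + r3), r2, r3.
split; split.
- by rewrite T0 t0E t1E t3E; field.
- by rewrite T2 t2E t3E; field.
- by rewrite T4 t1E t3E; field.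
- by rewrite T6 t3E; field.
- by rewrite W1 Dr0 Dr1 Dr3; field.
- by rewrite W3 Dr2 Dr3; field.
- by rewrite W5 Dr1 Dr3; field.
by rewrite W7 Dr3; field.
Qed.

End Tower8.

(** * The exceptional field [m = -3] *)

Definition rpoly8 (a0 a1 a2 a3 a4 a5 a6 a7 : rat) : {poly rat} :=
  Poly [:: a0; a1; a2; a3; a4; a5; a6; a7].

Lemma evalC_rpoly8 (a0 a1 a2 a3 a4 a5 a6 a7 : rat) (z : algC) :
  evalC z (rpoly8 a0 a1 a2 a3 a4 a5 a6 a7) = lin8 a0 a1 a2 a3 a4 a5 a6 a7 z.
Proof. by rewrite evalC_lin8 ?(leq_trans (size_Poly _)) // !coef_Poly. Qed.

(* The generator is [omega * theta] with [omega = (1 + theta ^+ 4) / 2] a sixth root of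
   unity: its fourth power is [2 - omega]. *)
Lemma monogenic_N3 (K : fieldExtType rat) :
    irreducible_poly ('X^8 - ((- 3%:Z)%:~R)%:P : {poly rat}) ->
    squarefreez (- 3%:Z) -> is_pure_field 8 (- 3%:Z) K ->
  monogenic K.
Proof.
move=> irr_m sq_m pureK.
apply: (monogenic_of_generator (A := rpoly8 0 2^-1 0 0 0 2^-1 0 0) irr_m pureK).
  move=> z z8; rewrite evalC_rpoly8 /lin8.
  have zA : z \in Aint by apply: (Aint_root_pure _ z8).
  have r2 : ((1 + z ^+ 4) / 2) ^+ 6 = 1%:~R.
    have -> : ((1 + z ^+ 4) / 2) ^+ 6 = (1 + 6 * z ^+ 4 + 15 * z ^+ 8 + 20 * z ^+ 4 * z ^+ 8
       + 15 * z ^+ 8 ^+ 2 + 6 * z ^+ 4 * z ^+ 8 ^+ 2 + z ^+ 8 ^+ 3) / 64 by field.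
    by rewrite z8; field.
  set y := (X in X \in _).
  have -> : y = (1 + z ^+ 4) / 2 * z by rewrite /y; field.
  by rewrite rpredM // (Aint_root_pure _ r2).
move=> B sB B_int; pose z : algC := 8.-root (- 3%:Z)%:~R.
have z8 : z ^+ 8 = (- 3%:Z)%:~R by rewrite rootCK.
have l_def : -1 = 2 * (-1) + 1 :> int by [].
have aA y : y ^+ 8 = (- 3%:Z)%:~R ->
    lin8 B`_0 B`_1 B`_2 B`_3 B`_4 B`_5 B`_6 B`_7 y \in Aint.
  by move=> y8; rewrite -evalC_lin8 // B_int.
have [u0 [u1 [u2 [u3 [v0 [v1 [v2 [v3 [[U0 U2 U4 U6] [V1 V3 V5 V7]]]]]]]]]] :=
  integral8_coords_odd sq_m (erefl : - 3%:Z = 1 + 4 * (-1)) aA l_def.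
(* At the generator [W] takes the value [omega], and [Z] the value
   [omega * (1 - omega) * theta = theta], as [omega * (1 - omega) = 1]. Products of these values
   give the integral basis found above. *)
pose W : {poly int} := 2%:P - 'X^4; pose Z : {poly int} := 'X * ('X^4 - 1).
exists ((u0%:P + u1%:P * W) + (v0%:P + v1%:P * W) * Z + (u2%:P + u3%:P * W) * Z ^+ 2
  + (v2%:P + v3%:P * W) * Z ^+ 3), z.
split=> //; rewrite evalC_lin8 // evalC_rpoly8.
set al := lin8 0 _ _ _ _ _ _ _ z.
have alE : al = (1 + z ^+ 4) / 2 * z by rewrite /al /lin8; field.
have al4 : 2 - al ^+ 4 = (1 + z ^+ 4) / 2.
  have -> : al ^+ 4
      = z ^+ 4 * (1 + 4 * z ^+ 4 + 6 * z ^+ 8 + 4 * z ^+ 4 * z ^+ 8 + z ^+ 8 ^+ 2) / 16.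
    by rewrite alE; field.
  rewrite z8.
  have -> : z ^+ 4 * (1 + 4 * z ^+ 4 + 6 * (- 3%:Z)%:~R + 4 * z ^+ 4 * (- 3%:Z)%:~R
      + (- 3%:Z)%:~R ^+ 2) / 16
    = (- 8 * z ^+ 4 - 8 * z ^+ 8) / 16 by field.
  by rewrite z8; field.
have alZ : al * (al ^+ 4 - 1) = z.
  have -> : al ^+ 4 - 1 = 1 - (1 + z ^+ 4) / 2 by rewrite -al4; ring.
  have -> : al * (1 - (1 + z ^+ 4) / 2) = z * (1 - z ^+ 8) / 4 by rewrite alE; field.
  by rewrite z8; field.
pose e p := (polyZC p).[al].
have eD p q : e (p + q) = e p + e q by rewrite /e /polyZC rmorphD hornerD.
have eM p q : e (p * q) = e p * e q by rewrite /e /polyZC rmorphM hornerM.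
have eX p n : e (p ^+ n) = e p ^+ n.
  by elim: n => [|n IH]; rewrite ?exprS ?eM ?IH // /e /polyZC rmorph1 hornerC.
have eC c : e c%:P = c%:~R by rewrite /e /polyZC map_polyC hornerC.
have eW : e W = (1 + z ^+ 4) / 2.
  by rewrite -al4 /e /polyZC rmorphB /= map_polyC map_polyXn !hornerE.
have eZ : e Z = z.
  by rewrite -[RHS]alZ /e /polyZC rmorphM rmorphB rmorph1 /= map_polyX map_polyXn !hornerE.
rewrite -/(e _) !(eD, eM, eX, eC, eW, eZ) /lin8 U0 U2 U4 U6 V1 V3 V5 V7.
by field.
Qed.

(** * Differences of conjugates at odd distance: the number [C] *)

Definition dvdAint (x y : algC) : Prop := exists2 q, q \in Aint & y = x * q.

Lemma dvdAintM (x1 y1 x2 y2 : algC) :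
  dvdAint x1 y1 -> dvdAint x2 y2 -> dvdAint (x1 * x2) (y1 * y2).
Proof.
by move=> [q1 q1A ->] [q2 q2A ->]; exists (q1 * q2); [apply: rpredM | ring].
Qed.

Lemma dvdAint_horner (p : {poly int}) (x y : algC) : x \in Aint -> y \in Aint ->
  dvdAint (x - y) ((polyZC p).[x] - (polyZC p).[y]).
Proof.
move=> xA yA; elim/poly_ind: p => [|p c [q qA E]].
  by exists 0; rewrite ?rpred0 // /polyZC rmorph0 !horner0 subrr mulr0.
exists (q * x + (polyZC p).[y]).
  by rewrite rpredD ?rpredM // polyZC_Aint.
rewrite /polyZC rmorphD rmorphM /= map_polyX map_polyC /= !hornerE.
rewrite -/(polyZC p); have -> : (x - y) * (q * x + (polyZC p).[y])
  = (x - y) * q * x + (x - y) * (polyZC p).[y] by ring.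
by rewrite -E; ring.
Qed.

(* Coordinates on [1, s, n, s * n] of the product in the biquadratic ring defined by
   [s ^+ 2 = 2] and [n ^+ 2 = - m]. *)
Definition emul (R : comNzRingType) (m : R) (x y : R * R * R * R) : R * R * R * R :=
  let: (x0, x1, x2, x3) := x in let: (y0, y1, y2, y3) := y in
  (x0 * y0 + 2 * x1 * y1 - m * (x2 * y2 + 2 * x3 * y3),
   x0 * y1 + x1 * y0 - m * (x2 * y3 + x3 * y2),
   x0 * y2 + 2 * x1 * y3 + x2 * y0 + 2 * x3 * y1,
   x0 * y3 + x1 * y2 + x2 * y1 + x3 * y0).

(** The norm in two steps: [n |-> - n] gives [(x0 + x1 * s) ^+ 2 + m * (x2 + x3 * s) ^+ 2], and then
    [s |-> - s]. *)
Definition enorm (R : comNzRingType) (m : R) (x : R * R * R * R) : R :=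
  let: (x0, x1, x2, x3) := x in
  (x0 ^+ 2 + 2 * x1 ^+ 2 + m * (x2 ^+ 2 + 2 * x3 ^+ 2)) ^+ 2
  - 2 * (2 * x0 * x1 + 2 * m * x2 * x3) ^+ 2.

Definition esub (R : comNzRingType) (x y : R * R * R * R) : R * R * R * R :=
  let: (x0, x1, x2, x3) := x in let: (y0, y1, y2, y3) := y in
  (x0 - y0, x1 - y1, x2 - y2, x3 - y3).

(** [S0coord] and [T1coord] are the two quadratic forms in [prod_diff4] for the differences of
    conjugates, freed of the factors [1 + w ^+ 2] and [2 * r * w ^+ 2]. What remains depends on the
    eighth root of unity [w] and on [r] only through [s = w - w ^+ 3] and [n = w ^+ 2 * r]; hence
    the biquadratic field. *)
Definition S0coord (R : comNzRingType) (m a1 a2 a3 a4 a5 a6 a7 : R) : R * R * R * R :=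
  let x := (a1, 0, a5, a5) in let z := (a3, 0, - a7, a7) in
  esub (esub (emul m (-1, 1, 0, 0) (emul m x x))
             (emul m (0, 0, -1, -1) (emul m z z)))
       (0 - 4 * m * a4 * a6, 0, 4 * a4 * a2, 0).

Definition T1coord (R : comNzRingType) (m a1 a2 a3 a4 a5 a6 a7 : R) : R * R * R * R :=
  let x := (a1, 0, a5, a5) in let z := (a3, 0, - a7, a7) in
  esub (emul m (0, 1, 0, 0) (emul m x z))
       (a2 ^+ 2 - m * a6 ^+ 2, 0, 2 * a2 * a6 + 2 * a4 ^+ 2, 0).

Definition xi_coord (R : comNzRingType) (m a1 a2 a3 a4 a5 a6 a7 : R) : R * R * R * R :=
  let S := S0coord m a1 a2 a3 a4 a5 a6 a7 in
  let T := T1coord m a1 a2 a3 a4 a5 a6 a7 in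
  esub (emul m (2, 0, 0, 0) (emul m S S)) (emul m (0, 0, 4, 0) (emul m T T)).

(** The ring is arbitrary because the form is evaluated over [rat], over [algC], over [int] once
    denominators are cleared, and over [{poly int}] to reduce it modulo [m]. *)
Definition odd_index (R : comNzRingType) (m a1 a2 a3 a4 a5 a6 a7 : R) : R :=
  enorm m (xi_coord m a1 a2 a3 a4 a5 a6 a7).

Section Morphism.

Variables (R S : comNzRingType) (f : {rmorphism R -> S}).

Definition emap (x : R * R * R * R) : S * S * S * S :=
  let: (x0, x1, x2, x3) := x in (f x0, f x1, f x2, f x3).

Lemma emapM m x y : emap (emul m x y) = emul (f m) (emap x) (emap y).
Proof.
case: x => [[[x0 x1] x2] x3]; case: y => [[[y0 y1] y2] y3] /=.
by congr (_, _, _, _); ring.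
Qed.

Lemma emapB x y : emap (esub x y) = esub (emap x) (emap y).
Proof.
case: x => [[[x0 x1] x2] x3]; case: y => [[[y0 y1] y2] y3] /=.
by congr (_, _, _, _); ring.
Qed.

Lemma odd_index_map m a1 a2 a3 a4 a5 a6 a7 :
  f (odd_index m a1 a2 a3 a4 a5 a6 a7)
  = odd_index (f m) (f a1) (f a2) (f a3) (f a4) (f a5) (f a6) (f a7).
Proof.
have -> x : f (enorm m x) = enorm (f m) (emap x).
  by case: x => [[[x0 x1] x2] x3] /=; ring.
congr enorm; rewrite /xi_coord emapB !emapM.
have -> : emap (S0coord m a1 a2 a3 a4 a5 a6 a7)
    = S0coord (f m) (f a1) (f a2) (f a3) (f a4) (f a5) (f a6) (f a7).
  rewrite /S0coord !emapB !emapM /emap !rmorphN rmorph0 rmorph1.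
  by congr (esub _ _); congr (_, _, _, _); ring.
have -> : emap (T1coord m a1 a2 a3 a4 a5 a6 a7)
    = T1coord (f m) (f a1) (f a2) (f a3) (f a4) (f a5) (f a6) (f a7).
  rewrite /T1coord !emapB !emapM /emap !rmorphN rmorph0 rmorph1.
  by congr (esub _ _); congr (_, _, _, _); ring.
by rewrite /emap rmorph0 !rmorph_nat.
Qed.

End Morphism.

Section Eval.

Variables (m s n : algC).
Hypotheses (s2 : s ^+ 2 = 2) (n2 : n ^+ 2 = - m).

Definition eeval (s n : algC) (x : algC * algC * algC * algC) : algC :=
  let: (x0, x1, x2, x3) := x in x0 + x1 * s + (x2 + x3 * s) * n.

Lemma eevalM x y : eeval s n (emul m x y) = eeval s n x * eeval s n y.
Proof.
case: x => [[[x0 x1] x2] x3]; case: y => [[[y0 y1] y2] y3] /=.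
have -> : m = - n ^+ 2 by rewrite n2 opprK.
by ring: s2.
Qed.

Lemma eevalB x y : eeval s n (esub x y) = eeval s n x - eeval s n y.
Proof.
by case: x => [[[x0 x1] x2] x3]; case: y => [[[y0 y1] y2] y3] /=; ring.
Qed.

Lemma eeval_norm x : eeval s n x * eeval (- s) (- n) x * (eeval (- s) n x * eeval s (- n) x)
  = enorm m x.
Proof.
case: x => [[[x0 x1] x2] x3] /=.
have -> : m = - n ^+ 2 by rewrite n2 opprK.
by ring: s2.
Qed.

Definition S0eval (s n a1 a2 a3 a4 a5 a6 a7 : algC) : algC :=
  (s - 1) * (a1 + a5 * (1 + s) * n) ^+ 2 + (1 + s) * n * (a3 + a7 * (s - 1) * n) ^+ 2
  - 4 * a4 * n * (a2 + a6 * n).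

Definition T1eval (s n a1 a2 a3 a4 a5 a6 a7 : algC) : algC :=
  s * (a1 + a5 * (1 + s) * n) * (a3 + a7 * (s - 1) * n) - (a2 + a6 * n) ^+ 2
  - 2 * a4 ^+ 2 * n.

Lemma eeval_xi a1 a2 a3 a4 a5 a6 a7 :
  eeval s n (xi_coord m a1 a2 a3 a4 a5 a6 a7)
  = 2 * S0eval s n a1 a2 a3 a4 a5 a6 a7 ^+ 2 - 4 * n * T1eval s n a1 a2 a3 a4 a5 a6 a7 ^+ 2.
Proof.
have SE : eeval s n (S0coord m a1 a2 a3 a4 a5 a6 a7) = S0eval s n a1 a2 a3 a4 a5 a6 a7.
  rewrite /S0coord !eevalB !eevalM /eeval /S0eval.
  have -> : m = - n ^+ 2 by rewrite n2 opprK.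
  by ring.
have TE : eeval s n (T1coord m a1 a2 a3 a4 a5 a6 a7) = T1eval s n a1 a2 a3 a4 a5 a6 a7.
  rewrite /T1coord !eevalB !eevalM /eeval /T1eval.
  have -> : m = - n ^+ 2 by rewrite n2 opprK.
  by ring.
rewrite /xi_coord eevalB !eevalM SE TE /eeval; ring.
Qed.

End Eval.

(** [F z * F (- z)] has the form [P + Q * z ^+ 2], the other pair gives [P - Q * z ^+ 2], and
    [z ^+ 4 = r]. *)
Lemma prod_diff4 (r z i d0 d1 d2 d3 : algC) : z ^+ 4 = r -> i ^+ 2 = -1 ->
  let F y := d0 + d1 * y + d2 * y ^+ 2 + d3 * y ^+ 3 in
  F z * F (i * z) * F (- z) * F (- (i * z))
  = (d0 ^+ 2 + r * d2 ^+ 2 - 2 * r * d1 * d3) ^+ 2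
    - r * (2 * d0 * d2 - d1 ^+ 2 - r * d3 ^+ 2) ^+ 2.
Proof. by move=> z4 i2 F; rewrite /F -z4; ring: i2. Qed.

Section DiffProduct.

Variables a0 a1 a2 a3 a4 a5 a6 a7 : rat.
Let L := lin8 a0 a1 a2 a3 a4 a5 a6 a7.

Definition diff_prod (w z : algC) : algC :=
  let i := w ^+ 2 in let D y := L y - L (w * y) in
  D z * D (i * z) * D (- z) * D (- (i * z)).

Lemma diff_prodE (w z : algC) : w ^+ 4 = -1 ->
  let s := w - w ^+ 3 in let n := w ^+ 2 * z ^+ 4 in
  diff_prod w z = - n *
   (2 * S0eval s n (ratr a1) (ratr a2) (ratr a3) (ratr a4) (ratr a5) (ratr a6) (ratr a7) ^+ 2
    - 4 * n * T1eval s n (ratr a1) (ratr a2) (ratr a3) (ratr a4) (ratr a5) (ratr a6) (ratr a7) ^+ 2).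
Proof.
move=> w4 s n; set r := z ^+ 4.
set A1 : algC := ratr a1; set A2 : algC := ratr a2; set A3 : algC := ratr a3.
set A4 : algC := ratr a4; set A5 : algC := ratr a5; set A6 : algC := ratr a6.
set A7 : algC := ratr a7.
(* The degrees [k] and [k + 4] are merged by [y ^+ 4 = r]; the signs differ because
   [w ^+ (k + 4) = - w ^+ k]. *)
pose d0 := 2 * A4 * r; pose d1 := A1 * (1 - w) + A5 * r * (1 + w).
pose d2 := A2 * (1 - w ^+ 2) + A6 * r * (1 + w ^+ 2).
pose d3 := A3 * (1 - w ^+ 3) + A7 * r * (1 + w ^+ 3).
pose F y := d0 + d1 * y + d2 * y ^+ 2 + d3 * y ^+ 3.
have DE y : y ^+ 4 = r -> L y - L (w * y) = F y.
  by move=> yr; rewrite /F /d0 /d1 /d2 /d3 /L /lin8 -yr; ring: w4.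
have i2 : (w ^+ 2) ^+ 2 = -1 by rewrite -exprM.
rewrite /diff_prod !DE //; last 3 first.
- by rewrite exprNn exprMn -signr_odd mul1r (exprM _ 2 2) i2 sqrrN expr1n mul1r.
- by rewrite exprNn -signr_odd mul1r.
- by rewrite exprMn (exprM _ 2 2) i2 sqrrN expr1n mul1r.
rewrite (@prod_diff4 r z (w ^+ 2) d0 d1 d2 d3 erefl i2).
have -> : 2 * d0 * d2 - d1 ^+ 2 - r * d3 ^+ 2
    = (1 + w ^+ 2) * S0eval s n A1 A2 A3 A4 A5 A6 A7.
  by rewrite /S0eval /d0 /d1 /d2 /d3 /s /n -/r; ring: w4.
have -> : d0 ^+ 2 + r * d2 ^+ 2 - 2 * r * d1 * d3
    = 2 * r * w ^+ 2 * T1eval s n A1 A2 A3 A4 A5 A6 A7.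
  by rewrite /T1eval /d0 /d1 /d2 /d3 /s /n -/r; ring: w4.
move: (S0eval _ _ _ _ _ _ _ _ _) (T1eval _ _ _ _ _ _ _ _ _) => S T.
by rewrite /n -/r; ring: w4.
Qed.

End DiffProduct.

Lemma eq_pm1_of_dvd (c m : int) (k : nat) : oddz m ->
  (exists q, 16 = c * q) -> (exists q, m ^+ k = c * q) -> c = 1 \/ c = -1.
Proof.
move=> m_odd [q1 E1] [q2 E2].
have c16 : (c %| 2 ^+ 4)%Z by apply/dvdzP; exists q1; rewrite mulrC -E1.
have cm : (c %| m ^+ k)%Z by apply/dvdzP; exists q2; rewrite mulrC -E2.
have cop : coprimez (2 ^+ 4) (m ^+ k).
  by rewrite coprimezE !abszX coprimeXl // coprimeXr // coprime2n.
have : (c %| gcdz (2 ^+ 4) (m ^+ k))%Z by rewrite dvdz_gcd c16 cm.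
by move: cop; rewrite /coprimez => /eqP ->; rewrite dvdz1; lia.
Qed.

Section Generator.

Variables (m : int) (a0 a1 a2 a3 a4 a5 a6 a7 : rat) (pw pt : {poly int}).
Hypothesis sq_m : squarefreez m.
Hypothesis m_neq0 : m <> 0.
Hypothesis m_odd : oddz m.
Let L := lin8 a0 a1 a2 a3 a4 a5 a6 a7.
Hypothesis LA : forall z : algC, z ^+ 8 = m%:~R -> L z \in Aint.
Hypothesis pwE : forall z : algC, z ^+ 8 = m%:~R -> (1 + z ^+ 4) / 2 = (polyZC pw).[L z].
Hypothesis ptE : forall z : algC, z ^+ 8 = m%:~R -> z = (polyZC pt).[L z].

Lemma diff_dvd_r (w z : algC) : w ^+ 4 = -1 -> z ^+ 8 = m%:~R ->
  dvdAint (L z - L (w * z)) (z ^+ 4).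
Proof.
move=> w4 z8.
have wz8 : (w * z) ^+ 8 = m%:~R by rewrite exprMn z8 (exprM _ 4 2) w4 sqrrN expr1n mul1r.
have := dvdAint_horner pw (LA z8) (LA wz8); rewrite -!pwE //.
by rewrite exprMn w4; congr dvdAint; field.
Qed.

Lemma diff_dvd_theta (w z : algC) : w ^+ 4 = -1 -> z ^+ 8 = m%:~R ->
  dvdAint (L z - L (w * z)) (z * (1 - w)).
Proof.
move=> w4 z8.
have wz8 : (w * z) ^+ 8 = m%:~R by rewrite exprMn z8 (exprM _ 4 2) w4 sqrrN expr1n mul1r.
have := dvdAint_horner pt (LA z8) (LA wz8); rewrite -!ptE //.
by congr dvdAint; ring.
Qed.

Let iz8 (w z : algC) : w ^+ 4 = -1 -> z ^+ 8 = m%:~R -> (w ^+ 2 * z) ^+ 8 = m%:~R.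
Proof.
by move=> w4 z8; rewrite exprMn z8 -exprM (exprM _ 4 4) w4 -signr_odd mul1r.
Qed.

Let Nz8 (z : algC) : z ^+ 8 = m%:~R -> (- z) ^+ 8 = m%:~R.
Proof. by move=> z8; rewrite exprNn -signr_odd mul1r. Qed.

Lemma diff_prod_dvd_r (w z : algC) : w ^+ 4 = -1 -> z ^+ 8 = m%:~R ->
  dvdAint (diff_prod a0 a1 a2 a3 a4 a5 a6 a7 w z) (z ^+ 16).
Proof.
move=> w4 z8; have iz := iz8 w4 z8.
have := dvdAintM (dvdAintM (dvdAintM (diff_dvd_r w4 z8) (diff_dvd_r w4 iz))
  (diff_dvd_r w4 (Nz8 z8))) (diff_dvd_r w4 (Nz8 iz)).
by congr dvdAint; ring: w4.
Qed.

Lemma diff_prod_dvd_theta (w z : algC) : w ^+ 4 = -1 -> z ^+ 8 = m%:~R ->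
  dvdAint (diff_prod a0 a1 a2 a3 a4 a5 a6 a7 w z) (- z ^+ 4 * (1 - w) ^+ 4).
Proof.
move=> w4 z8; have iz := iz8 w4 z8.
have := dvdAintM (dvdAintM (dvdAintM (diff_dvd_theta w4 z8) (diff_dvd_theta w4 iz))
  (diff_dvd_theta w4 (Nz8 z8))) (diff_dvd_theta w4 (Nz8 iz)).
by congr dvdAint; ring: w4.
Qed.

Lemma diff_prod_Aint (w z : algC) : w ^+ 4 = -1 -> z ^+ 8 = m%:~R ->
  diff_prod a0 a1 a2 a3 a4 a5 a6 a7 w z \in Aint.
Proof.
move=> w4 z8; have iz := iz8 w4 z8.
have wz8 y : y ^+ 8 = m%:~R -> (w * y) ^+ 8 = m%:~R.
  by move=> y8; rewrite exprMn y8 (exprM _ 4 2) w4 sqrrN expr1n mul1r.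
have D y : y ^+ 8 = m%:~R -> L y - L (w * y) \in Aint.
  by move=> y8; rewrite rpredB ?LA // wz8.
by rewrite !rpredM // D // ?Nz8.
Qed.

Lemma odd_index_pm1 :
  let C := odd_index m%:~R a1 a2 a3 a4 a5 a6 a7 in C = 1 \/ C = -1.
Proof.
set C := odd_index _ _ _ _ _ _ _ _ => /=.
have [w w4] := root8_exists.
have wA : w \in Aint by apply: (@Aint_root_pure 4 (-1)).
pose z : algC := 8.-root m%:~R; have z8 : z ^+ 8 = m%:~R by rewrite rootCK.
have zA : z \in Aint by apply: (Aint_root_pure _ z8).
have w3 : (w ^+ 3) ^+ 4 = -1 by rewrite -exprM mulnC exprM w4 -signr_odd.
have wN : (- w) ^+ 4 = -1 by rewrite exprNn -signr_odd mul1r.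
have w3N : (- w ^+ 3) ^+ 4 = -1 by rewrite exprNn -signr_odd mul1r.
pose W v := diff_prod a0 a1 a2 a3 a4 a5 a6 a7 v z.
(* Since [- w = w ^+ 5] and [- w ^+ 3 = w ^+ 7], the four odd powers of [w] occur. Each factor is
   [n] times a conjugate of [xi], up to sign. *)
pose D := W w * W (w ^+ 3) * (W (- w) * W (- w ^+ 3)).
pose s := w - w ^+ 3; pose n := w ^+ 2 * z ^+ 4.
have s2 : s ^+ 2 = 2 by rewrite /s; ring: w4.
have n2 : n ^+ 2 = - m%:~R by rewrite /n -z8; ring: w4.
have sN2 : (- s) ^+ 2 = 2 by rewrite sqrrN.
have nN2 : (- n) ^+ 2 = - m%:~R by rewrite sqrrN.
pose x s n := eeval s n (xi_coord m%:~R (ratr a1) (ratr a2) (ratr a3) (ratr a4)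
                          (ratr a5) (ratr a6) (ratr a7)).
have xE s' n' : s' ^+ 2 = 2 -> n' ^+ 2 = - m%:~R -> x s' n' = 2 * S0eval s' n' (ratr a1)
    (ratr a2) (ratr a3) (ratr a4) (ratr a5) (ratr a6) (ratr a7) ^+ 2
    - 4 * n' * T1eval s' n' (ratr a1) (ratr a2) (ratr a3) (ratr a4)
                          (ratr a5) (ratr a6) (ratr a7) ^+ 2.
  by move=> s2' n2'; apply: eeval_xi.
have W1 : W w = - n * x s n by rewrite /W diff_prodE // xE.
have W3 : W (w ^+ 3) = n * x (- s) (- n).
  rewrite /W diff_prodE // xE //.
  have -> : w ^+ 3 - (w ^+ 3) ^+ 3 = - s by rewrite /s; ring: w4.
  have -> : (w ^+ 3) ^+ 2 * z ^+ 4 = - n by rewrite /n; ring: w4.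
  by rewrite opprK.
have W5 : W (- w) = - n * x (- s) n.
  rewrite /W diff_prodE // xE //.
  have -> : - w - (- w) ^+ 3 = - s by rewrite /s; ring: w4.
  by have -> : (- w) ^+ 2 * z ^+ 4 = n by rewrite /n; ring: w4.
have W7 : W (- w ^+ 3) = n * x s (- n).
  rewrite /W diff_prodE // xE //.
  have -> : - w ^+ 3 - (- w ^+ 3) ^+ 3 = s by rewrite /s; ring: w4.
  have -> : (- w ^+ 3) ^+ 2 * z ^+ 4 = - n by rewrite /n; ring: w4.
  by rewrite opprK.
have CE : ratr C = x s n * x (- s) (- n) * (x (- s) n * x s (- n)).
  by rewrite /x (eeval_norm s2 n2) /C odd_index_map /= ratr_int.
have DE : D = ratr (m%:~R ^+ 2 * C).
  rewrite rmorphM /= CE /D W1 W3 W5 W7 rmorphXn /= ratr_int.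
  have -> : m%:~R = - n ^+ 2 :> algC by rewrite n2 opprK.
  by ring.
have DA : D \in Aint.
  by do 2!apply: rpredM; apply: diff_prod_Aint.
have [b bE] := integral8_coef sq_m m_neq0 LA.
have sA : s \in Aint by rewrite rpredB ?rpredX.
have nA : n \in Aint by rewrite rpredM ?rpredX.
(* [xi] is homogeneous of degree 4 in coefficients of denominator 8, and [8 ^ 4 = 2 ^ 12]. So the
   denominator of [C] is a power of 2, whereas integrality of [D] bounds it by [m ^+ 2]. *)
have xA s' n' : s' ^+ 2 = 2 -> n' ^+ 2 = - m%:~R -> s' \in Aint -> n' \in Aint ->
    2 ^+ 12 * x s' n' \in Aint.
  move=> s2' n2' sA' nA'; rewrite xE //.
  move: (bE 1%N isT) (bE 2%N isT) (bE 3%N isT) (bE 4%N isT) (bE 5%N isT) (bE 6%N isT)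
    (bE 7%N isT) => /= E1 E2 E3 E4 E5 E6 E7.
  pose B i : algC := (b i)%:~R.
  have -> : 2 ^+ 12 * (2 * S0eval s' n' (ratr a1)
    (ratr a2) (ratr a3) (ratr a4) (ratr a5) (ratr a6) (ratr a7) ^+ 2
    - 4 * n' * T1eval s' n' (ratr a1) (ratr a2) (ratr a3) (ratr a4)
                          (ratr a5) (ratr a6) (ratr a7) ^+ 2)
    = 2 * S0eval s' n' (B 1%N) (B 2%N) (B 3%N) (B 4%N) (B 5%N) (B 6%N) (B 7%N) ^+ 2
     - 4 * n' * T1eval s' n' (B 1%N) (B 2%N) (B 3%N) (B 4%N) (B 5%N) (B 6%N) (B 7%N) ^+ 2.
    by rewrite E1 E2 E3 E4 E5 E6 E7 /S0eval /T1eval /B; field.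
  have BA i : B i \in Aint by rewrite Aint_int.
  by rewrite /S0eval /T1eval !(rpredD, rpredN, rpredM, rpredX, rpred1, rpred_nat).
have mul4 (k x1 x2 x3 x4 : algC) :
    k ^+ 4 * (x1 * x2 * (x3 * x4)) = (k * x1) * (k * x2) * ((k * x3) * (k * x4)).
  by ring.
have CA : (2 ^+ 12) ^+ 4 * ratr C \in Aint.
  by rewrite CE mul4; do 2!apply: rpredM; apply: xA; rewrite ?rpredN.
have [c Dc] : exists c : int, C = c%:~R.
  apply: ratr_Aint; apply: (@coprime_Aint (m ^+ 2) ((2 ^+ 12) ^+ 4)).
  - by rewrite coprimezE !abszX coprimeXl // !coprimeXr // coprime_sym coprime2n.
  - by rewrite rmorphXn /=; move: DA; rewrite DE rmorphM rmorphXn /= ratr_int.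
  by rewrite !rmorphXn.
have m_neq0C : (m%:~R : algC) != 0 by rewrite intr_eq0; apply/eqP.
(* Four factors [z ^+ 16] make [m ^+ 8]. In [D2] the 16 is the fourth power of 2, the product of
   [1 - w ^+ j] over odd [j]. *)
have D1 : dvdAint D (m%:~R ^+ 8).
  have := dvdAintM (dvdAintM (diff_prod_dvd_r w4 z8) (diff_prod_dvd_r w3 z8))
    (dvdAintM (diff_prod_dvd_r wN z8) (diff_prod_dvd_r w3N z8)).
  by congr dvdAint; rewrite -z8; ring.
have D2 : dvdAint D (m%:~R ^+ 2 * 16).
  have := dvdAintM (dvdAintM (diff_prod_dvd_theta w4 z8) (diff_prod_dvd_theta w3 z8))
    (dvdAintM (diff_prod_dvd_theta wN z8) (diff_prod_dvd_theta w3N z8)).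
  by congr dvdAint; rewrite -z8; ring: w4.
have C0 : C != 0.
  apply/eqP => C0; case: D1 => q _; rewrite DE C0 mulr0 rmorph0 mul0r => /eqP.
  by rewrite expf_eq0 (negPf m_neq0C).
have intq (e : rat) (q : algC) : q \in Aint -> ratr e = ratr C * q ->
    exists k : int, e = C * k%:~R.
  move=> qA E; have [|k Dk] := @ratr_Aint (e / C).
    rewrite rmorphM fmorphV /= E mulrAC divff ?mul1r //.
    by rewrite fmorph_eq0.
  by exists k; rewrite -Dk mulrC divfK.
have mCE : ratr (m%:~R ^+ 2 * C) = m%:~R ^+ 2 * ratr C :> algC.
  by rewrite rmorphM rmorphXn /= ratr_int.
suff : c = 1 \/ c = -1 by rewrite Dc; case=> ->; [left | right].
apply: (@eq_pm1_of_dvd c m 6 m_odd).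
- case: D2 => q qA; rewrite DE => E.
  have [|k Dk] := intq 16 q qA.
    apply: (mulfI (expf_neq0 2 m_neq0C)).
    by rewrite ratr_nat E mCE -mulrA.
  by exists k; apply: (@intr_inj rat); rewrite [RHS]rmorphM /= -Dc -Dk.
case: D1 => q qA; rewrite DE => E.
have [|k Dk] := intq (m%:~R ^+ 6) q qA.
  apply: (mulfI (expf_neq0 2 m_neq0C)).
  by rewrite rmorphXn /= ratr_int -exprD E mCE -mulrA.
by exists k; apply: (@intr_inj rat); rewrite [RHS]rmorphM /= -Dc -Dk rmorphXn.
Qed.

End Generator.

(** * Differences of opposite conjugates: the number [A] *)

Definition even_index (R : comNzRingType) (m a1 a3 a5 a7 : R) : R :=
  (a1 ^+ 2 + m * a5 ^+ 2 - 2 * m * a3 * a7) ^+ 2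
  - m * (2 * a1 * a5 - a3 ^+ 2 - m * a7 ^+ 2) ^+ 2.

Lemma Aint_monic_eq (n : nat) (c : nat -> int) (x : algC) :
  x ^+ n = \sum_(i < n) (c i)%:~R * x ^+ i -> x \in Aint.
Proof.
move=> xn; pose p : {poly int} := 'X^n - \poly_(i < n) c i.
have p_mon : p \is monic.
  rewrite monicE lead_coefDl ?lead_coefXn // size_polyXn size_polyN.
  by rewrite ltnS size_poly.
apply: (@root_monic_Aint (polyZC p)); last 2 first.
- exact: monic_map.
- by apply/polyOverP => i; rewrite coef_map intr_int.
rewrite rootE /polyZC rmorphB /= map_polyXn !hornerE xn subr_eq0; apply/eqP.
have s : (size (map_poly (intr : int -> algC) (\poly_(i < n) c i)) <= n)%N.
  by rewrite (leq_trans (size_poly _ _)) // size_poly.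
rewrite (horner_coef_wide _ s); apply: eq_bigr => i _.
by rewrite coef_map coef_poly ltn_ord.
Qed.

Lemma even_indexE (m : int) (a1 a3 a5 a7 : rat) (i x : algC) :
    i ^+ 2 = -1 -> x ^+ 4 = m%:~R ->
  let v := lin4 a1 a3 a5 a7 in
  ratr (even_index m%:~R a1 a3 a5 a7) = v x * v (i * x) * v (- x) * v (- (i * x)).
Proof.
move=> i2 x4 v; rewrite /even_index /v /lin4.
have -> : ratr ((a1 ^+ 2 + m%:~R * a5 ^+ 2 - 2 * m%:~R * a3 * a7) ^+ 2
  - m%:~R * (2 * a1 * a5 - a3 ^+ 2 - m%:~R * a7 ^+ 2) ^+ 2)
  = (ratr a1 ^+ 2 + m%:~R * ratr a5 ^+ 2 - 2 * m%:~R * ratr a3 * ratr a7) ^+ 2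
  - m%:~R * (2 * ratr a1 * ratr a5 - ratr a3 ^+ 2 - m%:~R * ratr a7 ^+ 2) ^+ 2 :> algC.
  by ring.
by rewrite -x4; ring: i2.
Qed.

Lemma Aint_omega (m l : int) (x : algC) : m = 1 + 4 * l -> x ^+ 4 = m%:~R ->
  (1 + x ^+ 2) / 2 \in Aint.
Proof.
move=> -> x4.
apply: (@Aint_monic_eq 2 (fun i => nth 0 [:: l; 1] i)).
rewrite !big_ord_recr big_ord0 /=.
have -> : l%:~R = (x ^+ 4 - 1) / 4 :> algC by rewrite x4; field.
by field.
Qed.

(** Calling the element [e], [(x - 1) * e = (m - 1) / 4 = 2 * j]. Inserting [x = 1 + 2 * j / e] into
    [x ^+ 4 = m] and clearing denominators gives the monic equation; the coefficient of [e ^+ k] is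
    [binomial(4, k) * (2 * j) ^+ (4 - k) / (8 * j)]. *)
Lemma Aint_e2 (m j : int) (x : algC) : m = 1 + 8 * j -> x ^+ 4 = m%:~R ->
  (1 + x + x ^+ 2 + x ^+ 3) / 4 \in Aint.
Proof.
move=> -> x4.
apply: (@Aint_monic_eq 4 (fun i => nth 0 [:: 2 * j ^+ 3; 4 * j ^+ 2; 3 * j; 1] i)).
rewrite !big_ord_recr big_ord0 /=.
pose y := (x ^+ 4 - 1) / 8.
have jE : j%:~R = y by rewrite /y x4; field.
have -> : (2 * j ^+ 3)%:~R = 2 * y ^+ 3 by rewrite -jE; ring.
have -> : (4 * j ^+ 2)%:~R = 4 * y ^+ 2 by rewrite -jE; ring.
have -> : (3 * j)%:~R = 3 * y by rewrite -jE; ring.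
by rewrite /y; field.
Qed.

Lemma Aint_e3 (m i : int) (z : algC) : m = 1 + 16 * i -> z ^+ 8 = m%:~R ->
  (1 + z + z ^+ 2 + z ^+ 3 + z ^+ 4 + z ^+ 5 + z ^+ 6 + z ^+ 7) / 8 \in Aint.
Proof.
move=> -> z8; have [z1|z1] := eqVneq z 1.
  by rewrite z1 (_ : _ / 8 = 1) ?rpred1 //; field.
set e := _ / 8; pose u := z - 1.
have u0 : u != 0 by rewrite subr_eq0.
have ue : u * e = 2 * i%:~R.
  have -> : u * e = (z ^+ 8 - 1) / 8 by rewrite /u /e; field.
  by rewrite z8; field.
have u8 : u ^+ 8 = 16 * i%:~R - 8 * u - 28 * u ^+ 2 - 56 * u ^+ 3 - 70 * u ^+ 4
    - 56 * u ^+ 5 - 28 * u ^+ 6 - 8 * u ^+ 7.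
  have -> : 16 * i%:~R = z ^+ 8 - 1 by rewrite z8; ring.
  by rewrite /u; ring.
(* As for [Aint_e2], from [u * e = 2 * i]: the coefficient of [e ^+ k] is [binomial(8, k) * (2 * i)
   ^+ (8 - k) / (16 * i)]. The equation is checked after multiplication by [u ^+ 8], which is why
   [z = 1] was set apart. *)
apply: (@Aint_monic_eq 8 (fun k => nth 0 [:: 16 * i ^+ 7; 64 * i ^+ 6; 112 * i ^+ 5;
  112 * i ^+ 4; 70 * i ^+ 3; 28 * i ^+ 2; 7 * i; 1] k)).
rewrite !big_ord_recr big_ord0 /=; apply: (mulfI (expf_neq0 8 u0)).
pose y : algC := i%:~R; rewrite -/y in ue u8.
have -> : u ^+ 8 * e ^+ 8 = (u * e) ^+ 8 by ring.
set S := (X in u ^+ 8 * X).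
have -> : u ^+ 8 * S = 16 * y ^+ 7 * u ^+ 8 + 64 * y ^+ 6 * u ^+ 7 * (u * e)
    + 112 * y ^+ 5 * u ^+ 6 * (u * e) ^+ 2 + 112 * y ^+ 4 * u ^+ 5 * (u * e) ^+ 3
    + 70 * y ^+ 3 * u ^+ 4 * (u * e) ^+ 4 + 28 * y ^+ 2 * u ^+ 3 * (u * e) ^+ 5
    + 7 * y * u ^+ 2 * (u * e) ^+ 6 + u * (u * e) ^+ 7.
  by rewrite /S /y; ring.
by rewrite ue u8; ring.
Qed.

Lemma half_notin_Aint : (2^-1 : algC) \notin Aint.
Proof.
apply/negP => H; have [|k] := @ratr_Aint 2^-1; first by rewrite fmorphV rmorph_nat.
move/(congr1 (fun q : rat => 2 * q)); rewrite mulfV // => E.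
have /(@intr_inj rat) : (2 * k)%:~R = 1%:~R :> rat by rewrite rmorphM /= -E.
by lia.
Qed.

(** The four conjugates add up to [4 / 8]. *)
Lemma half_e2_notin_Aint (m : int) : m <> 0 ->
  ~ (forall x : algC, x ^+ 4 = m%:~R -> (1 + x + x ^+ 2 + x ^+ 3) / 8 \in Aint).
Proof.
move=> m0 H; have i2 := sqrCi algC.
pose x : algC := 4.-root m%:~R; have x4 : x ^+ 4 = m%:~R by rewrite rootCK.
have xi4 : ('i * x) ^+ 4 = m%:~R by rewrite exprMn x4 (exprM _ 2 2) i2 sqrrN expr1n mul1r.
have N4 y : y ^+ 4 = m%:~R -> (- y) ^+ 4 = m%:~R :> algC.
  by move=> y4; rewrite exprNn -signr_odd mul1r.
have := half_notin_Aint; apply/negP/negPn.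
have -> : 2^-1 = (1 + x + x ^+ 2 + x ^+ 3) / 8 + (1 + - x + (- x) ^+ 2 + (- x) ^+ 3) / 8
  + ((1 + 'i * x + ('i * x) ^+ 2 + ('i * x) ^+ 3) / 8
  + (1 + - ('i * x) + (- ('i * x)) ^+ 2 + (- ('i * x)) ^+ 3) / 8) :> algC.
  by rewrite [in ('i * x) ^+ 2]exprMn [in (- ('i * x)) ^+ 2]sqrrN [in ('i * x) ^+ 2]exprMn i2; field.
by rewrite !rpredD // H // ?N4.
Qed.

Section EvenIndex.

Variables (m : int) (a0 a1 a2 a3 a4 a5 a6 a7 : rat) (pt : {poly int}).
Hypothesis m_neq0 : m <> 0.
Let L := lin8 a0 a1 a2 a3 a4 a5 a6 a7.
Let v := lin4 a1 a3 a5 a7.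
Hypothesis LA : forall z : algC, z ^+ 8 = m%:~R -> L z \in Aint.
Hypothesis ptE : forall z : algC, z ^+ 8 = m%:~R -> z = (polyZC pt).[L z].

Let sqrt8 (x : algC) : x ^+ 4 = m%:~R -> sqrtC x ^+ 8 = m%:~R.
Proof. by move=> x4; rewrite (exprM _ 2 4) sqrtCK. Qed.

Lemma diff_opp (z : algC) : L z - L (- z) = 2 * z * v (z ^+ 2).
Proof. by rewrite /L /v /lin8 /lin4; ring. Qed.

(** Under [z |-> - z] an element changes by [2 * z] times its odd part, so divisibility of
    differences becomes divisibility of odd parts. The integer [theta] then makes [v x] the inverse
    of an integer. *)
Lemma dvd_odd_part (p : {poly int}) (x y : algC) : x ^+ 4 = m%:~R ->
    (let z := sqrtC x in 2 * z * y = (polyZC p).[L z] - (polyZC p).[L (- z)]) ->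
  exists2 q, q \in Aint & y = v x * q.
Proof.
move=> x4; have z8 := sqrt8 x4; set z := sqrtC x in z8 *; move=> /= E.
have Nz8 : (- z) ^+ 8 = m%:~R by rewrite exprNn -signr_odd mul1r.
have z0 : 2 * z != 0.
  rewrite mulf_neq0 ?pnatr_eq0 //; apply/eqP => z0; move: z8; rewrite z0 expr0n => /esym/eqP.
  by rewrite intr_eq0 => /eqP.
have [q qA] := dvdAint_horner p (LA z8) (LA Nz8).
rewrite -E diff_opp -[RHS]mulrA => /(mulfI z0) ->; exists q => //.
by rewrite sqrtCK.
Qed.

Lemma odd_part_unit (x : algC) : x ^+ 4 = m%:~R -> exists2 q, q \in Aint & 1 = v x * q.
Proof.
move=> x4; apply: (@dvd_odd_part pt) => //=; have z8 := sqrt8 x4.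
rewrite -!ptE //; first by ring.
by rewrite exprNn -signr_odd mul1r.
Qed.

Lemma even_index_unit : exists2 k : int, even_index m%:~R a1 a3 a5 a7 * k%:~R = 1 &
  (k = 1 \/ k = -1) -> forall x : algC, x ^+ 4 = m%:~R -> v x \in Aint.
Proof.
have i2 := sqrCi algC.
have conj4 (x : algC) : x ^+ 4 = m%:~R -> [/\ ('i * x) ^+ 4 = m%:~R, (- x) ^+ 4 = m%:~R &
    (- ('i * x)) ^+ 4 = m%:~R].
  move=> x4; have ix4 : ('i * x) ^+ 4 = m%:~R.
    by rewrite exprMn x4 (exprM _ 2 2) i2 sqrrN expr1n mul1r.
  by split=> //; rewrite exprNn -signr_odd mul1r.
have main (x : algC) : x ^+ 4 = m%:~R -> exists2 q, q \in Aint &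
    exists2 e, e \in Aint & v x * q = 1 /\ ratr (even_index m%:~R a1 a3 a5 a7) * (q * e) = 1.
  move=> x4; have [x14 x24 x34] := conj4 x x4.
  have [q0 q0A E0] := odd_part_unit x4; have [q1 q1A E1] := odd_part_unit x14.
  have [q2 q2A E2] := odd_part_unit x24; have [q3 q3A E3] := odd_part_unit x34.
  exists q0 => //; exists (q1 * q2 * q3); first by rewrite !rpredM.
  split=> //; rewrite (even_indexE _ _ _ _ i2 x4) -/v.
  have -> : v x * v ('i * x) * v (- x) * v (- ('i * x)) * (q0 * (q1 * q2 * q3))
    = (v x * q0) * (v ('i * x) * q1) * (v (- x) * q2) * (v (- ('i * x)) * q3) by ring.
  by rewrite -E0 -E1 -E2 -E3 !mulr1.
set A := even_index _ _ _ _ _ in main *.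
pose x : algC := 4.-root m%:~R; have x4 : x ^+ 4 = m%:~R by rewrite rootCK.
have [q qA [e eA [_ Aqe]]] := main x x4.
have A0 : A != 0.
  apply/eqP => A0; move: Aqe; rewrite A0 rmorph0 mul0r => /esym/eqP.
  by rewrite oner_eq0.
have [k Dk] : exists k : int, A^-1 = k%:~R.
  apply: ratr_Aint; rewrite fmorphV /=.
  have -> : (ratr A)^-1 = q * e.
    by apply: (mulfI (x := ratr A)); rewrite ?fmorph_eq0 // Aqe divff // fmorph_eq0.
  exact: rpredM.
exists k; first by rewrite -Dk divff.
(* From [v y * q' = 1] and [A * (q' * e') = 1] follows [v y = A * e'], which is integral once [A] is
   1 or -1. *)
move=> k1 y y4; have [q' q'A [e' e'A [vq Aqe']]] := main y y4.
have -> : v y = ratr A * e'.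
  have -> : v y = v y * (ratr A * (q' * e')) by rewrite Aqe' mulr1.
  have -> : v y * (ratr A * (q' * e')) = v y * q' * (ratr A * e') by ring.
  by rewrite vq mul1r.
have AE : A = k%:~R^-1 by rewrite -Dk invrK.
rewrite rpredM // AE; case: k1 => ->; first by rewrite invr1 rmorph1 rpred1.
by rewrite (_ : (-1)%:~R^-1 = -1) // rmorphN1 rpredN1.
Qed.

End EvenIndex.

(** * Reduction modulo [m] and homogeneity *)

Lemma odd_index_mod (m b1 b2 b3 b4 b5 b6 b7 : int) :
  exists q : int, odd_index m b1 b2 b3 b4 b5 b6 b7 = 16 * b1 ^+ 16 + m * q.
Proof.
(* With an indeterminate in place of [m], reduction modulo [m] becomes evaluation at 0. There [xi]
   reduces to [2 * (s - 1) ^+ 2 * b1 ^+ 4], and [s - 1] is a unit. *)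
pose P : {poly int} := odd_index 'X b1%:P b2%:P b3%:P b4%:P b5%:P b6%:P b7%:P.
have PE c : P.[c] = odd_index c b1 b2 b3 b4 b5 b6 b7.
  by rewrite -[P.[c]]/(horner_eval c P) odd_index_map /= /horner_eval hornerX !hornerC.
have P0 : P.[0] = 16 * b1 ^+ 16.
  rewrite PE /odd_index /xi_coord; move: (T1coord _ _ _ _ _ _ _ _) => [[[t0 t1] t2] t3].
  have : let: (s0, s1, _, _) := S0coord 0 b1 b2 b3 b4 b5 b6 b7 in
      s0 = - b1 ^+ 2 /\ s1 = b1 ^+ 2 by rewrite /=; split; ring.
  case: (S0coord _ _ _ _ _ _ _ _) => [[[s0 s1] s2] s3] [-> ->] /=.
  by rewrite !mul0r; ring.
rewrite -PE -P0; elim/poly_ind: P {PE P0} => [|p c _].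
  by exists 0; rewrite !horner0; ring.
by exists p.[m]; rewrite !hornerE; ring.
Qed.

Lemma even_index_mod (m b1 b3 b5 b7 : int) :
  exists q : int, even_index m b1 b3 b5 b7 = b1 ^+ 4 + m * q.
Proof.
exists (2 * b1 ^+ 2 * (b5 ^+ 2 - 2 * b3 * b7) + m * (b5 ^+ 2 - 2 * b3 * b7) ^+ 2
  - (2 * b1 * b5 - b3 ^+ 2 - m * b7 ^+ 2) ^+ 2).
by rewrite /even_index; ring.
Qed.

Section Scaling.

Variables (R : comNzRingType) (m : R).

Definition escale (k : R) (x : R * R * R * R) : R * R * R * R :=
  let: (x0, x1, x2, x3) := x in (k * x0, k * x1, k * x2, k * x3).

Lemma emul_scale k l x y : emul m (escale k x) (escale l y) = escale (k * l) (emul m x y).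
Proof.
case: x => [[[x0 x1] x2] x3]; case: y => [[[y0 y1] y2] y3] /=.
by congr (_, _, _, _); ring.
Qed.

Lemma emul_scaler l x y : emul m x (escale l y) = escale l (emul m x y).
Proof.
case: x => [[[x0 x1] x2] x3]; case: y => [[[y0 y1] y2] y3] /=.
by congr (_, _, _, _); ring.
Qed.

Lemma esub_scale k x y : esub (escale k x) (escale k y) = escale k (esub x y).
Proof.
case: x => [[[x0 x1] x2] x3]; case: y => [[[y0 y1] y2] y3] /=.
by congr (_, _, _, _); ring.
Qed.

Lemma odd_index_scale k a1 a2 a3 a4 a5 a6 a7 :
  odd_index m (k * a1) (k * a2) (k * a3) (k * a4) (k * a5) (k * a6) (k * a7)
  = k ^+ 16 * odd_index m a1 a2 a3 a4 a5 a6 a7.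
Proof.
have x1 : (k * a1, 0, k * a5, k * a5) = escale k (a1, 0, a5, a5).
  by rewrite /escale mulr0.
have x3 : (k * a3, 0, - (k * a7), k * a7) = escale k (a3, 0, - a7, a7).
  by rewrite /escale mulr0 mulrN.
have SE : S0coord m (k * a1) (k * a2) (k * a3) (k * a4) (k * a5) (k * a6) (k * a7)
    = escale (k * k) (S0coord m a1 a2 a3 a4 a5 a6 a7).
  rewrite /S0coord x1 x3 !emul_scale !emul_scaler -!esub_scale.
  by congr (esub _ _); rewrite /escale mulr0; congr (_, _, _, _); ring.
have TE : T1coord m (k * a1) (k * a2) (k * a3) (k * a4) (k * a5) (k * a6) (k * a7)
    = escale (k * k) (T1coord m a1 a2 a3 a4 a5 a6 a7).
  rewrite /T1coord x1 x3 !emul_scale !emul_scaler -!esub_scale.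
  by congr (esub _ _); rewrite /escale mulr0; congr (_, _, _, _); ring.
rewrite /odd_index /xi_coord SE TE !emul_scale !emul_scaler esub_scale.
by case: (esub _ _) => [[[y0 y1] y2] y3]; rewrite /enorm /escale; ring.
Qed.

End Scaling.

(** * The case [m = 1 mod 4], [m <> 1 mod 16] *)

Lemma generator_data (m l : int) (K : fieldExtType rat) : m = 1 + 4 * l ->
    irreducible_poly ('X^8 - (m%:~R)%:P : {poly rat}) -> is_pure_field 8 m K ->
    monogenic K ->
  exists a0 a1 a2 a3 a4 a5 a6 a7 : rat,
  let L := lin8 a0 a1 a2 a3 a4 a5 a6 a7 in
  [/\ forall z : algC, z ^+ 8 = m%:~R -> L z \in Aint,
      exists p, forall z : algC, z ^+ 8 = m%:~R -> (1 + z ^+ 4) / 2 = (polyZC p).[L z],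
      exists p, forall z : algC, z ^+ 8 = m%:~R -> z = (polyZC p).[L z]
    & forall i, m = 1 + 16 * i -> exists p, forall z : algC, z ^+ 8 = m%:~R ->
        (1 + z + z ^+ 2 + z ^+ 3 + z ^+ 4 + z ^+ 5 + z ^+ 6 + z ^+ 7) / 8
        = (polyZC p).[L z]].
Proof.
move=> m_def irr_m pureK monK.
have [A sA [A_int genA]] := monogenic_generator irr_m pureK monK.
exists A`_0, A`_1, A`_2, A`_3, A`_4, A`_5, A`_6, A`_7 => L.
have LE z : L z = evalC z A by rewrite evalC_lin8.
have rep (c0 c1 c2 c3 c4 c5 c6 c7 : rat) (f : algC -> algC) :
    (forall z, f z = lin8 c0 c1 c2 c3 c4 c5 c6 c7 z) ->
    (forall z, z ^+ 8 = m%:~R -> f z \in Aint) ->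
    exists p, forall z : algC, z ^+ 8 = m%:~R -> f z = (polyZC p).[L z].
  move=> fE fA; have [z z8|p pE] := genA (rpoly8 c0 c1 c2 c3 c4 c5 c6 c7).
    by rewrite evalC_rpoly8 -fE fA.
  by exists p => z z8; rewrite LE -pE // evalC_rpoly8 fE.
split=> [z z8|||i m_def'].
- by rewrite LE A_int.
- apply: (rep 2^-1 0 0 0 2^-1 0 0 0) => z; first by rewrite /lin8; field.
  move=> z8; have := @Aint_omega m l (z ^+ 2) m_def; rewrite -!exprM; apply.
  exact: z8.
- apply: (rep 0 1 0 0 0 0 0 0 id) => z; first by rewrite /lin8; ring.
  exact: Aint_root_pure.
apply: (rep 8^-1 8^-1 8^-1 8^-1 8^-1 8^-1 8^-1 8^-1) => z; first by rewrite /lin8; field.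
exact: (Aint_e3 m_def').
Qed.

Lemma not_monogenic_mod16 (m l : int) (K : fieldExtType rat) :
    squarefreez m -> m = 1 + 4 * l -> m <> 1 -> m <> -3 -> m <> 5 ->
    (forall i, m <> 1 + 16 * i) ->
    irreducible_poly ('X^8 - (m%:~R)%:P : {poly rat}) -> is_pure_field 8 m K ->
  ~ monogenic K.
Proof.
move=> sq_m m_def m1 mN3 m5 m16 irr_m pureK /(generator_data m_def irr_m pureK).
case=> a0 [a1 [a2 [a3 [a4 [a5 [a6 [a7 [LA [pw pwE] [pt ptE] _]]]]]]]].
have m_neq0 : m <> 0 by lia.
have m_odd : oddz m by rewrite m_def !oddz_simp.
have vA (x : algC) : x ^+ 4 = m%:~R -> lin4 a1 a3 a5 a7 x \in Aint.
  move=> x4; have xA : x \in Aint by apply: (Aint_root_pure _ x4).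
  have omA := Aint_omega m_def x4.
  have [j Dj] := oddzE l; case l_odd : (oddz l) Dj => Dj.
    have [_ [_ [_ [_ [v0 [v1 [v2 [v3 [_ [-> -> -> ->]]]]]]]]]] :=
      integral8_coords_odd sq_m m_def LA Dj.
    have -> : lin4 (v0%:~R + v1%:~R / 2) (v2%:~R + v3%:~R / 2) (v1%:~R / 2) (v3%:~R / 2) x
       = v0%:~R + v1%:~R * ((1 + x ^+ 2) / 2) + v2%:~R * x
         + v3%:~R * ((1 + x ^+ 2) / 2) * x by rewrite /lin4; field.
    move: (_ / 2) omA => om omA.
    by rewrite !(rpredD, rpredM) ?Aint_int.
  have {}Dj : l = 2 * j by rewrite Dj addr0.
  have [_ [_ [_ [_ [v0 [v1 [v2 [v3 [g [_ [-> -> -> ->] gE]]]]]]]]]] :=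
    integral8_coords_even sq_m m_def LA Dj.
  (* An even [j] would give [m = 1 mod 16]. *)
  have {}gE : g = false.
    apply: gE; have [i Di] := oddzE j; case: (oddz j) Di => // Di.
    by case: (m16 i); lia.
  have e2A : (1 + x + x ^+ 2 + x ^+ 3) / 4 \in Aint.
    by apply: (@Aint_e2 m j) => //; lia.
  rewrite gE /= mul0r !addr0.
  have -> : lin4 (v0%:~R + v1%:~R / 2 + v3%:~R / 4) (v2%:~R + v3%:~R / 4)
      (v1%:~R / 2 + v3%:~R / 4) (v3%:~R / 4) x
      = v0%:~R + v1%:~R * ((1 + x ^+ 2) / 2) + v2%:~R * x
         + v3%:~R * ((1 + x + x ^+ 2 + x ^+ 3) / 4) by rewrite /lin4; field.
  move: (_ / 2) (_ / 4) omA e2A => om e2 omA e2A.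
  by rewrite !(rpredD, rpredM) ?Aint_int.
have [k Ak _] := even_index_unit m_neq0 LA ptE.
have [A DA] : exists A : int, even_index m%:~R a1 a3 a5 a7 = A%:~R.
  have i2 := sqrCi algC.
  pose x : algC := 4.-root m%:~R; have x4 : x ^+ 4 = m%:~R by rewrite rootCK.
  have ix4 : ('i * x) ^+ 4 = m%:~R by rewrite exprMn x4 (exprM _ 2 2) i2 sqrrN expr1n mul1r.
  have N4 y : y ^+ 4 = m%:~R -> (- y) ^+ 4 = m%:~R :> algC.
    by move=> y4; rewrite exprNn -signr_odd mul1r.
  apply: ratr_Aint; rewrite (even_indexE _ _ _ _ i2 x4).
  exact: rpredM (rpredM (rpredM (vA _ x4) (vA _ ix4)) (vA _ (N4 _ x4))) (vA _ (N4 _ ix4)).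
have A1 : A ^+ 4 = 1.
  have : A * k = 1 by apply: (@intr_inj rat); rewrite rmorphM /= -DA Ak.
  move/(congr1 absz)/eqP; rewrite abszM muln_eq1 => /andP[/eqP A1 _].
  by have [->|->] : A = 1 \/ A = -1 by lia.
have C1 := odd_index_pm1 sq_m m_neq0 m_odd LA pwE ptE.
have [b bE] := integral8_coef sq_m m_neq0 LA.
move: (bE 1%N isT) (bE 2%N isT) (bE 3%N isT) (bE 4%N isT) (bE 5%N isT) (bE 6%N isT)
    (bE 7%N isT) => /= E1 E2 E3 E4 E5 E6 E7.
(* The common denominator 8 gets a name so that its powers stay symbolic. *)
have [N N_def] : exists N : int, N = 8 by exists 8.
have scale (a : rat) (c : int) : a = c%:~R / 8 -> c%:~R = N%:~R * a.
  by move=> ->; rewrite N_def; field.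
move/scale in E1; move/scale in E2; move/scale in E3; move/scale in E4.
move/scale in E5; move/scale in E6; move/scale in E7.
have [C [DC C_pm]] : exists C : int, odd_index m (b 1%N) (b 2%N) (b 3%N) (b 4%N) (b 5%N)
   (b 6%N) (b 7%N) = N ^+ 16 * C /\ (C = 1 \/ C = -1).
  have E : (odd_index m (b 1%N) (b 2%N) (b 3%N) (b 4%N) (b 5%N) (b 6%N) (b 7%N))%:~R
    = N%:~R ^+ 16 * odd_index m%:~R a1 a2 a3 a4 a5 a6 a7.
    by rewrite odd_index_map /= E1 E2 E3 E4 E5 E6 E7 odd_index_scale.
  case: C1 => C1; rewrite C1 in E; [exists 1 | exists (-1)]; split; [|by left| |by right].
    by apply: (@intr_inj rat); rewrite E rmorphM rmorphXn.
  by apply: (@intr_inj rat); rewrite E rmorphM rmorphXn.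
have DA4 : even_index m (b 1%N) (b 3%N) (b 5%N) (b 7%N) = N ^+ 4 * A.
  apply: (@intr_inj rat); rewrite rmorphM /= -DA rmorphXn /=.
  have -> : (even_index m (b 1%N) (b 3%N) (b 5%N) (b 7%N))%:~R
    = even_index m%:~R (b 1%N)%:~R (b 3%N)%:~R (b 5%N)%:~R (b 7%N)%:~R :> rat.
    by rewrite /even_index; ring.
  by rewrite E1 E3 E5 E7 /even_index; ring.
have [q1 Q1] := even_index_mod m (b 1%N) (b 3%N) (b 5%N) (b 7%N).
have [q2 Q2] := odd_index_mod m (b 1%N) (b 2%N) (b 3%N) (b 4%N) (b 5%N) (b 6%N) (b 7%N).
rewrite {}DA4 in Q1; rewrite {}DC in Q2.
(* Modulo [m], [b_1 ^+ 4 = N ^+ 4 * A], so [N ^+ 16 * C = 16 * b_1 ^+ 16 = 16 * N ^+ 16 * A ^+ 4],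
   and [A ^+ 4 = 1]. The quotient below is the binomial expansion of
   [(N ^+ 4 * A - m * q1) ^+ 4]. *)
have : (m %| N ^+ 16 * (C - 16))%Z.
  have B4 : b 1%N ^+ 4 = N ^+ 4 * A - m * q1 by rewrite Q1 addrK.
  have B16 : b 1%N ^+ 16 = (N ^+ 4 * A - m * q1) ^+ 4 by rewrite -B4 -exprM.
  have -> : N ^+ 16 * (C - 16) = (N ^+ 16 * C) - 16 * (N ^+ 16 * A ^+ 4) by rewrite A1; ring.
  rewrite Q2 B16; set X := N ^+ 4.
  have -> : N ^+ 16 = X ^+ 4 :> int by rewrite /X -exprM.
  apply/dvdzP; exists (q2 + 16 * (- 4 * (X * A) ^+ 3 * q1 + 6 * (X * A) ^+ 2 * m * q1 ^+ 2
     - 4 * (X * A) * m ^+ 2 * q1 ^+ 3 + m ^+ 3 * q1 ^+ 4)).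
  by move: X => X; ring.
rewrite Gauss_dvdzr; last first.
  rewrite coprimezE abszX coprimeXr // N_def -[`|8|%N]/(2 ^ 3)%N coprimeXr //.
  by rewrite coprime_sym coprime2n.
have dv (n : nat) : (m %| n%:Z)%Z -> (0 < n)%N -> `|m|%N \in divisors n.
  by rewrite dvdzE /= => mn n0; rewrite -dvdn_divisors.
case: C_pm => ->.
  (* The divisors of 15 that are 1 modulo 4 are 1, -3, 5 and -15, and the last is 1 modulo 16; those
     of 17 are 1 and 17, again 1 modulo 16. *)
  have -> : 1 - 16 = - 15%:Z by [].
  rewrite rpredN => /dv/(_ isT).
  rewrite -[divisors 15]/[:: 1; 3; 5; 15]%N !inE => H.
  by have := m16 (-1); move: H m_def m1 mN3 m5; clear; lia.
have -> : -1 - 16 = - 17%:Z by [].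
rewrite rpredN => /dv/(_ isT).
rewrite -[divisors 17]/[:: 1; 17]%N !inE => H.
by have := m16 1; move: H m_def m1 mN3 m5; clear; lia.
Qed.

(** * The case [m = 1 mod 16] *)

Lemma oddz_addM2 (a b : int) : oddz (a + 2 * b) = oddz a.
Proof. by rewrite oddzD oddzM addbF. Qed.

(** The arguments are the coordinates of [integral8_coords_even] with [g] equal to 1, and the
    polynomials in the proof are the expansion of [xi] at them. The parities depend only on
    [u1 + v1], [v0 + v2] and [i]. *)
Lemma xi_coord_integral (i u1 u2 u3 v0 v1 v2 v3 : int) :
  exists b0 b1 p q : int,
  [/\ xi_coord ((1 + 16 * i)%:~R : rat)
    (v0%:~R + v1%:~R / 2 + v3%:~R / 4 + 1 / 8) (u2%:~R + u3%:~R / 4 + 1 / 8)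
    (v2%:~R + v3%:~R / 4 + 1 / 8) (u1%:~R / 2 + u3%:~R / 4 + 1 / 8)
    (v1%:~R / 2 + v3%:~R / 4 + 1 / 8) (u3%:~R / 4 + 1 / 8) (v3%:~R / 4 + 1 / 8)
       = (b0%:~R, b1%:~R / 2, p%:~R, q%:~R / 2),
      oddz b1 = (oddz u1 (+) oddz v1) && (oddz v0 (+) oddz v2),
      oddz q = (oddz u1 (+) oddz v1) && (oddz v0 (+) oddz v2)
    & oddz (b0 + p) = (oddz u1 (+) oddz v1) && (oddz i (+) oddz v0 (+) oddz v2)].
Proof.
(* Here [s] is [b0 + p]; the odd coefficients of [s], [b1] and [q] are set apart. *)
pose p : int := - 2 * v3 * i ^+ 2 - 14 * v3 ^+ 2 * i ^+ 2 - 24 * v3 ^+ 3 * i ^+ 2 - 12 * v3 ^+ 4 * i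
    ^+ 2 - 4 * v2 * i ^+ 2 - 24 * v2 * v3 * i ^+ 2 - 48 * v2 * v3 ^+ 2 * i ^+ 2 - 32 * v2
    * v3 ^+ 3 * i ^+ 2 + v2 ^+ 2 * i - v2 ^+ 2 * v3 - 12 * v2 ^+ 2 * v3 * i - v2 ^+ 2 * v3
    ^+ 2 - 12 * v2 ^+ 2 * v3 ^+ 2 * i - v2 ^+ 3 - 16 * v2 ^+ 3 * i - 2 * v2 ^+ 3 * v3 - 32
    * v2 ^+ 3 * v3 * i - 2 * v1 * i ^+ 2 + 2 * v1 * v3 * i - 12 * v1 * v3 * i ^+ 2 + 6 *
    v1 * v3 ^+ 2 * i - 24 * v1 * v3 ^+ 2 * i ^+ 2 + 4 * v1 * v3 ^+ 3 * i - 16 * v1 * v3 ^+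
    3 * i ^+ 2 + 2 * v1 * v2 * i + 2 * v1 * v2 * v3 + 40 * v1 * v2 * v3 * i + 2 * v1 * v2
    * v3 ^+ 2 + 40 * v1 * v2 * v3 ^+ 2 * i + v1 * v2 ^+ 2 + 24 * v1 * v2 ^+ 2 * i + 2 * v1
    * v2 ^+ 2 * v3 + 48 * v1 * v2 ^+ 2 * v3 * i + 2 * v1 ^+ 2 * i - 4 * v1 ^+ 2 * i ^+ 2 -
    v1 ^+ 2 * v3 - 4 * v1 ^+ 2 * v3 * i - 16 * v1 ^+ 2 * v3 * i ^+ 2 - v1 ^+ 2 * v3 ^+ 2 -
    4 * v1 ^+ 2 * v3 ^+ 2 * i - 16 * v1 ^+ 2 * v3 ^+ 2 * i ^+ 2 + v1 ^+ 2 * v2 + 20 * v1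
    ^+ 2 * v2 * i + 2 * v1 ^+ 2 * v2 * v3 + 40 * v1 ^+ 2 * v2 * v3 * i + 2 * v1 ^+ 2 * v2
    ^+ 2 + 48 * v1 ^+ 2 * v2 ^+ 2 * i - v1 ^+ 3 - 8 * v1 ^+ 3 * i - 2 * v1 ^+ 3 * v3 - 16
    * v1 ^+ 3 * v3 * i - v1 ^+ 4 - 8 * v1 ^+ 4 * i + 4 * v0 * v3 * i + 12 * v0 * v3 ^+ 2 *
    i + 8 * v0 * v3 ^+ 3 * i + 4 * v0 * v2 * i + 16 * v0 * v2 * v3 * i + 16 * v0 * v2 * v3
    ^+ 2 * i - v0 * v2 ^+ 2 - 2 * v0 * v2 ^+ 2 * v3 + 6 * v0 * v1 * i - 2 * v0 * v1 * v3 +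
    8 * v0 * v1 * v3 * i - 2 * v0 * v1 * v3 ^+ 2 + 8 * v0 * v1 * v3 ^+ 2 * i + 16 * v0 *
    v1 * v2 * i + 32 * v0 * v1 * v2 * v3 * i - 4 * v0 * v1 * v2 ^+ 2 - 3 * v0 * v1 ^+ 2 -
    12 * v0 * v1 ^+ 2 * i - 6 * v0 * v1 ^+ 2 * v3 - 24 * v0 * v1 ^+ 2 * v3 * i - 4 * v0 *
    v1 ^+ 3 - 16 * v0 * v1 ^+ 3 * i + 3 * v0 ^+ 2 * i - v0 ^+ 2 * v3 + 12 * v0 ^+ 2 * v3 *
    i - v0 ^+ 2 * v3 ^+ 2 + 12 * v0 ^+ 2 * v3 ^+ 2 * i - v0 ^+ 2 * v2 - 2 * v0 ^+ 2 * v2 *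
    v3 - 4 * v0 ^+ 2 * v2 ^+ 2 - 3 * v0 ^+ 2 * v1 - 6 * v0 ^+ 2 * v1 * v3 - 6 * v0 ^+ 2 *
    v1 ^+ 2 - v0 ^+ 3 - 2 * v0 ^+ 3 * v3 - 4 * v0 ^+ 3 * v1 + 2 * u3 * i ^+ 2 + 16 * u3 *
    v3 * i ^+ 2 + 16 * u3 * v3 ^+ 2 * i ^+ 2 + u3 * v2 ^+ 2 + 16 * u3 * v2 ^+ 2 * i - 2 *
    u3 * v1 * i - 4 * u3 * v1 * v3 * i - 2 * u3 * v1 * v2 - 32 * u3 * v1 * v2 * i + u3 *
    v1 ^+ 2 + 12 * u3 * v1 ^+ 2 * i - 4 * u3 * v0 * i - 8 * u3 * v0 * v3 * i + 2 * u3 * v0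
    * v1 + 16 * u3 * v0 * v1 * i + u3 * v0 ^+ 2 - 2 * u3 ^+ 2 * i ^+ 2 + 16 * u3 ^+ 2 * v3
    * i ^+ 2 + 16 * u3 ^+ 2 * v3 ^+ 2 * i ^+ 2 + u3 ^+ 2 * v2 ^+ 2 + 16 * u3 ^+ 2 * v2 ^+
    2 * i - 2 * u3 ^+ 2 * v1 * i - 4 * u3 ^+ 2 * v1 * v3 * i - 2 * u3 ^+ 2 * v1 * v2 - 32
    * u3 ^+ 2 * v1 * v2 * i + u3 ^+ 2 * v1 ^+ 2 + 12 * u3 ^+ 2 * v1 ^+ 2 * i - 4 * u3 ^+ 2
    * v0 * i - 8 * u3 ^+ 2 * v0 * v3 * i + 2 * u3 ^+ 2 * v0 * v1 + 16 * u3 ^+ 2 * v0 * v1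
    * i + u3 ^+ 2 * v0 ^+ 2 - 8 * u3 ^+ 3 * i ^+ 2 - 4 * u3 ^+ 4 * i ^+ 2 - 2 * u2 * v3 *
    i - 2 * u2 * v3 ^+ 2 * i - 4 * u2 * v1 * i - 8 * u2 * v1 * v3 * i - 2 * u2 * v1 * v2 -
    32 * u2 * v1 * v2 * i + u2 * v1 ^+ 2 + 8 * u2 * v1 ^+ 2 * i - 8 * u2 * v0 * i - 16 *
    u2 * v0 * v3 * i + 2 * u2 * v0 * v1 + 2 * u2 * v0 ^+ 2 + 2 * u2 * u3 * i - 4 * u2 * u3
    * v3 * i - 4 * u2 * u3 * v3 ^+ 2 * i - 8 * u2 * u3 * v1 * i - 16 * u2 * u3 * v1 * v3 *
    i - 4 * u2 * u3 * v1 * v2 - 64 * u2 * u3 * v1 * v2 * i + 2 * u2 * u3 * v1 ^+ 2 + 16 *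
    u2 * u3 * v1 ^+ 2 * i - 16 * u2 * u3 * v0 * i - 32 * u2 * u3 * v0 * v3 * i + 4 * u2 *
    u3 * v0 * v1 + 4 * u2 * u3 * v0 ^+ 2 + 6 * u2 * u3 ^+ 2 * i + 4 * u2 * u3 ^+ 3 * i + 6
    * u2 ^+ 2 * i + 24 * u2 ^+ 2 * u3 * i + 24 * u2 ^+ 2 * u3 ^+ 2 * i - 2 * u2 ^+ 3 - 4 *
    u2 ^+ 3 * u3 - 4 * u2 ^+ 4 + 4 * u1 * i ^+ 2 + 16 * u1 * v3 * i ^+ 2 + 16 * u1 * v3 ^+
    2 * i ^+ 2 + u1 * v2 ^+ 2 + 16 * u1 * v2 ^+ 2 * i - 2 * u1 * v1 * i - 4 * u1 * v1 * v3
    * i - 2 * u1 * v1 * v2 - 32 * u1 * v1 * v2 * i + u1 * v1 ^+ 2 + 12 * u1 * v1 ^+ 2 * i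
    - 4 * u1 * v0 * i - 8 * u1 * v0 * v3 * i + 2 * u1 * v0 * v1 + 16 * u1 * v0 * v1 * i +
    u1 * v0 ^+ 2 + 8 * u1 * u3 * i ^+ 2 + 32 * u1 * u3 * v3 * i ^+ 2 + 32 * u1 * u3 * v3
    ^+ 2 * i ^+ 2 + 2 * u1 * u3 * v2 ^+ 2 + 32 * u1 * u3 * v2 ^+ 2 * i - 4 * u1 * u3 * v1
    * i - 8 * u1 * u3 * v1 * v3 * i - 4 * u1 * u3 * v1 * v2 - 64 * u1 * u3 * v1 * v2 * i +
    2 * u1 * u3 * v1 ^+ 2 + 24 * u1 * u3 * v1 ^+ 2 * i - 8 * u1 * u3 * v0 * i - 16 * u1 *
    u3 * v0 * v3 * i + 4 * u1 * u3 * v0 * v1 + 32 * u1 * u3 * v0 * v1 * i + 2 * u1 * u3 *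
    v0 ^+ 2 - 2 * u1 * u2 * i + 2 * u1 * u2 * v3 + 24 * u1 * u2 * v3 * i + 2 * u1 * u2 *
    v3 ^+ 2 + 24 * u1 * u2 * v3 ^+ 2 * i + 2 * u1 * u2 * v2 + 32 * u1 * u2 * v2 * i + 4 *
    u1 * u2 * v2 * v3 + 64 * u1 * u2 * v2 * v3 * i + 2 * u1 * u2 * v1 + 16 * u1 * u2 * v1
    * i + 4 * u1 * u2 * v1 * v3 + 32 * u1 * u2 * v1 * v3 * i + 4 * u1 * u2 * v1 ^+ 2 + 32
    * u1 * u2 * v1 ^+ 2 * i + 2 * u1 * u2 * v0 + 4 * u1 * u2 * v0 * v3 + 8 * u1 * u2 * v0
    * v1 + 8 * u1 * u2 * v0 ^+ 2 - 2 * u1 * u2 * u3 - 32 * u1 * u2 * u3 * i - 2 * u1 * u2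
    * u3 ^+ 2 - 32 * u1 * u2 * u3 ^+ 2 * i - u1 ^+ 2 * v3 - 16 * u1 ^+ 2 * v3 * i - u1 ^+
    2 * v3 ^+ 2 - 16 * u1 ^+ 2 * v3 ^+ 2 * i - u1 ^+ 2 * v2 - 16 * u1 ^+ 2 * v2 * i - 2 *
    u1 ^+ 2 * v2 * v3 - 32 * u1 ^+ 2 * v2 * v3 * i - u1 ^+ 2 * v1 - 16 * u1 ^+ 2 * v1 * i
    - 2 * u1 ^+ 2 * v1 * v3 - 32 * u1 ^+ 2 * v1 * v3 * i - 4 * u1 ^+ 2 * v1 * v2 - 64 * u1
    ^+ 2 * v1 * v2 * i - u1 ^+ 2 * v0 - 16 * u1 ^+ 2 * v0 * i - 2 * u1 ^+ 2 * v0 * v3 - 32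
    * u1 ^+ 2 * v0 * v3 * i + u1 ^+ 2 * u3 + 16 * u1 ^+ 2 * u3 * i + u1 ^+ 2 * u3 ^+ 2 +
    16 * u1 ^+ 2 * u3 ^+ 2 * i - u1 ^+ 2 * u2 - 16 * u1 ^+ 2 * u2 * i - 2 * u1 ^+ 2 * u2 *
    u3 - 32 * u1 ^+ 2 * u2 * u3 * i + u1 ^+ 3 + 16 * u1 ^+ 3 * i + 2 * u1 ^+ 3 * u3 + 32 *
    u1 ^+ 3 * u3 * i + u1 ^+ 4 + 16 * u1 ^+ 4 * i.
pose s : int := (v1 * v1 * i + v1 * v1 * v3 + v1 * v1 * v3 * v3 + v1 * v1 * v2 + v1 * v1 * v1 + v1 * v1
    * v1 * v1 + v0 * v1 * v1 + u3 * v1 * v1 + u3 * u3 * v1 * v1 + u1 * v1 * v1 + u1 * u1 *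
    i + u1 * u1 * v3 + u1 * u1 * v3 * v3 + u1 * u1 * v2 + u1 * u1 * v1 + u1 * u1 * v0 + u1
    * u1 * u3 + u1 * u1 * u3 * u3 + u1 * u1 * u1 + u1 * u1 * u1 * u1)
  + 2 * (- 3 * i ^+ 3 - v3 * i ^+ 2 - 24 * v3 * i ^+ 3 - 7 * v3 ^+ 2 * i ^+ 2 - 72 * v3 ^+ 2 *
    i ^+ 3 - 12 * v3 ^+ 3 * i ^+ 2 - 96 * v3 ^+ 3 * i ^+ 3 - 6 * v3 ^+ 4 * i ^+ 2 - 48 *
    v3 ^+ 4 * i ^+ 3 - 2 * v2 * i ^+ 2 + v2 * v3 * i + 4 * v2 * v3 * i ^+ 2 + 3 * v2 * v3
    ^+ 2 * i + 24 * v2 * v3 ^+ 2 * i ^+ 2 + 2 * v2 * v3 ^+ 3 * i + 16 * v2 * v3 ^+ 3 * i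
    ^+ 2 + 2 * v2 ^+ 2 * i + 24 * v2 ^+ 2 * i ^+ 2 - v2 ^+ 2 * v3 - 8 * v2 ^+ 2 * v3 * i +
    96 * v2 ^+ 2 * v3 * i ^+ 2 - v2 ^+ 2 * v3 ^+ 2 - 8 * v2 ^+ 2 * v3 ^+ 2 * i + 96 * v2
    ^+ 2 * v3 ^+ 2 * i ^+ 2 - 2 * v2 ^+ 3 - 32 * v2 ^+ 3 * i - 4 * v2 ^+ 3 * v3 - 64 * v2
    ^+ 3 * v3 * i - 3 * v2 ^+ 4 - 48 * v2 ^+ 4 * i + 2 * v1 * i ^+ 2 + v1 * v3 * i + 12 *
    v1 * v3 * i ^+ 2 + 3 * v1 * v3 ^+ 2 * i + 24 * v1 * v3 ^+ 2 * i ^+ 2 + 2 * v1 * v3 ^+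
    3 * i + 16 * v1 * v3 ^+ 3 * i ^+ 2 + v1 * v2 * i + v1 * v2 * v3 + 16 * v1 * v2 * v3 *
    i - 64 * v1 * v2 * v3 * i ^+ 2 + v1 * v2 * v3 ^+ 2 + 16 * v1 * v2 * v3 ^+ 2 * i - 64 *
    v1 * v2 * v3 ^+ 2 * i ^+ 2 + v1 * v2 ^+ 2 + 20 * v1 * v2 ^+ 2 * i + 2 * v1 * v2 ^+ 2 *
    v3 + 40 * v1 * v2 ^+ 2 * v3 * i + 8 * v1 ^+ 2 * i ^+ 2 - v1 ^+ 2 * v3 - 2 * v1 ^+ 2 *
    v3 * i + 64 * v1 ^+ 2 * v3 * i ^+ 2 - v1 ^+ 2 * v3 ^+ 2 - 2 * v1 ^+ 2 * v3 ^+ 2 * i +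
    64 * v1 ^+ 2 * v3 ^+ 2 * i ^+ 2 + 8 * v1 ^+ 2 * v2 * i - 32 * v1 ^+ 2 * v2 * i ^+ 2 +
    v1 ^+ 2 * v2 * v3 + 16 * v1 ^+ 2 * v2 * v3 * i - 64 * v1 ^+ 2 * v2 * v3 * i ^+ 2 + 2 *
    v1 ^+ 2 * v2 ^+ 2 + 40 * v1 ^+ 2 * v2 ^+ 2 * i - v1 ^+ 3 - 4 * v1 ^+ 3 * i + 48 * v1
    ^+ 3 * i ^+ 2 - v1 ^+ 3 * v3 - 8 * v1 ^+ 3 * v3 * i + 96 * v1 ^+ 3 * v3 * i ^+ 2 - v1
    ^+ 4 - 4 * v1 ^+ 4 * i + 48 * v1 ^+ 4 * i ^+ 2 + 6 * v0 * i ^+ 2 + v0 * v3 * i + 20 *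
    v0 * v3 * i ^+ 2 + 3 * v0 * v3 ^+ 2 * i + 24 * v0 * v3 ^+ 2 * i ^+ 2 + 2 * v0 * v3 ^+
    3 * i + 16 * v0 * v3 ^+ 3 * i ^+ 2 + 2 * v0 * v2 * i + 8 * v0 * v2 * v3 * i + 8 * v0 *
    v2 * v3 ^+ 2 * i + 8 * v0 * v2 ^+ 2 * i + 16 * v0 * v2 ^+ 2 * v3 * i - v0 * v1 * i + 8
    * v0 * v1 * i ^+ 2 - v0 * v1 * v3 - 12 * v0 * v1 * v3 * i + 32 * v0 * v1 * v3 * i ^+ 2
    - v0 * v1 * v3 ^+ 2 - 12 * v0 * v1 * v3 ^+ 2 * i + 32 * v0 * v1 * v3 ^+ 2 * i ^+ 2 + 8
    * v0 * v1 * v2 * i + 16 * v0 * v1 * v2 * v3 * i + 32 * v0 * v1 * v2 ^+ 2 * i - 2 * v0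
    * v1 ^+ 2 - 24 * v0 * v1 ^+ 2 * i - 3 * v0 * v1 ^+ 2 * v3 - 48 * v0 * v1 ^+ 2 * v3 * i
    - 2 * v0 * v1 ^+ 3 - 32 * v0 * v1 ^+ 3 * i - 3 * v0 ^+ 2 * i - 4 * v0 ^+ 2 * v3 * i -
    4 * v0 ^+ 2 * v3 ^+ 2 * i - v0 ^+ 2 * v2 - 8 * v0 ^+ 2 * v2 * i - 2 * v0 ^+ 2 * v2 *
    v3 - 16 * v0 ^+ 2 * v2 * v3 * i - 2 * v0 ^+ 2 * v2 ^+ 2 - 12 * v0 ^+ 2 * v1 * i - 24 *
    v0 ^+ 2 * v1 * v3 * i - 24 * v0 ^+ 2 * v1 ^+ 2 * i + v0 ^+ 3 + 2 * v0 ^+ 3 * v3 + 4 *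
    v0 ^+ 3 * v1 + 3 * v0 ^+ 4 + u3 * i ^+ 2 + 8 * u3 * v3 * i ^+ 2 + 8 * u3 * v3 ^+ 2 * i
    ^+ 2 - u3 * v2 * i - 16 * u3 * v2 * i ^+ 2 - 2 * u3 * v2 * v3 * i - 32 * u3 * v2 * v3
    * i ^+ 2 + u3 * v2 ^+ 2 + 16 * u3 * v2 ^+ 2 * i - u3 * v1 * i - 2 * u3 * v1 * v3 * i -
    u3 * v1 * v2 - 12 * u3 * v1 * v2 * i + 64 * u3 * v1 * v2 * i ^+ 2 + 4 * u3 * v1 ^+ 2 *
    i - 32 * u3 * v1 ^+ 2 * i ^+ 2 - u3 * v0 * i + 16 * u3 * v0 * i ^+ 2 - 2 * u3 * v0 *
    v3 * i + 32 * u3 * v0 * v3 * i ^+ 2 + u3 * v0 * v1 + 8 * u3 * v0 * v1 * i - 8 * u3 *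
    v0 ^+ 2 * i - u3 ^+ 2 * i ^+ 2 + 8 * u3 ^+ 2 * v3 * i ^+ 2 + 8 * u3 ^+ 2 * v3 ^+ 2 * i
    ^+ 2 - u3 ^+ 2 * v2 * i - 16 * u3 ^+ 2 * v2 * i ^+ 2 - 2 * u3 ^+ 2 * v2 * v3 * i - 32
    * u3 ^+ 2 * v2 * v3 * i ^+ 2 + u3 ^+ 2 * v2 ^+ 2 + 16 * u3 ^+ 2 * v2 ^+ 2 * i - u3 ^+
    2 * v1 * i - 2 * u3 ^+ 2 * v1 * v3 * i - u3 ^+ 2 * v1 * v2 - 12 * u3 ^+ 2 * v1 * v2 *
    i + 64 * u3 ^+ 2 * v1 * v2 * i ^+ 2 + 4 * u3 ^+ 2 * v1 ^+ 2 * i - 32 * u3 ^+ 2 * v1 ^+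
    2 * i ^+ 2 - u3 ^+ 2 * v0 * i + 16 * u3 ^+ 2 * v0 * i ^+ 2 - 2 * u3 ^+ 2 * v0 * v3 * i
    + 32 * u3 ^+ 2 * v0 * v3 * i ^+ 2 + u3 ^+ 2 * v0 * v1 + 8 * u3 ^+ 2 * v0 * v1 * i - 8
    * u3 ^+ 2 * v0 ^+ 2 * i - 4 * u3 ^+ 3 * i ^+ 2 - 2 * u3 ^+ 4 * i ^+ 2 + 16 * u2 * v3 *
    i ^+ 2 + 16 * u2 * v3 ^+ 2 * i ^+ 2 + u2 * v2 ^+ 2 + 16 * u2 * v2 ^+ 2 * i - 2 * u2 *
    v1 * i - 4 * u2 * v1 * v3 * i - 2 * u2 * v1 * v2 - 32 * u2 * v1 * v2 * i + u2 * v1 ^+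
    2 + 12 * u2 * v1 ^+ 2 * i - 4 * u2 * v0 * i - 8 * u2 * v0 * v3 * i + 2 * u2 * v0 * v1
    + 16 * u2 * v0 * v1 * i + u2 * v0 ^+ 2 - 16 * u2 * u3 * i ^+ 2 + 32 * u2 * u3 * v3 * i
    ^+ 2 + 32 * u2 * u3 * v3 ^+ 2 * i ^+ 2 + 2 * u2 * u3 * v2 ^+ 2 + 32 * u2 * u3 * v2 ^+
    2 * i - 4 * u2 * u3 * v1 * i - 8 * u2 * u3 * v1 * v3 * i - 4 * u2 * u3 * v1 * v2 - 64
    * u2 * u3 * v1 * v2 * i + 2 * u2 * u3 * v1 ^+ 2 + 24 * u2 * u3 * v1 ^+ 2 * i - 8 * u2
    * u3 * v0 * i - 16 * u2 * u3 * v0 * v3 * i + 4 * u2 * u3 * v0 * v1 + 32 * u2 * u3 * v0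
    * v1 * i + 2 * u2 * u3 * v0 ^+ 2 - 48 * u2 * u3 ^+ 2 * i ^+ 2 - 32 * u2 * u3 ^+ 3 * i
    ^+ 2 + 3 * u2 ^+ 2 * i - u2 ^+ 2 * v3 - 16 * u2 ^+ 2 * v3 * i - u2 ^+ 2 * v3 ^+ 2 - 16
    * u2 ^+ 2 * v3 ^+ 2 * i - u2 ^+ 2 * v2 - 16 * u2 ^+ 2 * v2 * i - 2 * u2 ^+ 2 * v2 * v3
    - 32 * u2 ^+ 2 * v2 * v3 * i - u2 ^+ 2 * v1 - 16 * u2 ^+ 2 * v1 * i - 2 * u2 ^+ 2 * v1
    * v3 - 32 * u2 ^+ 2 * v1 * v3 * i - 4 * u2 ^+ 2 * v1 * v2 - 64 * u2 ^+ 2 * v1 * v2 * i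
    - u2 ^+ 2 * v0 - 16 * u2 ^+ 2 * v0 * i - 2 * u2 ^+ 2 * v0 * v3 - 32 * u2 ^+ 2 * v0 *
    v3 * i + u2 ^+ 2 * u3 + 28 * u2 ^+ 2 * u3 * i + u2 ^+ 2 * u3 ^+ 2 + 28 * u2 ^+ 2 * u3
    ^+ 2 * i + 16 * u2 ^+ 3 * i + 32 * u2 ^+ 3 * u3 * i - 2 * u2 ^+ 4 + 2 * u1 * i ^+ 2 -
    u1 * v3 * i - 8 * u1 * v3 * i ^+ 2 - u1 * v3 ^+ 2 * i - 8 * u1 * v3 ^+ 2 * i ^+ 2 - 2
    * u1 * v2 * i - 32 * u1 * v2 * i ^+ 2 - 4 * u1 * v2 * v3 * i - 64 * u1 * v2 * v3 * i
    ^+ 2 + u1 * v2 ^+ 2 + 16 * u1 * v2 ^+ 2 * i - 2 * u1 * v1 * i - 16 * u1 * v1 * i ^+ 2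
    - 4 * u1 * v1 * v3 * i - 32 * u1 * v1 * v3 * i ^+ 2 - u1 * v1 * v2 - 16 * u1 * v1 * v2
    * i + 4 * u1 * v1 ^+ 2 * i - 32 * u1 * v1 ^+ 2 * i ^+ 2 - 2 * u1 * v0 * i - 4 * u1 *
    v0 * v3 * i + u1 * v0 * v1 + 8 * u1 * v0 * v1 * i - 8 * u1 * v0 ^+ 2 * i + u1 * u3 * i
    + 20 * u1 * u3 * i ^+ 2 - 2 * u1 * u3 * v3 * i - 16 * u1 * u3 * v3 * i ^+ 2 - 2 * u1 *
    u3 * v3 ^+ 2 * i - 16 * u1 * u3 * v3 ^+ 2 * i ^+ 2 - 4 * u1 * u3 * v2 * i - 64 * u1 *
    u3 * v2 * i ^+ 2 - 8 * u1 * u3 * v2 * v3 * i - 128 * u1 * u3 * v2 * v3 * i ^+ 2 + 2 *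
    u1 * u3 * v2 ^+ 2 + 32 * u1 * u3 * v2 ^+ 2 * i - 4 * u1 * u3 * v1 * i - 32 * u1 * u3 *
    v1 * i ^+ 2 - 8 * u1 * u3 * v1 * v3 * i - 64 * u1 * u3 * v1 * v3 * i ^+ 2 - 2 * u1 *
    u3 * v1 * v2 - 32 * u1 * u3 * v1 * v2 * i + u1 * u3 * v1 ^+ 2 + 8 * u1 * u3 * v1 ^+ 2
    * i - 64 * u1 * u3 * v1 ^+ 2 * i ^+ 2 - 4 * u1 * u3 * v0 * i - 8 * u1 * u3 * v0 * v3 *
    i + 2 * u1 * u3 * v0 * v1 + 16 * u1 * u3 * v0 * v1 * i - 16 * u1 * u3 * v0 ^+ 2 * i +
    3 * u1 * u3 ^+ 2 * i + 48 * u1 * u3 ^+ 2 * i ^+ 2 + 2 * u1 * u3 ^+ 3 * i + 32 * u1 *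
    u3 ^+ 3 * i ^+ 2 + 16 * u1 * u2 * i ^+ 2 + 2 * u1 * u2 * v3 + 32 * u1 * u2 * v3 * i +
    64 * u1 * u2 * v3 * i ^+ 2 + 2 * u1 * u2 * v3 ^+ 2 + 32 * u1 * u2 * v3 ^+ 2 * i + 64 *
    u1 * u2 * v3 ^+ 2 * i ^+ 2 + 2 * u1 * u2 * v2 + 32 * u1 * u2 * v2 * i + 4 * u1 * u2 *
    v2 * v3 + 64 * u1 * u2 * v2 * v3 * i + 4 * u1 * u2 * v2 ^+ 2 + 64 * u1 * u2 * v2 ^+ 2
    * i + 2 * u1 * u2 * v1 + 24 * u1 * u2 * v1 * i + 4 * u1 * u2 * v1 * v3 + 48 * u1 * u2
    * v1 * v3 * i + 4 * u1 * u2 * v1 ^+ 2 + 48 * u1 * u2 * v1 ^+ 2 * i + 2 * u1 * u2 * v0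
    + 16 * u1 * u2 * v0 * i + 4 * u1 * u2 * v0 * v3 + 32 * u1 * u2 * v0 * v3 * i + 8 * u1
    * u2 * v0 * v1 + 64 * u1 * u2 * v0 * v1 * i + 4 * u1 * u2 * v0 ^+ 2 - 2 * u1 * u2 * u3
    - 32 * u1 * u2 * u3 * i - 2 * u1 * u2 * u3 ^+ 2 - 32 * u1 * u2 * u3 ^+ 2 * i - u1 * u2
    ^+ 2 - 16 * u1 * u2 ^+ 2 * i - 2 * u1 * u2 ^+ 2 * u3 - 32 * u1 * u2 ^+ 2 * u3 * i + 8
    * u1 ^+ 2 * i ^+ 2 - u1 ^+ 2 * v3 - 8 * u1 ^+ 2 * v3 * i - u1 ^+ 2 * v3 ^+ 2 - 8 * u1
    ^+ 2 * v3 ^+ 2 * i - u1 ^+ 2 * v2 - 8 * u1 ^+ 2 * v2 * i - u1 ^+ 2 * v2 * v3 - 16 * u1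
    ^+ 2 * v2 * v3 * i - u1 ^+ 2 * v1 - 8 * u1 ^+ 2 * v1 * i - u1 ^+ 2 * v1 * v3 - 16 * u1
    ^+ 2 * v1 * v3 * i - 2 * u1 ^+ 2 * v1 * v2 - 32 * u1 ^+ 2 * v1 * v2 * i - u1 ^+ 2 * v0
    - 8 * u1 ^+ 2 * v0 * i - u1 ^+ 2 * v0 * v3 - 16 * u1 ^+ 2 * v0 * v3 * i + 10 * u1 ^+ 2
    * u3 * i + 32 * u1 ^+ 2 * u3 * i ^+ 2 + 10 * u1 ^+ 2 * u3 ^+ 2 * i + 32 * u1 ^+ 2 * u3
    ^+ 2 * i ^+ 2 - u1 ^+ 2 * u2 - 16 * u1 ^+ 2 * u2 * i - 2 * u1 ^+ 2 * u2 * u3 - 32 * u1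
    ^+ 2 * u2 * u3 * i - 2 * u1 ^+ 2 * u2 ^+ 2 - 32 * u1 ^+ 2 * u2 ^+ 2 * i + 8 * u1 ^+ 3
    * i + u1 ^+ 3 * u3 + 16 * u1 ^+ 3 * u3 * i + 8 * u1 ^+ 4 * i).
pose b1 : int := (v1 * v1 * v2 + v0 * v1 * v1 + u1 * u1 * v2 + u1 * u1 * v0)
  + 2 * (4 * i ^+ 3 + 32 * v3 * i ^+ 3 + 96 * v3 ^+ 2 * i ^+ 3 + 128 * v3 ^+ 3 * i ^+ 3 + 64 *
    v3 ^+ 4 * i ^+ 3 - v2 * v3 * i - 16 * v2 * v3 * i ^+ 2 - 3 * v2 * v3 ^+ 2 * i - 48 *
    v2 * v3 ^+ 2 * i ^+ 2 - 2 * v2 * v3 ^+ 3 * i - 32 * v2 * v3 ^+ 3 * i ^+ 2 - v2 ^+ 2 *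
    v3 - 16 * v2 ^+ 2 * v3 * i - v2 ^+ 2 * v3 ^+ 2 - 16 * v2 ^+ 2 * v3 ^+ 2 * i - 2 * v2
    ^+ 3 - 32 * v2 ^+ 3 * i - 4 * v2 ^+ 3 * v3 - 64 * v2 ^+ 3 * v3 * i - 4 * v2 ^+ 4 - 64
    * v2 ^+ 4 * i - 4 * v1 * i ^+ 2 - 24 * v1 * v3 * i ^+ 2 - 48 * v1 * v3 ^+ 2 * i ^+ 2 -
    32 * v1 * v3 ^+ 3 * i ^+ 2 - v1 * v2 * i - 16 * v1 * v2 * i ^+ 2 + v1 * v2 * v3 + 8 *
    v1 * v2 * v3 * i - 128 * v1 * v2 * v3 * i ^+ 2 + v1 * v2 * v3 ^+ 2 + 8 * v1 * v2 * v3
    ^+ 2 * i - 128 * v1 * v2 * v3 ^+ 2 * i ^+ 2 + v1 * v2 ^+ 2 + 16 * v1 * v2 ^+ 2 * i + 2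
    * v1 * v2 ^+ 2 * v3 + 32 * v1 * v2 ^+ 2 * v3 * i + v1 ^+ 2 * i - 8 * v1 ^+ 2 * i ^+ 2
    + 8 * v1 ^+ 2 * v3 * i + 32 * v1 ^+ 2 * v3 * i ^+ 2 + 8 * v1 ^+ 2 * v3 ^+ 2 * i + 32 *
    v1 ^+ 2 * v3 ^+ 2 * i ^+ 2 + 4 * v1 ^+ 2 * v2 * i - 64 * v1 ^+ 2 * v2 * i ^+ 2 + v1 ^+
    2 * v2 * v3 + 8 * v1 ^+ 2 * v2 * v3 * i - 128 * v1 ^+ 2 * v2 * v3 * i ^+ 2 + 2 * v1 ^+
    2 * v2 ^+ 2 + 32 * v1 ^+ 2 * v2 ^+ 2 * i + 8 * v1 ^+ 3 * i + 64 * v1 ^+ 3 * i ^+ 2 +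
    16 * v1 ^+ 3 * v3 * i + 128 * v1 ^+ 3 * v3 * i ^+ 2 + 8 * v1 ^+ 4 * i + 64 * v1 ^+ 4 *
    i ^+ 2 - 8 * v0 * i ^+ 2 + v0 * v3 * i - 32 * v0 * v3 * i ^+ 2 + 3 * v0 * v3 ^+ 2 * i
    - 48 * v0 * v3 ^+ 2 * i ^+ 2 + 2 * v0 * v3 ^+ 3 * i - 32 * v0 * v3 ^+ 3 * i ^+ 2 + 2 *
    v0 * v2 * v3 + 32 * v0 * v2 * v3 * i + 2 * v0 * v2 * v3 ^+ 2 + 32 * v0 * v2 * v3 ^+ 2
    * i + v0 * v2 ^+ 2 + 16 * v0 * v2 ^+ 2 * i + 2 * v0 * v2 ^+ 2 * v3 + 32 * v0 * v2 ^+ 2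
    * v3 * i + 5 * v0 * v1 * i - 16 * v0 * v1 * i ^+ 2 - v0 * v1 * v3 + 4 * v0 * v1 * v3 *
    i - 64 * v0 * v1 * v3 * i ^+ 2 - v0 * v1 * v3 ^+ 2 + 4 * v0 * v1 * v3 ^+ 2 * i - 64 *
    v0 * v1 * v3 ^+ 2 * i ^+ 2 + 2 * v0 * v1 * v2 + 32 * v0 * v1 * v2 * i + 4 * v0 * v1 *
    v2 * v3 + 64 * v0 * v1 * v2 * v3 * i + 4 * v0 * v1 * v2 ^+ 2 + 64 * v0 * v1 * v2 ^+ 2
    * i - 2 * v0 * v1 ^+ 2 - 3 * v0 * v1 ^+ 2 * v3 - 2 * v0 * v1 ^+ 3 + 6 * v0 ^+ 2 * i -
    v0 ^+ 2 * v3 + 8 * v0 ^+ 2 * v3 * i - v0 ^+ 2 * v3 ^+ 2 + 8 * v0 ^+ 2 * v3 ^+ 2 * i +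
    v0 ^+ 2 * v2 + 16 * v0 ^+ 2 * v2 * i + 2 * v0 ^+ 2 * v2 * v3 + 32 * v0 ^+ 2 * v2 * v3
    * i - 3 * v0 ^+ 2 * v1 - 6 * v0 ^+ 2 * v1 * v3 - 6 * v0 ^+ 2 * v1 ^+ 2 - 2 * v0 ^+ 3 -
    4 * v0 ^+ 3 * v3 - 8 * v0 ^+ 3 * v1 - 4 * v0 ^+ 4 + u3 * v2 * i + 16 * u3 * v2 * i ^+
    2 + 2 * u3 * v2 * v3 * i + 32 * u3 * v2 * v3 * i ^+ 2 + u3 * v2 ^+ 2 + 16 * u3 * v2 ^+
    2 * i - u3 * v1 * v2 - 12 * u3 * v1 * v2 * i + 64 * u3 * v1 * v2 * i ^+ 2 - 4 * u3 *
    v1 ^+ 2 * i - 64 * u3 * v1 ^+ 2 * i ^+ 2 - u3 * v0 * i - 16 * u3 * v0 * i ^+ 2 - 2 *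
    u3 * v0 * v3 * i - 32 * u3 * v0 * v3 * i ^+ 2 - 2 * u3 * v0 * v2 - 32 * u3 * v0 * v2 *
    i + u3 * v0 * v1 + 16 * u3 * v0 * v1 * i + u3 * v0 ^+ 2 + 16 * u3 * v0 ^+ 2 * i + u3
    ^+ 2 * v2 * i + 16 * u3 ^+ 2 * v2 * i ^+ 2 + 2 * u3 ^+ 2 * v2 * v3 * i + 32 * u3 ^+ 2
    * v2 * v3 * i ^+ 2 + u3 ^+ 2 * v2 ^+ 2 + 16 * u3 ^+ 2 * v2 ^+ 2 * i - u3 ^+ 2 * v1 *
    v2 - 12 * u3 ^+ 2 * v1 * v2 * i + 64 * u3 ^+ 2 * v1 * v2 * i ^+ 2 - 4 * u3 ^+ 2 * v1
    ^+ 2 * i - 64 * u3 ^+ 2 * v1 ^+ 2 * i ^+ 2 - u3 ^+ 2 * v0 * i - 16 * u3 ^+ 2 * v0 * i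
    ^+ 2 - 2 * u3 ^+ 2 * v0 * v3 * i - 32 * u3 ^+ 2 * v0 * v3 * i ^+ 2 - 2 * u3 ^+ 2 * v0
    * v2 - 32 * u3 ^+ 2 * v0 * v2 * i + u3 ^+ 2 * v0 * v1 + 16 * u3 ^+ 2 * v0 * v1 * i +
    u3 ^+ 2 * v0 ^+ 2 + 16 * u3 ^+ 2 * v0 ^+ 2 * i + 2 * u2 * v2 ^+ 2 + 32 * u2 * v2 ^+ 2
    * i + 2 * u2 * v1 * i + 32 * u2 * v1 * i ^+ 2 + 4 * u2 * v1 * v3 * i + 64 * u2 * v1 *
    v3 * i ^+ 2 - 2 * u2 * v1 * v2 - 32 * u2 * v1 * v2 * i - 2 * u2 * v0 * v2 - 32 * u2 *
    v0 * v2 * i + 4 * u2 * u3 * v2 ^+ 2 + 64 * u2 * u3 * v2 ^+ 2 * i + 4 * u2 * u3 * v1 *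
    i + 64 * u2 * u3 * v1 * i ^+ 2 + 8 * u2 * u3 * v1 * v3 * i + 128 * u2 * u3 * v1 * v3 *
    i ^+ 2 - 4 * u2 * u3 * v1 * v2 - 64 * u2 * u3 * v1 * v2 * i - 4 * u2 * u3 * v0 * v2 -
    64 * u2 * u3 * v0 * v2 * i - u2 ^+ 2 * v2 - 16 * u2 ^+ 2 * v2 * i - 2 * u2 ^+ 2 * v2 *
    v3 - 32 * u2 ^+ 2 * v2 * v3 * i - 4 * u2 ^+ 2 * v1 * v2 - 64 * u2 ^+ 2 * v1 * v2 * i +
    u2 ^+ 2 * v0 + 16 * u2 ^+ 2 * v0 * i + 2 * u2 ^+ 2 * v0 * v3 + 32 * u2 ^+ 2 * v0 * v3
    * i + u1 * v2 ^+ 2 + 16 * u1 * v2 ^+ 2 * i - u1 * v1 * v2 - 16 * u1 * v1 * v2 * i - 4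
    * u1 * v1 ^+ 2 * i - 64 * u1 * v1 ^+ 2 * i ^+ 2 - 2 * u1 * v0 * v2 - 32 * u1 * v0 * v2
    * i + u1 * v0 * v1 + 16 * u1 * v0 * v1 * i + u1 * v0 ^+ 2 + 16 * u1 * v0 ^+ 2 * i + 2
    * u1 * u3 * v2 ^+ 2 + 32 * u1 * u3 * v2 ^+ 2 * i - 2 * u1 * u3 * v1 * v2 - 32 * u1 *
    u3 * v1 * v2 * i - 8 * u1 * u3 * v1 ^+ 2 * i - 128 * u1 * u3 * v1 ^+ 2 * i ^+ 2 - 4 *
    u1 * u3 * v0 * v2 - 64 * u1 * u3 * v0 * v2 * i + 2 * u1 * u3 * v0 * v1 + 32 * u1 * u3
    * v0 * v1 * i + 2 * u1 * u3 * v0 ^+ 2 + 32 * u1 * u3 * v0 ^+ 2 * i - 2 * u1 * u2 * i -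
    32 * u1 * u2 * i ^+ 2 - 8 * u1 * u2 * v3 * i - 128 * u1 * u2 * v3 * i ^+ 2 - 8 * u1 *
    u2 * v3 ^+ 2 * i - 128 * u1 * u2 * v3 ^+ 2 * i ^+ 2 + 2 * u1 * u2 * v2 + 32 * u1 * u2
    * v2 * i + 4 * u1 * u2 * v2 * v3 + 64 * u1 * u2 * v2 * v3 * i + 8 * u1 * u2 * v2 ^+ 2
    + 128 * u1 * u2 * v2 ^+ 2 * i + u1 ^+ 2 * i + 16 * u1 ^+ 2 * i ^+ 2 + 4 * u1 ^+ 2 * v3
    * i + 64 * u1 ^+ 2 * v3 * i ^+ 2 + 4 * u1 ^+ 2 * v3 ^+ 2 * i + 64 * u1 ^+ 2 * v3 ^+ 2
    * i ^+ 2 - u1 ^+ 2 * v2 - 8 * u1 ^+ 2 * v2 * i - u1 ^+ 2 * v2 * v3 - 16 * u1 ^+ 2 * v2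
    * v3 * i + 4 * u1 ^+ 2 * v1 * i + 64 * u1 ^+ 2 * v1 * i ^+ 2 + 8 * u1 ^+ 2 * v1 * v3 *
    i + 128 * u1 ^+ 2 * v1 * v3 * i ^+ 2 - 2 * u1 ^+ 2 * v1 * v2 - 32 * u1 ^+ 2 * v1 * v2
    * i - u1 ^+ 2 * v0 - 8 * u1 ^+ 2 * v0 * i - u1 ^+ 2 * v0 * v3 - 16 * u1 ^+ 2 * v0 * v3
    * i - 4 * u1 ^+ 2 * v0 * v2 - 64 * u1 ^+ 2 * v0 * v2 * i).
pose q : int := (v1 * v1 * v2 + v0 * v1 * v1 + u1 * u1 * v2 + u1 * u1 * v0)
  + 2 * (2 * v3 * i ^+ 2 + 10 * v3 ^+ 2 * i ^+ 2 + 16 * v3 ^+ 3 * i ^+ 2 + 8 * v3 ^+ 4 * i ^+ 2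
    + 4 * v2 * i ^+ 2 + v2 * v3 * i + 24 * v2 * v3 * i ^+ 2 + 3 * v2 * v3 ^+ 2 * i + 48 *
    v2 * v3 ^+ 2 * i ^+ 2 + 2 * v2 * v3 ^+ 3 * i + 32 * v2 * v3 ^+ 3 * i ^+ 2 - v2 ^+ 2 *
    v3 - 16 * v2 ^+ 2 * v3 * i - v2 ^+ 2 * v3 ^+ 2 - 16 * v2 ^+ 2 * v3 ^+ 2 * i - v2 ^+ 3
    - 16 * v2 ^+ 3 * i - 2 * v2 ^+ 3 * v3 - 32 * v2 ^+ 3 * v3 * i + 2 * v1 * i ^+ 2 - 2 *
    v1 * v3 * i + 4 * v1 * v3 * i ^+ 2 - 6 * v1 * v3 ^+ 2 * i - 4 * v1 * v3 ^+ 3 * i - v1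
    * v2 * i + v1 * v2 * v3 + 16 * v1 * v2 * v3 * i + v1 * v2 * v3 ^+ 2 + 16 * v1 * v2 *
    v3 ^+ 2 * i + v1 * v2 ^+ 2 + 16 * v1 * v2 ^+ 2 * i + 2 * v1 * v2 ^+ 2 * v3 + 32 * v1 *
    v2 ^+ 2 * v3 * i - 2 * v1 ^+ 2 * i - 12 * v1 ^+ 2 * v3 * i - 12 * v1 ^+ 2 * v3 ^+ 2 *
    i + 8 * v1 ^+ 2 * v2 * i + v1 ^+ 2 * v2 * v3 + 16 * v1 ^+ 2 * v2 * v3 * i + 2 * v1 ^+
    2 * v2 ^+ 2 + 32 * v1 ^+ 2 * v2 ^+ 2 * i - 8 * v1 ^+ 3 * i - 16 * v1 ^+ 3 * v3 * i - 8
    * v1 ^+ 4 * i - 3 * v0 * v3 * i - 9 * v0 * v3 ^+ 2 * i - 6 * v0 * v3 ^+ 3 * i - 2 * v0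
    * v2 * i - 5 * v0 * v1 * i + v0 * v1 * v3 - 20 * v0 * v1 * v3 * i + v0 * v1 * v3 ^+ 2
    - 20 * v0 * v1 * v3 ^+ 2 * i + v0 * v1 ^+ 2 - 12 * v0 * v1 ^+ 2 * i + 3 * v0 * v1 ^+ 2
    * v3 - 24 * v0 * v1 ^+ 2 * v3 * i + 2 * v0 * v1 ^+ 3 - 16 * v0 * v1 ^+ 3 * i - 2 * v0
    ^+ 2 * i + v0 ^+ 2 * v3 - 8 * v0 ^+ 2 * v3 * i + v0 ^+ 2 * v3 ^+ 2 - 8 * v0 ^+ 2 * v3
    ^+ 2 * i + 3 * v0 ^+ 2 * v1 + 6 * v0 ^+ 2 * v1 * v3 + 6 * v0 ^+ 2 * v1 ^+ 2 + v0 ^+ 3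
    + 2 * v0 ^+ 3 * v3 + 4 * v0 ^+ 3 * v1 - 2 * u3 * i ^+ 2 - 8 * u3 * v3 * i ^+ 2 - 8 *
    u3 * v3 ^+ 2 * i ^+ 2 - u3 * v2 * i - 2 * u3 * v2 * v3 * i + u3 * v2 ^+ 2 + 16 * u3 *
    v2 ^+ 2 * i + 2 * u3 * v1 * i + 8 * u3 * v1 * i ^+ 2 + 4 * u3 * v1 * v3 * i + 16 * u3
    * v1 * v3 * i ^+ 2 - u3 * v1 * v2 - 20 * u3 * v1 * v2 * i + 4 * u3 * v1 ^+ 2 * i + 3 *
    u3 * v0 * i + 6 * u3 * v0 * v3 * i - 8 * u3 * v0 * v2 * i - u3 * v0 * v1 - u3 * v0 ^+
    2 - 2 * u3 ^+ 2 * i ^+ 2 - 8 * u3 ^+ 2 * v3 * i ^+ 2 - 8 * u3 ^+ 2 * v3 ^+ 2 * i ^+ 2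
    - u3 ^+ 2 * v2 * i - 2 * u3 ^+ 2 * v2 * v3 * i + u3 ^+ 2 * v2 ^+ 2 + 16 * u3 ^+ 2 * v2
    ^+ 2 * i + 2 * u3 ^+ 2 * v1 * i + 8 * u3 ^+ 2 * v1 * i ^+ 2 + 4 * u3 ^+ 2 * v1 * v3 *
    i + 16 * u3 ^+ 2 * v1 * v3 * i ^+ 2 - u3 ^+ 2 * v1 * v2 - 20 * u3 ^+ 2 * v1 * v2 * i +
    4 * u3 ^+ 2 * v1 ^+ 2 * i + 3 * u3 ^+ 2 * v0 * i + 6 * u3 ^+ 2 * v0 * v3 * i - 8 * u3
    ^+ 2 * v0 * v2 * i - u3 ^+ 2 * v0 * v1 - u3 ^+ 2 * v0 ^+ 2 - 4 * u2 * v2 * i - 8 * u2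
    * v2 * v3 * i + 2 * u2 * v1 * i + 4 * u2 * v1 * v3 * i - 16 * u2 * v1 * v2 * i + 8 *
    u2 * v1 ^+ 2 * i + 4 * u2 * v0 * i + 8 * u2 * v0 * v3 * i + 2 * u2 * v0 * v2 - 2 * u2
    * v0 * v1 - 2 * u2 * v0 ^+ 2 - 8 * u2 * u3 * v2 * i - 16 * u2 * u3 * v2 * v3 * i + 4 *
    u2 * u3 * v1 * i + 8 * u2 * u3 * v1 * v3 * i - 32 * u2 * u3 * v1 * v2 * i + 16 * u2 *
    u3 * v1 ^+ 2 * i + 8 * u2 * u3 * v0 * i + 16 * u2 * u3 * v0 * v3 * i + 4 * u2 * u3 *
    v0 * v2 - 4 * u2 * u3 * v0 * v1 - 4 * u2 * u3 * v0 ^+ 2 - 2 * u2 ^+ 2 * i - 8 * u2 ^+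
    2 * v3 * i - 8 * u2 ^+ 2 * v3 ^+ 2 * i + u2 ^+ 2 * v2 + 2 * u2 ^+ 2 * v2 * v3 - 8 * u2
    ^+ 2 * v1 * i - 16 * u2 ^+ 2 * v1 * v3 * i + 4 * u2 ^+ 2 * v1 * v2 + u2 ^+ 2 * v0 + 2
    * u2 ^+ 2 * v0 * v3 + 8 * u2 ^+ 2 * v0 * v2 - 4 * u1 * i ^+ 2 - 16 * u1 * v3 * i ^+ 2
    - 16 * u1 * v3 ^+ 2 * i ^+ 2 + u1 * v2 ^+ 2 + 16 * u1 * v2 ^+ 2 * i + 2 * u1 * v1 * i
    + 4 * u1 * v1 * v3 * i - u1 * v1 * v2 - 16 * u1 * v1 * v2 * i + 4 * u1 * v1 ^+ 2 * i +
    4 * u1 * v0 * i + 8 * u1 * v0 * v3 * i - u1 * v0 * v1 - u1 * v0 ^+ 2 - 8 * u1 * u3 * i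
    ^+ 2 - 32 * u1 * u3 * v3 * i ^+ 2 - 32 * u1 * u3 * v3 ^+ 2 * i ^+ 2 + 2 * u1 * u3 * v2
    ^+ 2 + 32 * u1 * u3 * v2 ^+ 2 * i + 4 * u1 * u3 * v1 * i + 8 * u1 * u3 * v1 * v3 * i -
    2 * u1 * u3 * v1 * v2 - 32 * u1 * u3 * v1 * v2 * i + 8 * u1 * u3 * v1 ^+ 2 * i + 8 *
    u1 * u3 * v0 * i + 16 * u1 * u3 * v0 * v3 * i - 2 * u1 * u3 * v0 * v1 - 2 * u1 * u3 *
    v0 ^+ 2 + 2 * u1 * u2 * i + 8 * u1 * u2 * v3 * i + 8 * u1 * u2 * v3 ^+ 2 * i + 16 * u1
    * u2 * v1 * i + 32 * u1 * u2 * v1 * v3 * i + 32 * u1 * u2 * v1 ^+ 2 * i - 2 * u1 * u2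
    * v0 - 4 * u1 * u2 * v0 * v3 - 8 * u1 * u2 * v0 * v1 - 8 * u1 * u2 * v0 ^+ 2 - u1 ^+ 2
    * v2 - 8 * u1 ^+ 2 * v2 * i - u1 ^+ 2 * v2 * v3 - 16 * u1 ^+ 2 * v2 * v3 * i - 2 * u1
    ^+ 2 * v1 * v2 - 32 * u1 ^+ 2 * v1 * v2 * i + 8 * u1 ^+ 2 * v0 * i + u1 ^+ 2 * v0 * v3
    + 16 * u1 ^+ 2 * v0 * v3 * i).
exists (s - p), b1, p, q; split.
- rewrite /xi_coord /S0coord /T1coord /emul /esub /s /p /b1 /q.
  by congr (_, _, _, _); field.
- rewrite /b1 oddz_addM2 !oddzD !oddzM.
  by move: (oddz u1) (oddz v0) (oddz v1) (oddz v2); do 4 case.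
- rewrite /q oddz_addM2 !oddzD !oddzM.
  by move: (oddz u1) (oddz v0) (oddz v1) (oddz v2); do 4 case.
have -> : s - p + p = s by apply: subrK.
rewrite /s oddz_addM2 !oddzD !oddzM.
by move: (oddz i) (oddz u1) (oddz u2) (oddz u3) (oddz v0) (oddz v1) (oddz v2) (oddz v3);
  do 8 case.
Qed.

Lemma even_index_integral (i v0 v1 v2 v3 : int) :
  exists2 A : int,
    2 * even_index ((1 + 16 * i)%:~R : rat) (v0%:~R + v1%:~R / 2 + v3%:~R / 4 + 1 / 8)
      (v2%:~R + v3%:~R / 4 + 1 / 8) (v1%:~R / 2 + v3%:~R / 4 + 1 / 8) (v3%:~R / 4 + 1 / 8)
      = A%:~R & oddz A -> oddz v0 (+) oddz v2.
Proof.
exists ((v2 * v2 * i + v2 * v2 * v2 + v1 * v2 * v2 + v0 * v2 * v2 + v0 * v0 * i + v0 * v0 * v2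
    + v0 * v0 * v1 + v0 * v0 * v0)
  + 2 * (- i ^+ 3 - 8 * v3 * i ^+ 3 - 24 * v3 ^+ 2 * i ^+ 3 - 32 * v3 ^+ 3 * i ^+ 3 - 16 * v3
    ^+ 4 * i ^+ 3 + 8 * v2 ^+ 2 * i ^+ 2 + 2 * v2 ^+ 2 * v3 * i + 32 * v2 ^+ 2 * v3 * i ^+
    2 + 2 * v2 ^+ 2 * v3 ^+ 2 * i + 32 * v2 ^+ 2 * v3 ^+ 2 * i ^+ 2 - v2 ^+ 3 - 8 * v2 ^+
    3 * i - v2 ^+ 3 * v3 - 16 * v2 ^+ 3 * v3 * i - v2 ^+ 4 - 16 * v2 ^+ 4 * i + v1 * i ^+
    2 + 6 * v1 * v3 * i ^+ 2 + 12 * v1 * v3 ^+ 2 * i ^+ 2 + 8 * v1 * v3 ^+ 3 * i ^+ 2 - v1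
    * v2 * i - 16 * v1 * v2 * i ^+ 2 - 4 * v1 * v2 * v3 * i - 64 * v1 * v2 * v3 * i ^+ 2 -
    4 * v1 * v2 * v3 ^+ 2 * i - 64 * v1 * v2 * v3 ^+ 2 * i ^+ 2 + 8 * v1 * v2 ^+ 2 * i +
    v1 * v2 ^+ 2 * v3 + 16 * v1 * v2 ^+ 2 * v3 * i + 6 * v1 ^+ 2 * i ^+ 2 + 24 * v1 ^+ 2 *
    v3 * i ^+ 2 + 24 * v1 ^+ 2 * v3 ^+ 2 * i ^+ 2 - 2 * v1 ^+ 2 * v2 * i - 32 * v1 ^+ 2 *
    v2 * i ^+ 2 - 4 * v1 ^+ 2 * v2 * v3 * i - 64 * v1 ^+ 2 * v2 * v3 * i ^+ 2 + v1 ^+ 2 *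
    v2 ^+ 2 + 16 * v1 ^+ 2 * v2 ^+ 2 * i + 16 * v1 ^+ 3 * i ^+ 2 + 32 * v1 ^+ 3 * v3 * i
    ^+ 2 + 16 * v1 ^+ 4 * i ^+ 2 + 2 * v0 * i ^+ 2 + 12 * v0 * v3 * i ^+ 2 + 24 * v0 * v3
    ^+ 2 * i ^+ 2 + 16 * v0 * v3 ^+ 3 * i ^+ 2 + 8 * v0 * v2 ^+ 2 * i + v0 * v2 ^+ 2 * v3
    + 16 * v0 * v2 ^+ 2 * v3 * i - v0 * v1 * i + 8 * v0 * v1 * i ^+ 2 - 4 * v0 * v1 * v3 *
    i + 32 * v0 * v1 * v3 * i ^+ 2 - 4 * v0 * v1 * v3 ^+ 2 * i + 32 * v0 * v1 * v3 ^+ 2 *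
    i ^+ 2 + 2 * v0 * v1 * v2 ^+ 2 + 32 * v0 * v1 * v2 ^+ 2 * i - 6 * v0 * v1 ^+ 2 * i -
    12 * v0 * v1 ^+ 2 * v3 * i - 8 * v0 * v1 ^+ 3 * i - 2 * v0 ^+ 2 * i - 6 * v0 ^+ 2 * v3
    * i - 6 * v0 ^+ 2 * v3 ^+ 2 * i - v0 ^+ 2 * v2 - 8 * v0 ^+ 2 * v2 * i - v0 ^+ 2 * v2 *
    v3 - 16 * v0 ^+ 2 * v2 * v3 * i - 4 * v0 ^+ 2 * v1 * i + v0 ^+ 2 * v1 * v3 - 8 * v0 ^+
    2 * v1 * v3 * i + v0 ^+ 2 * v1 ^+ 2 - 8 * v0 ^+ 2 * v1 ^+ 2 * i + v0 ^+ 3 * v3 + 2 *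
    v0 ^+ 3 * v1 + v0 ^+ 4)).
  by rewrite /even_index; field.
rewrite oddz_addM2 !oddzD !oddzM.
by move: (oddz i) (oddz v0) (oddz v1) (oddz v2) (oddz v3); do 5 case.
Qed.

(** Four times the norm is [X ^+ 2 - 8 * Y ^+ 2], with [X = 2 * Z] because [b1] and [q] have equal
    parity. Then [Z ^+ 2 = C + 2 * Y ^+ 2] is odd, and [Z] has the parity of [b0 + p + beta], since
    [b1 ^+ 2 + m * q ^+ 2 = 2 * beta] modulo 4 for [m = 1 + 16 * i]. *)
Lemma index_norm_parity (i b0 b1 p q : int) (C : rat) (beta : bool) :
    C = 1 \/ C = -1 ->
    enorm ((1 + 16 * i)%:~R : rat) (b0%:~R, b1%:~R / 2, p%:~R, q%:~R / 2) = C ->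
    oddz b1 = beta -> oddz q = beta ->
  oddz (b0 + p) = ~~ beta.
Proof.
move=> C1 E b1E qE.
pose X := 2 * b0 ^+ 2 + b1 ^+ 2 + (1 + 16 * i) * (2 * p ^+ 2 + q ^+ 2).
pose Y := b0 * b1 + (1 + 16 * i) * p * q.
have [c [cE c1]] : exists c : int, X ^+ 2 - 8 * Y ^+ 2 = 4 * c /\ oddz c.
  have EX : (X ^+ 2 - 8 * Y ^+ 2)%:~R = 4 * C by rewrite -E /enorm /X /Y; field.
  by case: C1 => CE; [exists 1 | exists (-1)]; split=> //; apply: (@intr_inj rat);
    rewrite EX CE.
have Xhalf : X = 2 * (b0 ^+ 2 + (1 + 16 * i) * p ^+ 2) + (b1 ^+ 2 + (1 + 16 * i) * q ^+ 2).
  by rewrite /X; ring.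
have [x] : exists x, b1 ^+ 2 + (1 + 16 * i) * q ^+ 2 = 4 * x + 2 * beta%:Z.
  have [y1 D1] := oddzE b1; have [y2 D2] := oddzE q; rewrite b1E in D1; rewrite qE in D2.
  exists (y1 ^+ 2 + y1 * beta%:Z + (1 + 16 * i) * (y2 ^+ 2 + y2 * beta%:Z) + 4 * i * beta%:Z).
  by rewrite D1 D2; case: beta {b1E qE D1 D2} => /=; ring.
move=> Dx; rewrite Dx in Xhalf.
pose Z := b0 ^+ 2 + (1 + 16 * i) * p ^+ 2 + 2 * x + beta%:Z.
have XZ : X = 2 * Z by rewrite Xhalf /Z; ring.
have : oddz Z.
  have /(congr1 oddz) : Z ^+ 2 = c + 2 * Y ^+ 2.
    by apply: (@mulfI _ 4) => //; rewrite mulrDr -cE XZ; ring.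
  by rewrite oddz_addM2 oddzX /= c1.
rewrite /Z !oddz_simp /=; case: beta {b1E qE Dx Xhalf Z XZ} => /=;
  by case: (oddz b0) (oddz p) => -[].
Qed.

(* The norm is that from Q(sqrt 2) of a sum of two squares, one of which is
   [m * (p + q / sqrt 2) ^+ 2]. *)
Lemma index_norm_lower (m b0 b1 p q : int) (C : rat) : 0 < m ->
    enorm (m%:~R : rat) (b0%:~R, b1%:~R / 2, p%:~R, q%:~R / 2) = C -> oddz q ->
  m%:~R ^+ 2 <= 4 * C.
Proof.
move=> m_gt0 E q_odd.
have -> : 4 * C = ((2 * b0 ^+ 2 - b1 ^+ 2) ^+ 2 + m ^+ 2 * (2 * p ^+ 2 - q ^+ 2) ^+ 2
    + 2 * m * ((2 * b0 * p - b1 * q) ^+ 2 + 2 * (b0 * q - b1 * p) ^+ 2))%:~R.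
  by rewrite -E /enorm; field.
rewrite -rmorphXn /= ler_int.
have : 1 <= (2 * p ^+ 2 - q ^+ 2) ^+ 2.
  have : oddz ((2 * p ^+ 2 - q ^+ 2) ^+ 2) by rewrite !oddz_simp /= q_odd.
  have := sqr_ge0 (2 * p ^+ 2 - q ^+ 2); move: (_ ^+ 2) => y; rewrite /oddz; lia.
move=> H; have H1 := sqr_ge0 (2 * b0 ^+ 2 - b1 ^+ 2).
have H2 := sqr_ge0 (2 * b0 * p - b1 * q); have H3 := sqr_ge0 (b0 * q - b1 * p).
move: (_ ^+ 2) H1 => y1 H1; move: (_ ^+ 2) H2 => y2 H2.
move: ((b0 * q - b1 * p) ^+ 2) H3 => y3 H3.
by move: ((2 * p ^+ 2 - q ^+ 2) ^+ 2) H => y4 H; nia.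
Qed.

Lemma factor2_int (A k : int) : A * k = 2 -> ~ (k = 1 \/ k = -1) -> A = 1 \/ A = -1.
Proof.
move=> Ak k1.
have k12 : (`|k|%N == 1%N) || (`|k|%N == 2%N).
  have : (`|k| %| 2)%N by apply/dvdnP; exists `|A|%N; rewrite -abszM Ak.
  by rewrite dvdn_divisors // -[divisors 2]/[:: 1; 2]%N !inE.
have k4 : k = 1 \/ k = -1 \/ k = 2 \/ k = -2 by lia.
case: k4 => [Dk|[Dk|Dk]]; [by case: k1; left | by case: k1; right | ].
by case: Dk Ak => ->; lia.
Qed.

Lemma sqr_le_4unit (m : int) (C : rat) :
  C = 1 \/ C = -1 -> m%:~R ^+ 2 <= 4 * C -> m ^+ 2 <= 4.
Proof.
move=> C1 H; have : m%:~R ^+ 2 <= 4 :> rat by case: C1 H => ->; lra.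
by rewrite -rmorphXn -[4]/(4%:~R) ler_int.
Qed.

Lemma definite_norm_neq8 (m x y A : int) : m < -8 -> A = 1 \/ A = -1 ->
  x ^+ 2 - m * y ^+ 2 = 8 * A -> False.
Proof.
move=> m_lt A1 E; have := sqr_ge0 x; have := sqr_ge0 y => y0 x0.
have y2 : y ^+ 2 = 0 by nia.
have x8 : x ^+ 2 = 8 by rewrite y2 in E; lia.
have x_le : x < 3 by nia.
have x_ge : -3 < x by nia.
have {x_le x_ge} : x \in [:: -2; -1; 0; 1; 2] by rewrite !inE; lia.
by rewrite !inE => /or4P[|||/orP[]] /eqP Dx; move: x8; rewrite Dx.
Qed.

Lemma not_monogenic_1mod16 (m i : int) (K : fieldExtType rat) :
    squarefreez m -> m = 1 + 16 * i -> m <> 1 ->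
    irreducible_poly ('X^8 - (m%:~R)%:P : {poly rat}) -> is_pure_field 8 m K ->
  ~ monogenic K.
Proof.
move=> sq_m m_def m1 irr_m pureK monK.
have m_def4 : m = 1 + 4 * (4 * i) by lia.
have m_def8 : m = 1 + 8 * (2 * i) by lia.
have [a0 [a1 [a2 [a3 [a4 [a5 [a6 [a7 [LA [pw pwE] [pt ptE] gen_e3]]]]]]]]] :=
  generator_data m_def4 irr_m pureK monK.
have m_neq0 : m <> 0 by lia.
have m_odd : oddz m by rewrite m_def !oddz_simp.
have l_def : 4 * i = 2 * (2 * i) by lia.
have [u0 [u1 [u2 [u3 [v0 [v1 [v2 [v3 [g [[_ A2 A4 A6] [A1 A3 A5 A7] _]]]]]]]]]] :=
  integral8_coords_even sq_m m_def4 LA l_def.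
have v'A (x : algC) : x ^+ 4 = m%:~R ->
    v0%:~R + v1%:~R * ((1 + x ^+ 2) / 2) + v2%:~R * x
         + v3%:~R * ((1 + x + x ^+ 2 + x ^+ 3) / 4) \in Aint.
  move=> x4; have xA : x \in Aint by apply: (Aint_root_pure _ x4).
  have omA := Aint_omega m_def4 x4; have e2A := Aint_e2 m_def8 x4.
  move: (_ / 2) (_ / 4) omA e2A => om e2 omA e2A.
  by rewrite !(rpredD, rpredM) ?Aint_int.
have vE (x : algC) : lin4 a1 a3 a5 a7 x = v0%:~R + v1%:~R * ((1 + x ^+ 2) / 2) + v2%:~R * x
    + v3%:~R * ((1 + x + x ^+ 2 + x ^+ 3) / 4) + g%:R * ((1 + x + x ^+ 2 + x ^+ 3) / 8).
  by rewrite /lin4 A1 A3 A5 A7; case: (g) => /=; field.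
case: g A1 A2 A3 A4 A5 A6 A7 vE => A1 A2 A3 A4 A5 A6 A7 vE; last first.
  (* With [g] equal to 0 the odd part of the generator is integral. It divides the odd part of the
     element with denominator 8, so that [(1 + x + x ^+ 2 + x ^+ 3) / 8] would be integral. *)
  apply: (half_e2_notin_Aint m_neq0) => x x4.
  have [pe peE] := gen_e3 i m_def.
  have [|q qA ->] := @dvd_odd_part m a0 a1 a2 a3 a4 a5 a6 a7 m_neq0 LA pe x
    ((1 + x + x ^+ 2 + x ^+ 3) / 8) x4.
    have z8 : sqrtC x ^+ 8 = m%:~R by rewrite (exprM _ 2 4) sqrtCK.
    rewrite /= -!peE //; last by rewrite exprNn -signr_odd mul1r.
    by rewrite -{2 3 4}[x]sqrtCK; field.
  by rewrite rpredM // vE mul0r addr0 v'A.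
have [b0 [b1 [p [q [xiE b1P qP b0pP]]]]] := xi_coord_integral i u1 u2 u3 v0 v1 v2 v3.
have C1 := odd_index_pm1 sq_m m_neq0 m_odd LA pwE ptE.
have CE : odd_index m%:~R a1 a2 a3 a4 a5 a6 a7
   = enorm ((1 + 16 * i)%:~R : rat) (b0%:~R, b1%:~R / 2, p%:~R, q%:~R / 2).
  by rewrite -xiE /odd_index A1 A2 A3 A4 A5 A6 A7 m_def.
set C := odd_index _ _ _ _ _ _ _ _ in C1 CE.
have par := index_norm_parity C1 (esym CE) b1P qP.
rewrite {}par in b0pP.
have [k Ak vA] := even_index_unit m_neq0 LA ptE.
have [Ai AiE Ai_odd] := even_index_integral i v0 v1 v2 v3.
have {}AiE : 2 * even_index m%:~R a1 a3 a5 a7 = Ai%:~R by rewrite -AiE A1 A3 A5 A7 m_def.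
have Aik : Ai * k = 2.
  by apply: (@intr_inj rat); rewrite rmorphM /= -AiE -mulrA Ak mulr1.
(* Otherwise the odd part would be integral, and so would its difference with the combination in
   [v'A], which is [(1 + x + x ^+ 2 + x ^+ 3) / 8]. *)
have k_neq1 : k = 1 \/ k = -1 -> False.
  move=> k1; apply: (half_e2_notin_Aint m_neq0) => x x4.
  have := rpredB (vA k1 x x4) (v'A x x4); rewrite vE mul1r addrC addKr.
  by [].
have AiE1 := factor2_int Aik k_neq1.
have v02 : oddz v0 (+) oddz v2 by apply: Ai_odd; case: AiE1 => ->.
(* With [v0 + v2] odd and [t] the parity of [u1 + v1], the two values of the parity of [b0 + p] give
   [~~ t = t && ~~ oddz i]. So [t] is true, and [q] has parity [t]; an even [i] is contradictory. *)
have q_odd : oddz q.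
  move: b0pP; rewrite qP -addbA v02 addbT !andbT.
  by case: (oddz i); case: (_ (+) _).
have [m_le0|m_gt0] := lerP m 0; last first.
  have := @index_norm_lower m b0 b1 p q C m_gt0 _ q_odd; rewrite m_def -CE => /(_ erefl).
  rewrite -m_def => /(sqr_le_4unit C1); move: m_def m1 m_gt0; clear; nia.
(* [dp] and [dq] are four times the two forms squared in [even_index], so that
   [dp ^+ 2 - m * dq ^+ 2] is 16 times it, that is [8 * Ai]. *)
pose dp := - i - 4 * v3 * i - 4 * v3 ^+ 2 * i - v2 - 16 * v2 * i - 2 * v2 * v3
  - 32 * v2 * v3 * i + v1 + 8 * v1 * i + 2 * v1 * v3 + 16 * v1 * v3 * i + 2 * v1 ^+ 2
  + 16 * v1 ^+ 2 * i + v0 + 2 * v0 * v3 + 4 * v0 * v1 + 4 * v0 ^+ 2.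
pose dq := - i - 4 * v3 * i - 4 * v3 ^+ 2 * i - v2 - 2 * v2 * v3 - 4 * v2 ^+ 2 + v1
  + 2 * v1 * v3 + 2 * v1 ^+ 2 + v0 + 2 * v0 * v3 + 4 * v0 * v1.
apply: (@definite_norm_neq8 m dp dq Ai) => //.
  by move: m_def m1 m_le0; clear; lia.
apply: (@intr_inj rat); rewrite [RHS]rmorphM /= -AiE A1 A3 A5 A7 m_def /even_index /dp /dq.
have -> : true%:R = 1 :> rat by [].
by field.
Qed.

Theorem theorem6 (k : int) (r : nat) (m : int) (K : fieldExtType rat)
    (m_def : m = r%:Z + 64%:Z * k)
    (m_sqfree : squarefreez m)
    (m_neq0 : m <> 0) (m_neq1 : m <> 1) (m_neqN1 : m <> -1)
    (K_def : is_pure_field 8 m K) :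
  (r \in [:: 2; 3; 6; 7; 10; 11; 14; 15; 18; 19; 22; 23; 26; 27; 30; 31;
             34; 35; 38; 39; 42; 43; 46; 47; 50; 51; 54; 55; 58; 59; 62; 63]%N ->
     monogenic K)
  /\
  (r \in [:: 1; 5; 9; 13; 17; 21; 25; 29; 33; 37; 41; 45; 49; 53; 57; 61]%N ->
     m <> 5%:Z ->
     (m <> - 3%:Z -> ~ monogenic K) /\ (m = - 3%:Z -> monogenic K)).
Proof.
have irr_m : irreducible_poly ('X^8 - (m%:~R)%:P : {poly rat}).
  exact: irreducible_pure.
split=> [r_in|r_in m_neq5].
  apply: (monogenic_mod4_23 m_sqfree m_neq0 irr_m K_def).
  suff : (r %% 4 == 2)%N || (r %% 4 == 3)%N by lia.
  by apply: (allP (_ : all (fun r => (r %% 4 == 2) || (r %% 4 == 3))%N _)) r_in.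
have r4 : (r %% 4 == 1)%N.
  by apply: (allP (_ : all (fun r => r %% 4 == 1)%N _)) r_in.
split=> [m_neqN3|mN3]; last by rewrite mN3 in irr_m m_sqfree K_def; apply: monogenic_N3.
have [l l_def] : exists l : int, m = 1 + 4 * l by exists ((m - 1) %/ 4)%Z; lia.
have [/dvdzP[i i_def]|no_i] := boolP (16 %| m - 1)%Z.
  by apply: (@not_monogenic_1mod16 m i) => //; lia.
apply: (@not_monogenic_mod16 m l) => // i i_def; case/negP: no_i.
by apply/dvdzP; exists i; lia.
Qed.
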